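(* Let $\tau\in\mathbb{R}$ with $\tau>-1$. Then $E_{\ast}(\tau)$ is a Salem set and $$\dim_H E_{\ast}(\tau)=\dim_F E_{\ast}(\tau)=\min\{4/(1+\tau),\,2\}.$$
   Context: Identify $\mathbb{R}^2$ with $\mathbb{C}$, so that for $q,x\in\mathbb{R}^2$ the product $qx$ is complex multiplication and $\mathbb{Z}^2$ is the ring of Gaussian integers. For $x\in\mathbb{R}^2$, $|x|=\max(|x_1|,|x_2|)$. Define $$E_{\ast}(\tau)=\{x\in\mathbb{R}^2: |qx-r|\le|q|^{-\tau}\text{ for infinitely many }(q,r)\in\mathbb{Z}^2\times\mathbb{Z}^2\text{ with }q\neq0\}.$$ $\dim_H$ denotes Hausdorff dimension. For $A\subseteq\mathbb{R}^2$, let $\mathcal{P}(A)$ be the set of Borel probability measures with compact support contained in $A$, and with $\widehat{\mu}(\xi)=\int e^{-2\pi i(\xi_1x_1+\xi_2x_2)}d\mu(x)$ define the Fourier dimension $$\dim_F A=\sup\{s\in[0,2]:\ \sup_{0\neq\xi\in\mathbb{R}^2}|\widehat{\mu}(\xi)|^2|\xi|^{s}<\infty\text{ for some }\mu\in\mathcal{P}(A)\}.$$ A set $A$ is a Salem set if $\dim_F A=\dim_H A$. *)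

(* Defs.v *)
From HB Require Import structures.
From mathcomp Require Import all_boot all_order all_algebra.
From mathcomp Require Import all_classical all_reals all_analysis.
Set Implicit Arguments. Unset Strict Implicit. Unset Printing Implicit Defensive.
Import Order.TTheory GRing.Theory Num.Theory.
Import numFieldNormedType.Exports.
Local Open Scope classical_set_scope.
Local Open Scope ring_scope.

Section Defs.
Variable R : realType.

Definition supn (x : R * R) : R := Num.max `|x.1| `|x.2|.

Definition cmul (q x : R * R) : R * R :=
  (q.1 * x.1 - q.2 * x.2, q.1 * x.2 + q.2 * x.1).

Definition gauss (q : int * int) : R * R := (q.1%:~R, q.2%:~R).

Definition Estar (tau : R) : set (R * R) :=
  [set x | ~ finite_set [set qr : (int * int) * (int * int) |
      qr.1 != (0, 0) /\
      supn (cmul (gauss qr.1) x - gauss qr.2) <= (supn (gauss qr.1)) `^ (- tau)]].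

(* diameter w.r.t. the sup norm (as an extended real; -oo for the empty set) *)
Definition diam (U : set (R * R)) : \bar R :=
  ereal_sup [set (supn (x - y))%:E | x in U & y in U].

Definition hausdorff_delta (s delta : R) (A : set (R * R)) : \bar R :=
  ereal_inf [set (\sum_(0 <= i <oo) (if U i == set0 then 0%E
                                      else ((fine (diam (U i))) `^ s)%:E))%E
            | U in [set U : nat -> set (R * R) |
                    A `<=` \bigcup_i U i /\ forall i, (diam (U i) <= delta%:E)%E]].

Definition hausdorff_measure (s : R) (A : set (R * R)) : \bar R :=
  ereal_sup [set hausdorff_delta s delta A | delta in [set d : R | 0 < d]].

Definition dimH (A : set (R * R)) : \bar R :=
  ereal_inf [set s%:E | s in [set s : R | 0 <= s /\ hausdorff_measure s A = 0%E]].

Definition msupport (mu : set (R * R) -> \bar R) : set (R * R) :=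
  [set x | forall e : R, 0 < e -> (0 < mu (ball x e))%E].

Definition probP (A : set (R * R)) (mu : probability (R * R)%type R) : Prop :=
  compact (msupport mu) /\ msupport mu `<=` A.

Definition dotp (xi x : R * R) : R := xi.1 * x.1 + xi.2 * x.2.

(* |hat mu (xi)|^2 = (Re hat mu)^2 + (Im hat mu)^2, with
   hat mu(xi) = int exp(-2 pi i xi.x) dmu(x) *)
Definition fourier_sq (mu : probability (R * R)%type R) (xi : R * R) : R :=
  (fine (\int[mu]_x (cos (2 * pi * dotp xi x))%:E)) ^+ 2 +
  (fine (\int[mu]_x (- sin (2 * pi * dotp xi x))%:E)) ^+ 2.

Definition dimF (A : set (R * R)) : \bar R :=
  ereal_sup [set s%:E | s in [set s : R | 0 <= s <= 2 /\
     exists mu : probability (R * R)%type R, probP A mu /\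
       exists C : R, forall xi : R * R, xi != 0 ->
         fourier_sq mu xi * (supn xi) `^ s <= C]].

Definition salem (A : set (R * R)) : Prop := dimF A = dimH A.

End Defs.

(* Main.v *)
(** The upper bound is a Borel-Cantelli argument: [Estar tau] is the set of points
    lying in infinitely many of the sets [|q x - r| <= |q|^-tau], of diameter
    [O(|q|^-(1 + tau))].

    A measure with [|mu^(xi)|^2 = O(|xi|^-s)] supported in [A] forces [dimH A >= s]:
    averaging the kernel [|sum_(j in [0,n)^2) e(j.(x - y))|^2] over [mu x mu] only
    involves [|mu^|^2] at integer frequencies, so that [mu (ball y (c / n))] is at most
    [n^-t] for [t < s], all large dyadic [n], and [y] in a set of measure at least
    [1/2]; the mass distribution principle applies.

    For the lower bound, [mu] is the law of a sum of independent terms [a_k / q_k],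
    where [q_k] is uniform in a set of Gaussian integers of size about [M_k] and [a_k]
    is a sum of many uniform Gaussian integers, scaled so that
    [|a_k / q_k| <= rho_k = M_(k-1)^-alpha] with [alpha] slightly above [1 + tau].
    If [M_k] grows fast, the [k]-th partial sum is a fraction with denominator
    [q_1 ... q_k] of size [M_k^(1 + o(1))], so the sum lies in [Estar tau].  The factor
    of [mu^] at [xi] coming from the [k]-th term is the average over [q] of powers of
    Dirichlet kernels at [xi^* / q]; it is small unless [q] divides a Gaussian integer
    close to [xi^*], and by the divisor bound this happens for [M_k^o(1)] of the
    [M_k^2] moduli. *)

Require Import Defs.
From HB Require Import structures.
From mathcomp Require Import all_boot all_order all_algebra.
From mathcomp Require Import all_classical all_reals all_analysis.
From mathcomp Require Import measurable_realfun ring lra zify.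
Set Implicit Arguments. Unset Strict Implicit. Unset Printing Implicit Defensive.
Import Order.TTheory GRing.Theory Num.Theory.
Import numFieldNormedType.Exports.
From mathcomp Require Import complex.
Import ComplexField.Normc.
Local Open Scope ring_scope.

(** * Powers and trigonometric inequalities *)

(** Where the exponent comes from: there are about [M^2] moduli, and all but [M^o(1)] of them
    contribute a negligible amount, so one term has amplitude at most about [M^-2]. Since [|mu^|^2]
    is to decay like [|z|^-s], the amplitude must be at most [|z|^-sigma] with [sigma = s / 2], up
    to [|z| = M^beta] with [beta] just above [max 1 (1 + tau)]. This asks for [sigma * beta < 2],
    which has room because [s < 4 / (1 + tau)] and [s <= 2]. The scales are sparse, so the ranges
    [[M_k / 2, M_k^beta]] may leave gaps. In a gap the decay must come from the smoothness of the
    next term, and a single uniform numerator gives decay of order 1 only. Adding [N] independent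
    numerators raises the Dirichlet kernels to the power [N]; the same power makes the contribution
    of the harmless moduli negligible. Each frequency is then handled by one factor of [mu^], the
    others being bounded by 1. For Hausdorff measures, an exponent strictly above the dimension
    leaves room for summable weights on the integers, which replace the counting of lattice
    points. *)

Lemma powR_add (R : realType) (x r t : R) : 0 < x -> x `^ (r + t) = x `^ r * x `^ t.
Proof. by move=> x0; rewrite powRD// (gt_eqF x0) implybT. Qed.

(** Absorbs a linear factor into a small exponential: the [k + 1] divisors of a prime power, and the
    logarithm lost in the energy estimate. *)
Lemma poly_powR (R : realType) (eta : R) : 0 < eta ->
  exists2 c : R, 0 < c & forall k : nat, k.+1%:R <= c * (2 `^ eta) ^+ k.
Proof.
move=> e0; have ln2 : 0 < ln (2 : R) by rewrite ln_gt0// ltr1n.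
have el : 0 < eta * ln 2 by rewrite mulr_gt0.
exists (1 + (eta * ln 2)^-1); first by rewrite ltr_wpDl// invr_gt0.
move=> k; rewrite -powR_mulrn ?powR_ge0// -powRrM /powR gt_eqF//.
apply: (@le_trans _ _ ((1 + (eta * ln 2)^-1) * (1 + eta * k%:R * ln 2))); last first.
  by rewrite ler_pM2l ?ltr_wpDl ?invr_gt0// expR_ge1Dx.
have -> : eta * k%:R * ln 2 = k%:R * (eta * ln 2) by ring.
have E : (eta * ln 2)^-1 * (k%:R * (eta * ln 2)) = k%:R.
  by rewrite mulrCA mulVf ?mulr1// gt_eqF.
rewrite mulrDl mul1r mulrDr mulr1 E -natr1.
have : 0 <= (eta * ln 2)^-1 by rewrite invr_ge0 ltW.
have : 0 <= k%:R * (eta * ln 2) by rewrite mulr_ge0// ltW.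
by move: (k%:R : R) (_^-1) (_ * (eta * _)) => x y z; lra.
Qed.

Lemma geo_sum_le (R : realType) (z : R) n : 0 <= z < 1 ->
  \sum_(0 <= k < n) z ^+ k <= (1 - z)^-1.
Proof.
move=> /andP[z0 z1]; rewrite -[leRHS]mul1r ler_pdivlMr ?subr_gt0// mulrC big_mkord.
by rewrite -opprB mulNr -subrX1 opprB gerBl exprn_ge0.
Qed.

Lemma eventually_le_powR (R : realType) (K d : R) : 0 < d ->
  exists M0 : nat, forall M, (M0 <= M)%N -> K <= M%:R `^ d.
Proof.
move=> d0; exists (Num.trunc (`|K| `^ (d^-1))).+1 => M hM.
apply: le_trans (ler_norm K) _.
rewrite -[leLHS](powRr1 (normr_ge0 K)) -[X in _ `^ X <= _](mulVf (lt0r_neq0 d0)) powRrM.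
apply: ge0_ler_powR; rewrite ?nnegrE ?powR_ge0 ?(ltW d0)//.
by apply/ltW/(lt_le_trans (truncnS_gt _)); rewrite ler_nat.
Qed.

Lemma trunc_half_le (R : realType) (y : R) : 2 <= y ->
  y / 2 <= (Num.trunc y)%:R <= y.
Proof.
move=> y2; have y0 : 0 <= y by lra.
by rewrite truncn_le y0 andbT; have := truncnS_gt y; rewrite -natr1; lra.
Qed.

Lemma sin_MVT (R : realType) (x : R) : 0 < x ->
  exists2 c, 0 < c < x & sin x = cos c * x.
Proof.
move=> x0; have [|c cx] := @MVT R sin cos 0 x x0 (fun y _ => is_derive_sin y).
  by apply: continuous_subspaceT => y; exact: continuous_sin.
by rewrite sin0 !subr0 => e; exists c.
Qed.

Lemma normr_sin_le (R : realType) (x : R) : `|sin x| <= `|x|.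
Proof.
wlog x0 : x / 0 < x.
  move=> h; have [x0|x0|->] := ltgtP x 0; last by rewrite sin0 !normr0.
    by rewrite -(normrN x) -(normrN (sin x)) -sinN h// oppr_gt0.
  exact: h.
have [c _ ->] := sin_MVT x0.
by rewrite normrM ler_piMl// cos_max.
Qed.

Lemma cos_ge_half (R : realType) (x : R) : `|x| <= 1 -> 2^-1 <= cos x.
Proof.
move=> x1; have -> : x = (x / 2) *+ 2 by rewrite mulr2n -splitr.
rewrite cos_mulr2n cos2sin2.
have : sin (x / 2) ^+ 2 <= (x / 2) ^+ 2.
  rewrite -[leLHS]real_normK ?num_real// -[leRHS]real_normK ?num_real//.
  by rewrite ler_pXn2r ?nnegrE// normr_sin_le.
have : x ^+ 2 <= 1 by rewrite -real_normK ?num_real// expr_le1.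
by move: (sin _ ^+ 2) => z; rewrite expr_div_n; lra.
Qed.

Lemma normr_cosB_le (R : realType) (x y : R) : `|cos x - cos y| <= `|x - y|.
Proof.
have xE : x = (x + y) / 2 + (x - y) / 2 by field.
have yE : y = (x + y) / 2 - (x - y) / 2 by field.
have -> : cos x - cos y = - (2 * (sin ((x + y) / 2) * sin ((x - y) / 2))).
  by rewrite [in LHS]xE [X in _ - cos X]yE cosD cosB; ring.
rewrite normrN normrM (ger0_norm (ler0n _ 2)) normrM.
have h := normr_sin_le ((x - y) / 2).
have -> : `|x - y| = 2 * (1 * `|(x - y) / 2|) by rewrite mul1r normrM [`|2^-1|]ger0_norm ?invr_ge0// mulrCA mulfV// mulr1.
by rewrite ler_pM2l// ler_pM// sin_max.
Qed.

Lemma normr_sinB_le (R : realType) (x y : R) : `|sin x - sin y| <= `|x - y|.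
Proof.
rewrite -!cosBpihalf; apply: le_trans (normr_cosB_le _ _) _.
by rewrite opprB addrA subrK.
Qed.

(** Dropping the last digit of a mixed-radix expansion. It makes the partial sums of the random
    series, all read off one real number, extend each other. *)
Lemma truncn_mul_div (R : realType) (y : R) B : (0 < B)%N ->
  (Num.trunc (y * B%:R) %/ B = Num.trunc y)%N.
Proof.
move=> B0; have b0 : 0 < B%:R :> R by rewrite ltr0n.
have [y0|y0] := leP 0 y; last first.
  have h (w : R) : w < 0 -> Num.trunc w = 0%N.
    by move=> w0; apply/truncn0Pn; rewrite -ltNge (lt_trans w0).
  by rewrite !h// ?div0n// pmulr_llt0.
apply/esym/truncn_def.
have /andP[h1 h2] := truncn_itv (mulr_ge0 y0 (ltW b0)).
set n := Num.trunc _ in h1 h2 *; apply/andP; split.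
  rewrite -(ler_pM2r b0); apply: le_trans h1; rewrite -natrM ler_nat.
  exact: leq_trunc_div.
rewrite -(ltr_pM2r b0); apply: lt_le_trans h2 _; rewrite -natrM ler_nat.
by rewrite ltn_ceil.
Qed.

(** * Divisors and Gaussian moduli *)

Lemma size_divisors_pfactor p k m : prime p -> (0 < m)%N -> coprime p m ->
  (size (divisors (m * p ^ k)) <= k.+1 * size (divisors m))%N.
Proof.
move=> pp m0 cpm.
have n0 : (0 < m * p ^ k)%N by rewrite muln_gt0 m0 expn_gt0 prime_gt0.
pose t := [seq (p ^ j * e)%N | j <- iota 0 k.+1, e <- divisors m].
have -> : (k.+1 * size (divisors m) = size t)%N by rewrite size_allpairs size_iota.
apply: uniq_leq_size; first exact: divisors_uniq.
move=> d; rewrite -dvdn_divisors// => dn.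
have d0 : (0 < d)%N by exact: dvdn_gt0 dn.
have [e cpe dE] := pfactor_coprime pp d0.
apply/allpairsP; exists (logn p d, e); split.
- have kE : logn p (m * p ^ k) = k.
    by rewrite lognM// ?expn_gt0 ?prime_gt0// logn_coprime// add0n pfactorK.
  by rewrite mem_iota [_.1]/= add0n leq0n andTb ltnS -[leqRHS]kE dvdn_leq_log.
- rewrite [_.2]/= -dvdn_divisors// -(@Gauss_dvdl _ _ (p ^ k)); last by rewrite coprime_sym coprimeXl.
  by apply: dvdn_trans dn; rewrite dE dvdn_mulr.
- by rewrite /= mulnC.
Qed.

(* Peel off the least prime [p]: primes with [p `^ eps >= 2] cost nothing, and the
   exponent [p0 - B] counts the smaller primes that may still occur. *)
Lemma divisor_bound (R : realType) (eps : R) : 0 < eps ->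
  exists2 C : R, 0 < C & forall n, (0 < n)%N -> (size (divisors n))%:R <= C * n%:R `^ eps.
Proof.
move=> e0; have [c c0 hc] := poly_powR e0.
pose K := Num.max 1 c; have K1 : 1 <= K by rewrite le_max lexx.
have K0 : 0 < K by exact: lt_le_trans K1.
pose p0 := (Num.trunc ((2 : R) `^ (eps^-1))).+1.
have p0P p : (p0 <= p)%N -> 2 <= (p%:R : R) `^ eps.
  move=> pp; rewrite -[leLHS](powRr1 (ler0n _ 2)) -[X in _ `^ X <= _](mulVf (lt0r_neq0 e0)) powRrM.
  apply: ge0_ler_powR; rewrite ?nnegrE ?powR_ge0 ?(ltW e0)//.
  apply: ltW; apply: (@lt_le_trans _ _ p0%:R); first exact: truncnS_gt.
  by rewrite ler_nat.
exists (K ^+ p0); first by rewrite exprn_gt0.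
suff main n B : (0 < n)%N -> (forall p, prime p -> (p %| n)%N -> (B <= p)%N) ->
    (size (divisors n))%:R <= K ^+ (p0 - B) * n%:R `^ eps.
  by move=> n n0; have := main n 0%N n0 (fun _ _ _ => leq0n _); rewrite subn0.
elim/ltn_ind: n B => n IH B n0 nB.
have [n1|n1] := leqP n 1.
  have -> : n = 1%N by lia.
  by rewrite powR1 mulr1 (_ : size _ = 1%N)// exprn_ege1.
set p := pdiv n; have pp : prime p by exact: pdiv_prime.
have pn : (p %| n)%N by exact: pdiv_dvd.
have [m cpm nE] := pfactor_coprime pp n0; set k := logn p n in nE.
have k0 : (0 < k)%N by rewrite logn_gt0 mem_primes pp n0 pn.
have m0 : (0 < m)%N by move: n0; rewrite nE muln_gt0 => /andP[].
have p1 : (1 < p)%N by exact: prime_gt1.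
have mn : (m < n)%N.
  by rewrite nE -[X in (X < _)%N]muln1 ltn_pmul2l// -[X in (X < _)%N](expn0 p) ltn_exp2l.
have mB q : prime q -> (q %| m)%N -> (p.+1 <= q)%N.
  move=> pq qm; rewrite ltn_neqAle; apply/andP; split.
    apply: contraTneq cpm => ->; rewrite prime_coprime// negbK; exact: qm.
  by apply: pdiv_min_dvd; [exact: prime_gt1|rewrite nE dvdn_mulr].
have IHm := IH m mn p.+1 m0 mB.
have Bp : (B <= p)%N by exact: nB.
have step : k.+1%:R * K ^+ (p0 - p.+1) <= K ^+ (p0 - B) * (p%:R `^ eps) ^+ k.
  have p2 : (2 : R) `^ eps <= p%:R `^ eps.
    by rewrite ge0_ler_powR ?nnegrE ?(ltW e0)// ler_nat.
  have [pp0|p0p] := ltnP p p0.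
    apply: (@le_trans _ _ (K * (p%:R `^ eps) ^+ k * K ^+ (p0 - p.+1))).
      rewrite ler_wpM2r ?exprn_ge0 ?(ltW K0)//; apply: le_trans (hc k) _.
      rewrite ler_pM ?(ltW c0) ?exprn_ge0 ?powR_ge0//; first by rewrite le_max lexx orbT.
      by rewrite lerXn2r ?nnegrE ?powR_ge0.
    rewrite mulrAC -exprS ler_wpM2r ?exprn_ge0 ?powR_ge0// ler_weXn2l//; lia.
  have -> : (p0 - p.+1 = 0)%N by lia.
  rewrite expr0 mulr1 -[leLHS]mul1r ler_pM ?exprn_ege1//.
  apply: (@le_trans _ _ (2 ^+ k)).
    by rewrite -natrX ler_nat ltn_expl.
  by rewrite lerXn2r ?nnegrE ?powR_ge0// p0P.
rewrite [X in X%:R `^ _]nE natrM powRM// natrX.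
have -> : (p%:R ^+ k) `^ eps = (p%:R `^ eps) ^+ k.
  by rewrite -powR_mulrn// -powRrM mulrC powRrM powR_mulrn ?powR_ge0.
apply: (@le_trans _ _ (k.+1%:R * (size (divisors m))%:R)).
  by rewrite -natrM ler_nat [X in divisors X]nE size_divisors_pfactor.
apply: (@le_trans _ _ (k.+1%:R * (K ^+ (p0 - p.+1) * m%:R `^ eps))).
  by rewrite ler_wpM2l.
rewrite mulrA (mulrC (m%:R `^ _)) [leRHS]mulrA ler_wpM2r ?powR_ge0//.
Qed.

(** The norm of the Gaussian integer [(M + q.1) + i (M + q.2)]. The box is shifted away from 0 so
    that all moduli have absolute value between [M] and [4 M]. *)
Definition box_norm M (q : 'I_M * 'I_M) : nat := ((M + q.1) ^ 2 + (M + q.2) ^ 2)%N.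

(* [a^2 - c^2 = (d - b)(d + b)], so [(b, d)] is determined by the divisor [d - b]. *)
Lemma card_sq_diff M D (a c : 'I_M) :
  (forall n, (0 < n < 4 * M ^ 2)%N -> (size (divisors n) <= D)%N) -> a != c ->
  (#|[set p : 'I_M * 'I_M | (M + a) ^ 2 + (M + p.1) ^ 2 == (M + c) ^ 2 + (M + p.2) ^ 2]| <= D)%N.
Proof.
move=> hD; wlog ac : a c / (c < a)%N => [hw|_].
  move=> neq; have : (c < a)%N || (a < c)%N.
    by rewrite -neq_ltn; apply: contra neq => /eqP e; apply/eqP/val_inj.
  case/orP => [ca|ac]; first exact: hw.
  apply: leq_trans (hw c a ac _); last by rewrite eq_sym.
  have injs : injective (fun p : 'I_M * 'I_M => (p.2, p.1)) by move=> [x y] [z w] [-> ->].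
  rewrite -(card_imset _ injs); apply: subset_leq_card; apply/fintype.subsetP => p /imsetP[[x y]].
  by rewrite !inE /= => /eqP e ->; rewrite /= e.
set S := [set p : 'I_M * 'I_M | _].
set n := ((M + a) ^ 2 - (M + c) ^ 2)%N.
have n0 : (0 < n < 4 * M ^ 2)%N.
  have := ltn_ord a; rewrite /n !expnS !expn0; nia.
apply: leq_trans (hD n n0).
have key (p : 'I_M * 'I_M) : p \in S -> ((p.1 < p.2) /\ (p.2 - p.1) * (2 * M + p.1 + p.2) = n)%N.
  rewrite inE => /eqP; rewrite /n !expnS !expn0 !muln1 => e.
  have lt : (p.1 < p.2)%N by nia.
  split => //; nia.
pose f (p : 'I_M * 'I_M) : nat := (p.2 - p.1)%N.
have finj : {in S &, injective f}.
  move=> [p1 p2] [q1 q2] /key[/= pl pe] /key[/= ql qe]; rewrite /f /= => fe.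
  have : ((q2 - q1) * (2 * M + p1 + p2) == (q2 - q1) * (2 * M + q1 + q2))%N by rewrite qe -fe pe.
  rewrite eqn_pmul2l ?subn_gt0// => /eqP e2.
  have h1 : p1 = q1 by apply: val_inj => /=; lia.
  have h2 : p2 = q2 by apply: val_inj => /=; lia.
  by rewrite h1 h2.
rewrite cardE -(size_map f); apply: uniq_leq_size.
  by rewrite map_inj_in_uniq ?enum_uniq// => p q; rewrite !mem_enum; exact: finj.
move=> d /mapP[p]; rewrite mem_enum => /key[pl pe] ->.
have [n1 _] := andP n0.
by rewrite -dvdn_divisors// -pe dvdn_mulr.
Qed.

Definition box_rep M (q : 'I_M * 'I_M) : nat := #|[set p : 'I_M * 'I_M | box_norm p == box_norm q]|.

(** The sum counts the solutions of [(M + a)^2 + (M + b)^2 = (M + c)^2 + (M + e)^2]. Each [a != c]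
    admits at most [D] pairs [(b, e)]; [a = c] forces [b = e] and admits [M] of them. *)
Lemma sum_box_rep M D :
  (forall n, (0 < n < 4 * M ^ 2)%N -> (size (divisors n) <= D)%N) ->
  (\sum_(q : 'I_M * 'I_M) box_rep q <= M ^ 2 * D.+1)%N.
Proof.
move=> hD.
have -> : (\sum_(q : 'I_M * 'I_M) box_rep q =
   \sum_(a < M) \sum_(c < M) #|[set p : 'I_M * 'I_M | (M + a) ^ 2 + (M + p.1) ^ 2 == (M + c) ^ 2 + (M + p.2) ^ 2]|)%N.
  rewrite -(pair_bigA _ (fun a b => box_rep (a, b))) /=.
  apply: eq_bigr => a _.
  rewrite (eq_bigr (fun b : 'I_M => \sum_(c < M) \sum_(e < M) ((M + a) ^ 2 + (M + b) ^ 2 == (M + c) ^ 2 + (M + e) ^ 2)%N))%N; last first.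
    move=> b _; rewrite /box_rep cardsE -sum1_card big_mkcond /=.
    rewrite pair_bigA /=; apply: eq_bigr => -[c e] _ /=.
    by rewrite unfold_in eqnE eq_sym /box_norm /=; case: (_ == _).
  rewrite exchange_big /=; apply: eq_bigr => c _.
  rewrite cardsE -sum1_card [RHS]big_mkcond pair_bigA /=.
  by apply: eq_bigr => p _; rewrite unfold_in ?eqnE; case: (_ == _).
apply: (@leq_trans (\sum_(a < M) \sum_(c < M) (D + (if a == c then M else 0)))%N).
  apply: leq_sum => a _; apply: leq_sum => c _.
  have [<-|ac] := eqVneq a c; last by rewrite addn0 card_sq_diff.
  apply: leq_trans (leq_addl _ _).
  have injd : injective (fun b : 'I_M => (b, b)) by move=> x y [].
  rewrite -[X in (_ <= X)%N](card_ord M) -cardsT -(card_imset _ injd).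
  apply: subset_leq_card; apply/fintype.subsetP => -[x y]; rewrite inE /= eqn_add2l => /eqP e.
  apply/imsetP; exists x => //; congr pair; apply: val_inj => /=.
  by move: e; rewrite !expnS !expn0 !muln1; nia.
have -> : (\sum_(a < M) \sum_(c < M) (D + (if a == c then M else 0)) = \sum_(a < M) (M * D + M))%N.
  apply: eq_bigr => a _; rewrite big_split /= sum_nat_const card_ord; congr addn.
  by rewrite -big_mkcond /= (big_pred1 a)// => c; rewrite eq_sym.
by rewrite sum_nat_const card_ord; nia.
Qed.

(* By Markov's inequality most [q] share their norm with few others; restricted to such
   [q], divisibility in the Gaussian integers is controlled by the divisors of the norm,
   which avoids unique factorization of Gaussian integers. *)
Lemma thick_moduli (R : realType) (eps : R) : 0 < eps ->
  exists2 C : R, 0 < C & forall M, (0 < M)%N ->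
    exists P : {set 'I_M * 'I_M}, (M ^ 2 <= 2 * #|P|)%N /\
    forall n, (0 < n)%N ->
      (#|[set q in P | (box_norm q %| n)%N]|)%:R <= C * M%:R `^ eps * n%:R `^ eps.
Proof.
move=> e0; have e2 : 0 < eps / 2 by rewrite divr_gt0.
have [c2 c20 hc2] := divisor_bound e2; have [c1 c10 hc1] := divisor_bound e0.
exists (c1 * (2 * (c2 * 4 `^ (eps / 2) + 1))).
  by rewrite !mulr_gt0// addr_gt0// mulr_gt0// powR_gt0.
move=> M M0.
pose D := (\max_(0 <= n < 4 * M ^ 2 | 0 < n) size (divisors n))%N.
have hD n : (0 < n < 4 * M ^ 2)%N -> (size (divisors n) <= D)%N.
  move=> /andP[n0 nM]; rewrite /D.
  apply: (@leq_bigmax_seq _ _ (fun n => (0 < n)%N) (fun n => size (divisors n))) => //.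
  by rewrite mem_index_iota.
have M0' : 0 < M%:R :> R by rewrite ltr0n.
have DM : (D%:R : R) <= c2 * 4 `^ (eps / 2) * M%:R `^ eps.
  have B0 : 0 <= c2 * 4 `^ (eps / 2) * M%:R `^ eps by rewrite !mulr_ge0 ?powR_ge0// ltW.
  rewrite /D big_seq_cond; elim/big_ind : _ => // [x y hx hy|n].
    by rewrite natr_max ge_max hx.
  rewrite mem_index_iota => /andP[/andP[_ nM] n0]; apply: le_trans (hc2 _ n0) _.
  have -> : M%:R `^ eps = ((M ^ 2)%:R : R) `^ (eps / 2).
    by rewrite natrX -powR_mulrn// -powRrM mulrCA mulfV// mulr1.
  rewrite -mulrA ler_pM2l// -powRM// ge0_ler_powR ?nnegrE ?(ltW e2)//.
  by rewrite -natrM ler_nat ltnW.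
pose P := [set q : 'I_M * 'I_M | (box_rep q <= 2 * D.+1)%N].
exists P; split.
  have h := sum_box_rep hD.
  have : (#|~: P| * (2 * D.+1) <= M ^ 2 * D.+1)%N.
    apply: leq_trans h.
    rewrite (bigID (fun q => q \in ~: P)) /=; apply: leq_trans (leq_addr _ _).
    rewrite -sum_nat_const; apply: leq_sum => q; rewrite !inE -ltnNge; exact: ltnW.
  have := cardsC P; rewrite card_prod card_ord !expnS expn0 muln1.
  move: #|P| #|~: P| => x y; nia.
move=> n n0.
apply: (@le_trans _ _ ((size (divisors n) * (2 * D.+1))%:R)).
  rewrite ler_nat.
  rewrite -sum1_card.
  apply: (@leq_trans (\sum_(q in [set q in P | (box_norm q %| n)%N]) \sum_(d <- divisors n | d == box_norm q) 1)%N).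
    apply: leq_sum => q; rewrite inE => /andP[_ qn].
    by rewrite (big_rem (box_norm q)) -?dvdn_divisors//= eqxx leq_addr.
  rewrite (exchange_big_dep xpredT)//=.
  apply: (@leq_trans (\sum_(d <- divisors n) 2 * D.+1)%N).
    apply: leq_sum => d _.
    case: (pickP (fun q : 'I_M * 'I_M => (q \in [set q in P | (box_norm q %| n)%N]) && (d == box_norm q))); last first.
      by move=> none; rewrite big_pred0.
    move=> q0 /andP[]; rewrite inE => /andP[] q0P _ /eqP dE.
    rewrite inE in q0P; apply: leq_trans q0P.
    rewrite /box_rep cardsE -sum1_card big_mkcond [leqRHS]big_mkcond /=.
    apply: leq_sum => q _; rewrite -dE [X in (_ <= (if X then _ else _))%N](_ : _ = (d == box_norm q)).
      by case: (d == _); rewrite ?andbF ?andbT//; case: ifP.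
    by rewrite unfold_in eqnE eq_sym.
  by rewrite big_const_seq count_predT iter_addn addn0 mulnC.
have m1 : 1 <= M%:R `^ eps by rewrite -[leLHS](powRr0 M%:R) ler_powR ?ler1n// ltW.
have hn := hc1 n n0; have y0 := powR_ge0 (n%:R : R) eps.
rewrite natrM.
apply: (@le_trans _ _ ((c1 * n%:R `^ eps) * (2 * (c2 * 4 `^ (eps / 2) + 1) * M%:R `^ eps))).
  apply: ler_pM => //; rewrite natrM -mulrA ler_pM2l// -natr1 mulrDl mul1r.
  by rewrite lerD.
by rewrite le_eqVlt; apply/orP; left; apply/eqP; ring.
Qed.

(** * Exponential sums over Gaussian fractions *)

Section Expi.
Variable R : realType.
Implicit Types (u w : R) (z x y : R[i]).

Definition expi u : R[i] := Complex (cos (2 * pi * u)) (sin (2 * pi * u)).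

Lemma expi0 : expi 0 = 1.
Proof. by rewrite /expi mulr0 cos0 sin0. Qed.

Lemma expiD u w : expi (u + w) = expi u * expi w.
Proof.
by rewrite /expi mulrDr cosD sinD; congr Complex; rewrite addrC mulrC [X in _ + X]mulrC addrC.
Qed.

Lemma normc_expi u : normc (expi u) = 1.
Proof. by rewrite /normc /expi cos2Dsin2 sqrtr1. Qed.

Lemma expiMn u n : expi (n%:R * u) = expi u ^+ n.
Proof.
elim: n => [|n IH]; first by rewrite mul0r expi0 expr0.
by rewrite -natr1 mulrDl mul1r expiD IH exprSr.
Qed.

Lemma expiN u : expi (- u) * expi u = 1.
Proof. by rewrite -expiD addNr expi0. Qed.

Lemma expi_int (m : int) : expi m%:~R = 1.
Proof.
have expi1 : expi 1 = 1.
  by rewrite /expi mulr1 mulr_natl cos2pi sin2pi.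
have h n : expi n%:R = 1 by rewrite -[n%:R]mulr1 expiMn expi1 expr1n.
case: (intP m) => [|n|n]; first by rewrite expi0.
  by rewrite -[_%:~R]/(n.+1%:R) h.
by rewrite mulrNz -[LHS]mulr1 -[X in _ * X](h n.+1) expiN.
Qed.

Lemma normc_sum (I : Type) (r : seq I) (P : pred I) (F : I -> R[i]) :
  normc (\sum_(i <- r | P i) F i) <= \sum_(i <- r | P i) normc (F i).
Proof.
elim/big_ind2 : _ => // [|x a y b hx hy]; first by rewrite normc0.
by apply: le_trans (le_normcD _ _) _; rewrite lerD.
Qed.

Lemma normcX z n : normc (z ^+ n) = normc z ^+ n.
Proof. by elim: n => [|n IH]; rewrite ?expr0 ?normc1// !exprS normcM IH. Qed.

Lemma normc_ge0 z : 0 <= normc z.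
Proof. by case: z => a b; exact: sqrtr_ge0. Qed.

Lemma normc_Re z : `|Re z| <= normc z.
Proof. by case: z => a b /=; rewrite -sqrtr_sqr ler_sqrt ?lerDl ?addr_ge0 ?sqr_ge0. Qed.

Lemma normc_Im z : `|Im z| <= normc z.
Proof. by case: z => a b /=; rewrite -sqrtr_sqr ler_sqrt ?lerDr ?addr_ge0 ?sqr_ge0. Qed.

Lemma normc_le z : normc z <= `|Re z| + `|Im z|.
Proof.
case: z => a b /=; rewrite -[leRHS]ger0_norm ?addr_ge0// -sqrtr_sqr ler_sqrt ?sqr_ge0//.
by rewrite sqrrD !real_normK ?num_real// lerD2r lerDl mulrn_wge0// mulr_ge0.
Qed.

Lemma sqr_normcE z : normc z ^+ 2 = Re z ^+ 2 + Im z ^+ 2.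
Proof. by case: z => a b /=; rewrite sqr_sqrtr// addr_ge0 ?sqr_ge0. Qed.

(** Up to [pi * w = 1] the mean value theorem with [cos >= 1/2] suffices; beyond, monotonicity gives
    at least [sin 1 >= 1/2]. Only the order of magnitude matters. *)
Lemma normr_sin_ge w : `|w| <= 2^-1 -> `|w| <= 2 * `|sin (pi * w)|.
Proof.
wlog w0 : w / 0 < w.
  move=> h; have [w0|w0|->] := ltgtP w 0; last by rewrite mulr0 sin0 normr0 mulr0.
    rewrite -(normrN w) -(normrN (sin _)) -sinN -mulrN; apply: h; by rewrite oppr_gt0.
  exact: h.
have p2 := pi_ge2 R; have pl := pihalf_lt2 R; have pg := pihalf_ge1 R.
rewrite (gtr0_norm w0) => w2.
have pw : pi * w <= pi / 2 by rewrite ler_pM2l ?pi_gt0.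
have pw0 : 0 < pi * w by rewrite mulr_gt0 ?pi_gt0.
have s1 : 2^-1 <= sin (1 : R).
  have [c /andP[c0 c1] ->] := sin_MVT (ltr01 : 0 < (1 : R)).
  by rewrite mulr1 cos_ge_half// ger0_norm ltW.
have [h1|h1] := leP (pi * w) 1.
  have [c /andP[c0 c1] ->] := sin_MVT pw0.
  have cg : 2^-1 <= cos c by apply: cos_ge_half; rewrite ger0_norm; lra.
  rewrite normrM (gtr0_norm pw0) ger0_norm; last by apply: le_trans cg.
  apply: (@le_trans _ _ (2 * (2^-1 * (pi * w)))).
    by rewrite mulrA mulfV// mul1r ler_pMl//; lra.
  by rewrite ler_pM2l// ler_pM2r.
have : sin 1 <= sin (pi * w).
  have := @ltr_sin R (pi * w) 1; rewrite !in_itv/= !leNgt => -> //; first by rewrite -leNgt ltW.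
    by rewrite -!leNgt; lra.
  by rewrite -!leNgt; lra.
by move=> h; have := ler_norm (sin (pi * w)); lra.
Qed.

(** By the double angle formulas the right-hand side equals [2 * |sin (pi * w)|]. *)
Lemma normc_expi_sub1 w : `|w| <= 2^-1 -> `|w| <= normc (expi w - 1).
Proof.
move=> hw; apply: le_trans (normr_sin_ge hw) _.
rewrite /expi /normc /= -{1}[2](@ger0_norm R 2)// -normrM -sqrtr_sqr ler_sqrt ?addr_ge0 ?sqr_ge0//.
rewrite subr0.
have -> : 2 * pi * w = (pi * w) *+ 2 by ring.
rewrite cos_mulr2n sin_mulr2n; have := cos2Dsin2 (pi * w).
move: (cos _) (sin _) => c s h.
have -> : (c ^+ 2 *+ 2 - 1 - 1) ^+ 2 + (c * s *+ 2) ^+ 2 = 4 * (c ^+ 2 - 1) ^+ 2 + 4 * c ^+ 2 * s ^+ 2 by ring.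
have -> : c ^+ 2 = 1 - s ^+ 2 by rewrite -h; ring.
by rewrite le_eqVlt; apply/orP; left; apply/eqP; ring.
Qed.

(** The absolute value of the Dirichlet kernel with [L] terms, divided by its value at the
    integers. *)
Definition dir L u : R := normc (\sum_(j < L) expi (j%:R * u)) / L%:R.

Lemma dir_ge0 L u : 0 <= dir L u.
Proof. by rewrite divr_ge0 ?normc_ge0. Qed.

Lemma dir_le1 L u : dir L u <= 1.
Proof.
case: L => [|L]; first by rewrite /dir invr0 mulr0.
rewrite ler_pdivrMr ?ltr0n// mul1r; apply: le_trans (normc_sum _ _ _) _.
by under eq_bigr do rewrite normc_expi; rewrite sumr_const card_ord.
Qed.

(** Multiplying the geometric sum by [expi w - 1], with [w = u - m], leaves [expi w ^+ L - 1], of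
    modulus at most 2. The product form includes the case where [u] is an integer. *)
Lemma dir_le L u (m : int) : `|u - m%:~R| <= 2^-1 -> dir L u * (L%:R * `|u - m%:~R|) <= 2.
Proof.
case: L => [|L] hu; first by rewrite mul0r mulr0.
rewrite /dir mulrA divfK ?pnatr_eq0//.
have -> : \sum_(j < L.+1) expi (j%:R * u) = \sum_(j < L.+1) (expi (u - m%:~R)) ^+ j.
  apply: eq_bigr => j _; rewrite expiMn; congr (_ ^+ _).
  by rewrite expiD -[RHS]mulr1 -[in RHS](expi_int m) -mulrA expiN mulr1.
set w := u - _ in hu *.
apply: (@le_trans _ _ (normc (\sum_(j < L.+1) expi w ^+ j) * normc (expi w - 1))).
  by rewrite ler_wpM2l ?normc_ge0// normc_expi_sub1.
rewrite -normcM mulrC -subrX1; apply: le_trans (le_normcD _ _) _.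
by rewrite normcN normc1 normcX normc_expi expr1n -[leRHS]/(1 + 1).
Qed.

Lemma nearest_int u : exists m : int, `|u - m%:~R| <= 2^-1.
Proof.
exists (Num.floor (u + 2^-1)); have := floor_itv (u + 2^-1); rewrite intrD.
by move=> /andP[h1 h2]; rewrite ler_norml; lra.
Qed.

End Expi.

Section Family.
Variable R : realType.
Implicit Types (z x y : R[i]).

Definition gint (q : int * int) : R[i] := Complex q.1%:~R q.2%:~R.

Lemma gint_sum (I : Type) (r : seq I) (f g : I -> int) :
  gint (\sum_(i <- r) f i, \sum_(i <- r) g i) = \sum_(i <- r) gint (f i, g i).
Proof.
elim: r => [|i r IH]; first by rewrite !big_nil.
by rewrite !big_cons -IH /gint /= !intrD.
Qed.

(** For [z] the conjugate of a frequency, [Re (z * x)] is its scalar product with [x]. In this form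
    a fraction [a / q] tested at [z] is [a] tested at the complex number [z / q]. *)
Definition chi z x : R[i] := expi (Re (z * x)).

Lemma chiD z x y : chi z (x + y) = chi z x * chi z y.
Proof. by rewrite /chi mulrDr -expiD; congr expi; case: (z * x) (z * y) => a b [c e]. Qed.

Lemma chi0 z : chi z 0 = 1.
Proof. by rewrite /chi mulr0 expi0. Qed.

Lemma chi_sum z (I : Type) (r : seq I) (F : I -> R[i]) :
  chi z (\sum_(i <- r) F i) = \prod_(i <- r) chi z (F i).
Proof. by elim/big_rec2: _ => [|i x y _ <-]; [exact: chi0|exact: chiD]. Qed.

Lemma normc_chi z x : normc (chi z x) = 1.
Proof. exact: normc_expi. Qed.

(* The modulus of the Fourier transform, at the conjugate of [z], of the uniform law
   on [V]. *)
Definition avg_chi (V : seq R[i]) z : R := normc (\sum_(x <- V) chi z x) / (size V)%:R.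

Lemma avg_chi_ge0 V z : 0 <= avg_chi V z.
Proof. by rewrite divr_ge0 ?normc_ge0. Qed.

Lemma avg_chi_le1 V z : avg_chi V z <= 1.
Proof.
case: V => [|x0 V0]; first by rewrite /avg_chi /= invr0 mulr0.
set V := x0 :: V0; rewrite ler_pdivrMr ?ltr0n// mul1r; apply: le_trans (normc_sum _ _ _) _.
by under eq_bigr do rewrite normc_chi; rewrite big_const_seq count_predT iter_addr addr0.
Qed.

Variables (M L N : nat).
Variable P : {set 'I_M * 'I_M}.
Hypothesis M0 : (0 < M)%N.
Hypothesis L0 : (0 < L)%N.
Hypothesis P0 : (0 < #|P|)%N.

Definition modulus (q : 'I_M * 'I_M) : int * int := (Posz (M + q.1), Posz (M + q.2)).

Definition node (q : 'I_M * 'I_M) (g : {ffun 'I_N -> 'I_L * 'I_L}) : int * int :=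
  (\sum_k Posz (g k).1, \sum_k Posz (g k).2).

(** A list with repetitions: the uniform law on it is that of [a / q] with [q] uniform in [P] and
    [a] an independent sum of [N] independent uniform points of the square of side [L]. *)
Definition family : seq R[i] :=
  [seq gint (node p.1 p.2) / gint (modulus p.1)
     | p : ('I_M * 'I_M) * {ffun 'I_N -> 'I_L * 'I_L} in [pred p | p.1 \in P]].

Lemma size_family : size family = (#|P| * (L * L) ^ N)%N.
Proof.
rewrite size_image -[X in _ = (_ * X)%N](_ : #|{: {ffun 'I_N -> 'I_L * 'I_L}}| = _); last first.
  by rewrite card_ffun card_prod !card_ord.
by rewrite -cardX; apply: eq_card => p; rewrite !inE andbT.
Qed.

Let uu z q : R := Re (z / gint (modulus q)).
Let vv z q : R := Im (z / gint (modulus q)).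

(** The [N] summands of the numerator are independent, whence the power [N]. Their two coordinates
    are independent too, and enter through [Re (a * w) = a.1 * Re w - a.2 * Im w] with
    [w = z / q]. *)
Lemma sum_family z : \sum_(x <- family) chi z x =
  \sum_(q in P) ((\sum_(j < L) expi (j%:R * uu z q)) * (\sum_(j < L) expi (j%:R * - vv z q))) ^+ N.
Proof.
rewrite big_image_cond /= -(pair_big_dep (fun q => q \in P) (fun _ _ => true) (fun q g => chi z (gint (node q g) / gint (modulus q)))) /=.
apply: eq_bigr => q _.
have step (g : {ffun 'I_N -> 'I_L * 'I_L}) : chi z (gint (node q g) / gint (modulus q)) =
   \prod_(k < N) (expi ((g k).1%:R * uu z q) * expi ((g k).2%:R * - vv z q)).
  transitivity (\prod_(k < N) chi z (gint (Posz (g k).1, Posz (g k).2) / gint (modulus q))); last first.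
    apply: eq_bigr => k _; rewrite /chi -expiD mulrCA mulrC /uu /vv; congr expi.
    by rewrite /gint /= -!pmulrn; case: (z / _) => a b /=; ring.
  rewrite -chi_sum -mulr_suml; congr (chi z (_ / _)).
  exact: gint_sum.
under eq_bigr do rewrite step.
rewrite -(bigA_distr_bigA (fun (k : 'I_N) (p : 'I_L * 'I_L) => expi (p.1%:R * uu z q) * expi (p.2%:R * - vv z q))) /=.
rewrite prodr_const card_ord; congr (_ ^+ _).
rewrite -(pair_bigA _ (fun a b : 'I_L => expi (a%:R * uu z q) * expi (b%:R * - vv z q))) /=.
by rewrite mulr_suml; apply: eq_bigr => a _; rewrite mulr_sumr.
Qed.

(** The triangle inequality over [q]: no cancellation between different moduli is exploited. *)
Lemma avg_family_le z : avg_chi family z <=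
  (#|P|%:R)^-1 * \sum_(q in P) (dir L (Re (z / gint (modulus q))) * dir L (- Im (z / gint (modulus q)))) ^+ N.
Proof.
rewrite /avg_chi size_family sum_family natrM invfM mulrA [leRHS]mulrC.
have p0 : 0 < #|P|%:R :> R by rewrite ltr0n.
rewrite mulrAC ler_pM2r ?invr_gt0//.
have LN : 0 < ((L * L) ^ N)%:R :> R by rewrite ltr0n expn_gt0 muln_gt0 L0.
rewrite ler_pdivrMr// mulr_suml; apply: le_trans (normc_sum _ _ _) _.
apply: ler_sum => q _; rewrite normcX normcM natrX -exprMn natrM mulrACA /dir !divfK ?pnatr_eq0 -?lt0n//.
Qed.

End Family.

Section Estimates.
Variable R : realType.
Variables (M L N : nat).
Variable P : {set 'I_M * 'I_M}.
Implicit Types (z : R[i]) (q : 'I_M * 'I_M).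

Local Notation gmod q := (gint R (modulus q)).

Lemma gmod_ge q : M%:R <= normc (gmod q).
Proof.
apply: le_trans (normc_Re _); rewrite /gint /= -pmulrn ger0_norm ?ler0n//.
by rewrite ler_nat leq_addr.
Qed.

Lemma gmod_le q : normc (gmod q) <= 4 * M%:R.
Proof.
apply: le_trans (normc_le _) _; rewrite /gint /= -!pmulrn !ger0_norm ?ler0n//.
rewrite -natrD -natrM ler_nat; have := ltn_ord q.1; have := ltn_ord q.2; lia.
Qed.

Hypothesis M0 : (0 < M)%N.
Hypothesis L0 : (0 < L)%N.
Hypothesis P0 : (0 < #|P|)%N.

Let L0' : 0 < L%:R :> R. Proof. by rewrite ltr0n. Qed.
Let M0' : 0 < M%:R :> R. Proof. by rewrite ltr0n. Qed.
Let P0' : 0 < #|P|%:R :> R. Proof. by rewrite ltr0n. Qed.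
Let gmod_gt0 q : 0 < normc (gmod q). Proof. exact: lt_le_trans (gmod_ge q). Qed.
Let gmod_neq0 q : gmod q != 0.
Proof. by apply: contraTneq (gmod_gt0 q) => ->; rewrite normc0 ltxx. Qed.

(** For [|z| <= M / 2] both coordinates of [w = z / q] are within [1/2] of the integer 0. Each
    kernel times [L] times its coordinate is at most 2, so the product of the kernels times
    [L * (|Re w| + |Im w|)] is at most 4, and [|w| >= |z| / (4 M)]. *)
Lemma avg_family_small z : 0 < normc z <= M%:R / 2 ->
  avg_chi (family R L N P) z <= (16 * M%:R / (L%:R * normc z)) ^+ N.
Proof.
move=> /andP[z0 zM]; apply: le_trans (avg_family_le _ _ _ _) _ => //.
set T := _ ^+ N.
apply: (@le_trans _ _ ((#|P|%:R)^-1 * \sum_(q in P) T)); last first.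
  by rewrite sumr_const -[X in _ * X]mulr_natl mulKf// gt_eqF.
rewrite ler_pM2l ?invr_gt0//; apply: ler_sum => q _.
rewrite lerXn2r ?nnegrE ?mulr_ge0 ?dir_ge0 ?invr_ge0 ?mulr_ge0 ?ler0n ?normc_ge0//.
set w := z / _.
have wn : normc w = normc z / normc (gmod q) by rewrite normcM normcV.
have w2 : normc w <= 2^-1.
  rewrite wn ler_pdivrMr//; apply: le_trans zM _.
  by rewrite mulrC ler_pM2l ?invr_gt0// gmod_ge.
have wge : normc z <= 4 * M%:R * normc w.
  by rewrite wn mulrA ler_pdivlMr// mulrC ler_pM2r// gmod_le.
have dl (u : R) : `|u| <= 2^-1 -> dir L u * (L%:R * `|u|) <= 2.
  by move=> hu; have := @dir_le R L u 0; rewrite subr0; apply.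
have hu := dl _ (le_trans (normc_Re w) w2).
have hv : dir L (- Im w) * (L%:R * `|Im w|) <= 2.
  by rewrite -[X in _ * (_ * X)]normrN; apply: dl; rewrite normrN (le_trans (normc_Im w) w2).
have wle := normc_le w.
rewrite ler_pdivlMr ?mulr_gt0//.
have d1 := dir_le1 L (Re w); have d2 := dir_le1 L (- Im w).
have e1 := dir_ge0 L (Re w); have e2 := dir_ge0 L (- Im w).
apply: (@le_trans _ _ (dir L (Re w) * dir L (- Im w) * (L%:R * (4 * M%:R * (`|Re w| + `|Im w|))))).
  have h : normc z <= 4 * M%:R * (`|Re w| + `|Im w|).
    by apply: le_trans wge _; rewrite ler_wpM2l// mulr_ge0// ltW.
  by apply: ler_wpM2l; [exact: mulr_ge0|rewrite ler_pM2l].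
have -> : dir L (Re w) * dir L (- Im w) * (L%:R * (4 * M%:R * (`|Re w| + `|Im w|))) =
  4 * M%:R * ((dir L (Re w) * (L%:R * `|Re w|)) * dir L (- Im w) +
     (dir L (- Im w) * (L%:R * `|Im w|)) * dir L (Re w)) by ring.
have -> : 16 * M%:R = 4 * M%:R * (2 * 1 + 2 * 1) :> R by ring.
have L0w := ltW L0'.
rewrite ler_wpM2l ?mulr_ge0//.
by apply: lerD; apply: ler_pM => //; rewrite ?mulr_ge0 ?normc_ge0.
Qed.

(** As both kernels are at most 1, each of them exceeds the threshold, so the coordinates of [z / q]
    lie within [eta] of integers [m1], [m2]. Take [l = q * (m1 + i m2)]: it is within
    [2 * eta * |q|] of [z], and its norm is a multiple of the norm of [q]. *)
Lemma bad_modulus z (eta : R) q : 0 < eta ->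
  (2 / (L%:R * eta)) ^+ N < (dir L (Re (z / gmod q)) * dir L (- Im (z / gmod q))) ^+ N ->
  exists2 l : int * int, normc (z - gint R l) <= 8 * M%:R * eta &
   exists k : nat, (`|l.1| ^ 2 + `|l.2| ^ 2 = box_norm q * k)%N.
Proof.
move=> eta0 hb; set w := z / gmod q in hb *.
have Leta : 0 < L%:R * eta by rewrite mulr_gt0.
have near u : 2 / (L%:R * eta) < dir L u -> exists m : int, `|u - m%:~R| <= eta.
  have [m hm] := nearest_int u; exists m; rewrite leNgt; apply/negP => lt.
  move: H; apply/negP; rewrite -leNgt ler_pdivlMr//.
  apply: le_trans (dir_le L hm); rewrite ler_wpM2l ?dir_ge0// ler_pM2l//; exact: ltW.
have hb' : 2 / (L%:R * eta) < dir L (Re w) * dir L (- Im w).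
  rewrite ltNge; apply/negP => h; move: hb; apply/negP; rewrite -leNgt.
  have h0 : 0 <= 2 / (L%:R * eta) by rewrite divr_ge0// ltW.
  by rewrite lerXn2r ?nnegrE// mulr_ge0 ?dir_ge0.
have [m1 hm1] : exists m : int, `|Re w - m%:~R| <= eta.
  by apply: near; apply: lt_le_trans hb' _; rewrite ler_piMr ?dir_ge0 ?dir_le1.
have [m2 hm2] : exists m : int, `|Im w - m%:~R| <= eta.
  have [|m hm] := near (- Im w).
    by apply: lt_le_trans hb' _; rewrite ler_piMl ?dir_ge0 ?dir_le1.
  by exists (- m); rewrite rmorphN opprK -normrN opprD.
pose a : int := (modulus q).1; pose b : int := (modulus q).2.
pose l := (a * m1 - b * m2, a * m2 + b * m1).
have lE : gint R l = gmod q * gint R (m1, m2).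
  rewrite /gint /l /=; congr Complex; first by rewrite rmorphB !rmorphM.
  by rewrite rmorphD !rmorphM.
exists l.
  have -> : z - gint R l = gmod q * (w - gint R (m1, m2)).
    by rewrite mulrBr lE /w mulrCA divff// mulr1.
  rewrite normcM; apply: (@le_trans _ _ (4 * M%:R * (2 * eta))); last first.
    by rewrite le_eqVlt; apply/orP; left; apply/eqP; ring.
  apply: ler_pM; rewrite ?normc_ge0 ?gmod_le//.
  apply: le_trans (normc_le _) _; rewrite mulr_natl mulr2n.
  by case: (w) hm1 hm2 => x y /= h1 h2; rewrite lerD.
exists (`|m1| ^ 2 + `|m2| ^ 2)%N; apply/eqP; rewrite -eqz_nat.
have sq (i : int) : Posz (`|i| ^ 2)%N = i ^+ 2.
  by rewrite -mulnn PoszM abszE -expr2 real_normK ?num_real.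
have bE : Posz (box_norm q) = a ^+ 2 + b ^+ 2.
  by rewrite /box_norm PoszD -!mulnn !PoszM !expr2.
rewrite PoszD !sq PoszM PoszD !sq bE /l /=; apply/eqP; ring.
Qed.

(* A modulus [q] for which the Dirichlet kernels are not small divides a Gaussian
   integer [l] within [8 M eta] of [z]; the second term counts such pairs [(q, l)]. *)
Lemma avg_family_large (K eps : R) z (eta : R) : 0 < K -> 0 < eps ->
  (forall n, (0 < n)%N ->
      (#|[set q in P | (box_norm q %| n)%N]|)%:R <= K * n%:R `^ eps) ->
  0 < eta -> 8 * M%:R * eta < normc z ->
  avg_chi (family R L N P) z <= (2 / (L%:R * eta)) ^+ N +
    (#|P|%:R)^-1 * ((16 * M%:R * eta + 2) ^+ 2 * (K * ((normc z + 8 * M%:R * eta) ^+ 2) `^ eps)).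
Proof.
move=> K0 eps0 hP eta0; set r := 8 * M%:R * eta => rz.
have r0 : 0 < r by rewrite !mulr_gt0.
apply: le_trans (avg_family_le _ _ _ _) _ => //.
pose T q := (dir L (Re (z / gmod q)) * dir L (- Im (z / gmod q))) ^+ N.
set E := (2 / (L%:R * eta)) ^+ N.
have E0 : 0 <= E by rewrite exprn_ge0// divr_ge0// mulr_ge0// ltW.
pose bad := [set q in P | E < T q].
apply: (@le_trans _ _ (E + (#|P|%:R)^-1 * (#|bad|)%:R)).
  apply: (@le_trans _ _ ((#|P|%:R)^-1 * \sum_(q in P) (E + (q \in bad)%:R))).
    rewrite ler_pM2l ?invr_gt0//; apply: ler_sum => q qP; rewrite -/(T q).
    rewrite inE qP /=; case: ltP => h; last by rewrite addr0.
    apply: ler_wpDl => //; apply: exprn_ile1; first by rewrite mulr_ge0 ?dir_ge0.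
    by rewrite mulr_ile1 ?dir_ge0 ?dir_le1.
  rewrite big_split /= sumr_const mulrDr -[X in _ * X + _]mulr_natl mulKf ?gt_eqF// lerD2l.
  rewrite ler_pM2l ?invr_gt0// -natr_sum ler_nat -sum1_card big_mkcond [leqRHS]big_mkcond.
  by apply: leq_sum => q _; rewrite inE; case: (q \in P) => //=; case: ltP.
rewrite lerD2l ler_pM2l ?invr_gt0//.
(* Each coordinate of [l] lies in an interval of length [2 * r]. Its offset from the floor of the
   left end is less than [2 * r + 1], the extra 1 paying for the rounding. *)
pose B := (Num.trunc (2 * r + 1)).+1.
pose f1 := Num.floor (Re z - r); pose f2 := Num.floor (Im z - r).
pose nn (k : 'I_B * 'I_B) : nat := (absz (f1 + Posz k.1)%R ^ 2 + absz (f2 + Posz k.2)%R ^ 2)%N.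
(* The norm of [l] is positive because [r < normc z]; this matters, as 0 is divisible by every
   norm. *)
pose S := [pred k | (0 < nn k)%N && ((nn k)%:R <= (normc z + r) ^+ 2)].
have hbad q : q \in bad -> exists2 k, k \in S & (box_norm q %| nn k)%N.
  rewrite inE => /andP[_ hq]; have [l lz [m hm]] := bad_modulus eta0 hq.
  rewrite -/r in lz.
  have l1 : `|Re z - l.1%:~R| <= r by apply: le_trans lz; apply: le_trans (normc_Re _); case: (z).
  have l2 : `|Im z - l.2%:~R| <= r by apply: le_trans lz; apply: le_trans (normc_Im _); case: (z).
  have idx (y : R) (i : int) : `|y - i%:~R| <= r -> exists k : 'I_B, Num.floor (y - r) + Posz k = i.
    rewrite ler_norml => /andP[h1 h2].
    have fi : Num.floor (y - r) <= i.
      by rewrite -(ler_int R); apply: le_trans (floor_le _) _; lra.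
    have [k kE] : exists k : nat, i = Num.floor (y - r) + Posz k.
      exists (absz (i - Num.floor (y - r))).
      by rewrite gez0_abs ?subr_ge0// subrKC.
    have kB : (k < B)%N.
      rewrite -(ltr_nat R); apply: lt_trans (truncnS_gt _).
      have := floorD1_gt (y - r); rewrite intrD.
      by move: h1 h2; rewrite kE intrD -[(Posz k)%:~R]pmulrn; lra.
    by exists (Ordinal kB).
  have [k1 k1E] := idx _ _ l1; have [k2 k2E] := idx _ _ l2.
  have nE : nn (k1, k2) = (`|l.1| ^ 2 + `|l.2| ^ 2)%N by rewrite /nn /= k1E k2E.
  have nR : (nn (k1, k2))%:R = normc (gint R l) ^+ 2.
    rewrite nE sqr_normcE natrD !natrX /gint /=.
    by rewrite !natr_absz !intr_norm !real_normK ?num_real.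
  exists (k1, k2); last by rewrite nE hm dvdn_mulr.
  have lz' : normc (gint R l - z) <= r by rewrite -normcN opprB.
  rewrite inE; apply/andP; split.
    rewrite -(ltr_nat R) nR exprn_gt0//.
    have := le_normcD (gint R l) (z - gint R l); rewrite subrKC; lra.
  rewrite nR lerXn2r ?nnegrE ?normc_ge0 ?addr_ge0 ?normc_ge0 ?(ltW r0)//.
  by have := le_normcD z (gint R l - z); rewrite subrKC; lra.
apply: (@le_trans _ _ (\sum_(k in S) (#|[set q in P | (box_norm q %| nn k)%N]|)%:R)).
  rewrite -natr_sum ler_nat -sum1_card.
  apply: (@leq_trans (\sum_(q in bad) \sum_(k in S | (box_norm q %| nn k)%N) 1)%N).
    apply: leq_sum => q /hbad[k kS qk].
    by rewrite (bigD1 k)/= ?kS ?qk// leq_addr.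
  rewrite (exchange_big_dep (fun k => k \in S))/=; last by move=> q k _ /andP[].
  apply: leq_sum => k kS; rewrite -[leqRHS]sum1_card big_mkcond [leqRHS]big_mkcond.
  apply: leq_sum => q _; move: (kS); rewrite !inE => -> /=.
  by case: (q \in P); rewrite //= andbC; case: (_ %| _)%N; rewrite //=; case: ltP.
apply: (@le_trans _ _ (\sum_(k in S) (K * ((normc z + r) ^+ 2) `^ eps))).
  apply: ler_sum => k; rewrite inE => /andP[k0 kz]; apply: le_trans (hP _ k0) _.
  by rewrite ler_pM2l// ge0_ler_powR ?nnegrE ?(ltW eps0) ?exprn_ge0 ?addr_ge0 ?normc_ge0 ?(ltW r0).
rewrite sumr_const -[leLHS]mulr_natl; apply: ler_wpM2r; first by rewrite mulr_ge0 ?powR_ge0 ?(ltW K0).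
apply: (@le_trans _ _ ((B * B)%:R)).
  by rewrite ler_nat -[X in (_ <= X * X)%N](card_ord B) -card_prod max_card.
have -> : 16 * M%:R * eta = 2 * r by rewrite /r; ring.
have r2 : 0 <= 2 * r + 2 by rewrite addr_ge0// mulr_ge0// ltW.
rewrite natrM -expr2 lerXn2r ?nnegrE//.
rewrite /B -natr1 (_ : 2 * r + 2 = (2 * r + 1) + 1); last by ring.
have r1 : 0 <= 2 * r + 1 by rewrite addr_ge0// mulr_ge0// ltW.
by rewrite lerD2r truncn_le.
Qed.

End Estimates.

(** * Choice of the parameters at one scale *)

Definition gauss_frac (R : realType) (H : R) (x : R[i]) := exists q a : int * int,
  [/\ H <= normc (gint R q), normc (gint R q) <= 4 * H & x = gint R a / gint R q].

Lemma family_gauss_frac (R : realType) M L N (P : {set 'I_M * 'I_M}) (rho : R) :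
  (0 < M)%N -> 2 * N%:R * L%:R <= rho * M%:R ->
  forall x, x \in family R L N P -> normc x <= rho /\ gauss_frac M%:R x.
Proof.
move=> M0 hL x /fintype.imageP[[q g] _ ->]; rewrite [X in gint R (node X _)]/= [X in gint R (node _ X)]/= [X in gint R (modulus X)]/=; split; last first.
  exists (modulus q), (node q g); split; [exact: gmod_ge|exact: gmod_le|by []].
have m0 : 0 < M%:R :> R by rewrite ltr0n.
have g0 := lt_le_trans m0 (gmod_ge R q).
rewrite normcM normcV ler_pdivrMr//.
apply: (@le_trans _ _ (2 * N%:R * L%:R)); last first.
  have rm0 : 0 <= rho * M%:R by rewrite (le_trans _ hL)// !mulr_ge0.
  apply: le_trans hL _; rewrite ler_wpM2l ?gmod_ge//; move: rm0.
  by rewrite pmulr_lge0.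
apply: le_trans (normc_le _) _; rewrite /gint /node /=.
have sum_le (f : 'I_N -> 'I_L) : `|(\sum_k Posz (f k))%:~R| <= N%:R * L%:R :> R.
  rewrite -intr_norm -natrM pmulrn ler_int.
  have -> : \sum_k Posz (f k) = Posz (\sum_k f k)%N.
    by elim/big_rec2: _ => // k y1 y2 _ ->; rewrite PoszD.
  rewrite ger0_norm// lez_nat -[X in (_ <= X * _)%N]card_ord -sum_nat_const.
  by apply: leq_sum => k _; exact: ltnW.
by have := sum_le (fun k => (g k).1); have := sum_le (fun k => (g k).2); lra.
Qed.

(** [N] and [K] are fixed before [rho], since the construction learns [rho] only from the preceding
    scale; just the threshold for [M] depends on it. The third clause is the divisor argument, the
    fourth the smoothness of the numerators, which takes over below [M / 2]. *)
Lemma decaying_family (R : realType) (sigma alpha : R) (N1 : nat) :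
  0 <= sigma -> 1 <= alpha -> sigma * alpha < 2 ->
  exists2 N, (N1 <= N)%N & exists2 K : R, 0 < K &
  forall rho : R, 0 < rho -> exists M0 : nat, forall M, (M0 <= M)%N ->
  exists V : seq R[i], [/\ (0 < size V)%N,
    forall x, x \in V -> normc x <= rho /\ gauss_frac M%:R x,
    forall z, M%:R / 2 <= normc z <= M%:R `^ alpha ->
      avg_chi V z <= normc z `^ (- sigma) &
    forall z, 0 < normc z <= M%:R / 2 -> avg_chi V z <= (K / (rho * normc z)) ^+ N].
Proof.
move=> s0 a1 sa.
pose d := 2 - sigma * alpha; have d0 : 0 < d by rewrite subr_gt0.
have a0 : 0 < 3 + 2 * alpha by lra.
(* The exponents of [M] lost below add up to [eps * (3 + 2 * alpha) = d / 2]: twice [eps] for the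
   square searched for [l], once for [thick_moduli], and [2 * alpha * eps] for the norm of [l],
   which is at most [4 * M^(2 * alpha)]. The other [d / 2] absorbs the constant [K1]. *)
pose eps := d / (2 * (3 + 2 * alpha)).
have eps0 : 0 < eps by rewrite divr_gt0// mulr_gt0.
have epsE : eps * (3 + 2 * alpha) = d / 2 by rewrite /eps; field; rewrite gt_eqF.
have eps1 : eps < 1.
  rewrite /eps ltr_pdivrMr ?mulr_gt0// mul1r /d.
  have : 0 <= sigma * alpha by rewrite mulr_ge0//; lra.
  lra.
have [C C0 hC] := thick_moduli eps0.
(* With [eps * N >= 2] the harmless moduli contribute [O((M^-eps)^N)], hence [O(M^-2)]. *)
pose N := (N1 + (Num.trunc (2 / eps)).+1)%N.
have N0 : (0 < N)%N by rewrite /N addnS.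
have N0' : 0 < N%:R :> R by rewrite ltr0n.
have Neps : 2 <= eps * N%:R.
  rewrite mulrC -ler_pdivrMr//; apply/ltW/(lt_le_trans (truncnS_gt _)).
  by rewrite ler_nat leq_addl.
exists N; first exact: leq_addr.
exists (64 * N%:R); first by rewrite mulr_gt0.
move=> rho rho0.
pose kap := 32 * N%:R / rho.
have kap0 : 0 < kap by rewrite divr_gt0// mulr_gt0.
pose K1 := 2 ^+ N + 2 * ((2 * kap + 2) ^+ 2 * (C * 4 `^ eps)).
have e1 : 0 < 1 - eps by rewrite subr_gt0.
have [Ma hMa] := eventually_le_powR (4 * N%:R / rho) ltr01.
have [Mb hMb] := eventually_le_powR (4 * kap + 1) e1.
have d2 : 0 < d / 2 by rewrite divr_gt0.
have [Mc hMc] := eventually_le_powR K1 d2.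
exists (maxn 1 (maxn Ma (maxn Mb Mc))) => M; rewrite !geq_max => /and4P[M0 /hMa la /hMb lb /hMc lc].
have m0 : 0 < M%:R :> R by rewrite ltr0n.
have m1 : 1 <= M%:R :> R by rewrite ler1n.
rewrite (powRr1 (ltW m0)) in la.
(* The largest [L] with [2 * N * L <= rho * M], which keeps the fractions in the disc of radius
   [rho]. *)
pose L := Num.trunc (rho * M%:R / (2 * N%:R)).
have y2 : 2 <= rho * M%:R / (2 * N%:R).
  rewrite ler_pdivlMr ?mulr_gt0// -ler_pdivrMl//; apply: le_trans la.
  by rewrite le_eqVlt; apply/orP; left; apply/eqP; rewrite mulrC; ring.
have /andP[L2 L1] := trunc_half_le y2; rewrite -/L in L1 L2.
have L0' : 0 < L%:R :> R by apply: lt_le_trans L2; rewrite divr_gt0// (lt_le_trans _ y2).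
have L0 : (0 < L)%N by rewrite -(ltr0n R).
have [P [Pcard hP]] := hC M M0.
have P0 : (0 < #|P|)%N.
  by have : (0 < 2 * #|P|)%N by [apply: leq_trans Pcard; rewrite expn_gt0 M0]; rewrite muln_gt0.
exists (family R L N P); split.
- by rewrite size_family muln_gt0 P0 expn_gt0 muln_gt0 L0.
- apply: family_gauss_frac => //; rewrite mulrC -ler_pdivlMr// mulr_gt0//.
- move=> z /andP[z1 z2].
  have me0 : 0 < M%:R `^ eps by rewrite powR_gt0.
  (* Since [L >= rho * M / (4 * N)], this is the value for which [L * eta >= M^eps]; the search
     radius [8 * M * eta] is then only a constant times [M^eps]. *)
  pose eta := 4 * N%:R / rho * (M%:R `^ eps / M%:R).
  have eta0 : 0 < eta by rewrite !mulr_gt0 ?invr_gt0.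
  have rE : 8 * M%:R * eta = kap * M%:R `^ eps.
    by rewrite /eta /kap; field; rewrite !gt_eqF.
  have rM : 4 * (kap * M%:R `^ eps) <= M%:R.
    have h : 4 * kap <= M%:R `^ (1 - eps) by lra.
    apply: (@le_trans _ _ (M%:R `^ (1 - eps) * M%:R `^ eps)); first by rewrite mulrA ler_pM2r.
    by rewrite -powR_add// subrK powRr1// ltW.
  have rz : 8 * M%:R * eta < normc z by rewrite rE; lra.
  have Cm0 : 0 < C * M%:R `^ eps by rewrite mulr_gt0.
  apply: le_trans (avg_family_large N M0 L0 P0 Cm0 eps0 hP eta0 rz) _.
  have Leta : M%:R `^ eps <= L%:R * eta.
    apply: (@le_trans _ _ (rho * M%:R / (2 * N%:R) / 2 * eta)); last by rewrite ler_pM2r.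
    by rewrite le_eqVlt; apply/orP; left; apply/eqP; rewrite /eta; field; rewrite !gt_eqF.
  have Le0 : 0 < L%:R * eta by rewrite mulr_gt0.
  have t1 : (2 / (L%:R * eta)) ^+ N <= 2 ^+ N * M%:R `^ (- 2%:R).
    rewrite exprMn ler_pM2l ?exprn_gt0// exprVn powRN lef_pV2 ?posrE ?powR_gt0 ?exprn_gt0 ?Le0//.
    apply: (@le_trans _ _ ((M%:R `^ eps) ^+ N)).
      by rewrite -powR_mulrn ?powR_ge0// -powRrM ler_powR.
    by rewrite lerXn2r ?nnegrE ?powR_ge0// (le_trans _ Leta)// powR_ge0.
  have t2 : (#|P|%:R)^-1 <= 2 * M%:R `^ (- 2%:R) :> R.
    rewrite powRN powR_mulrn// -[2]invrK -invfM lef_pV2 ?posrE ?ltr0n ?mulr_gt0 ?invr_gt0 ?exprn_gt0//.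
    by rewrite ler_pdivrMl// -natrX -natrM ler_nat.
  have ma1 : 1 <= M%:R `^ eps by rewrite -[leLHS](powRr0 M%:R) ler_powR// ltW.
  have mal : M%:R <= M%:R `^ alpha by exact: le1r_powR.
  have t3 : (16 * M%:R * eta + 2) ^+ 2 <= (2 * kap + 2) ^+ 2 * M%:R `^ (eps * 2%:R).
    rewrite powRrM powR_mulrn ?powR_ge0// -exprMn.
    have -> : 16 * M%:R * eta = 2 * (kap * M%:R `^ eps) by rewrite -rE; ring.
    have h1 : 0 <= 2 * (kap * M%:R `^ eps) + 2 by rewrite addr_ge0// mulr_ge0// mulr_ge0// ltW.
    have h2 : 2 * (kap * M%:R `^ eps) + 2 <= (2 * kap + 2) * M%:R `^ eps.
      have -> : (2 * kap + 2) * M%:R `^ eps = 2 * (kap * M%:R `^ eps) + 2 * M%:R `^ eps by ring.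
      by rewrite lerD2l ler_peMr.
    by rewrite lerXn2r ?nnegrE// (le_trans h1).
  have t4 : ((normc z + 8 * M%:R * eta) ^+ 2) `^ eps <= 4 `^ eps * M%:R `^ (2 * alpha * eps).
    have -> : M%:R `^ (2 * alpha * eps) = ((M%:R `^ alpha) ^+ 2) `^ eps.
      by rewrite -powR_mulrn ?powR_ge0// -!powRrM; congr powR; ring.
    rewrite -powRM ?exprn_ge0 ?powR_ge0//.
    have -> : 4 * (M%:R `^ alpha) ^+ 2 = (2 * M%:R `^ alpha) ^+ 2 by ring.
    have r0 : 0 <= 8 * M%:R * eta by rewrite rE mulr_ge0 ?powR_ge0 ?(ltW kap0).
    have zz : 0 <= normc z + 8 * M%:R * eta by rewrite addr_ge0// normc_ge0.
    have h : normc z + 8 * M%:R * eta <= 2 * M%:R `^ alpha by rewrite rE; lra.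
    have h2 : (normc z + 8 * M%:R * eta) ^+ 2 <= (2 * M%:R `^ alpha) ^+ 2.
      by rewrite lerXn2r ?nnegrE ?mulr_ge0 ?powR_ge0.
    by apply: ge0_ler_powR; rewrite ?nnegrE ?sqr_ge0 ?(ltW eps0).
  have tot : M%:R `^ (- 2%:R) * M%:R `^ (d / 2) * M%:R `^ (d / 2) = M%:R `^ (- (sigma * alpha)).
    by rewrite -!powR_add//; congr powR; rewrite /d; field.
   apply: (@le_trans _ _ (M%:R `^ (- (sigma * alpha)))); last first.
    have -> : - (sigma * alpha) = alpha * - sigma by ring.
    have z0 : 0 < normc z by apply: lt_le_trans z1; rewrite divr_gt0.
    rewrite powRrM !(powRN _ sigma) lef_pV2 ?posrE ?powR_gt0//.
    by rewrite ge0_ler_powR ?nnegrE ?powR_ge0// normc_ge0.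
  apply: (@le_trans _ _ (K1 * (M%:R `^ (- 2%:R) * M%:R `^ (d / 2)))); last first.
    by rewrite -tot mulrC ler_wpM2l ?mulr_ge0 ?powR_ge0.
  rewrite /K1 [leRHS]mulrDl; apply: lerD.
    apply: le_trans t1 _; rewrite ler_wpM2l ?exprn_ge0// ler_peMr ?powR_ge0//.
    by rewrite -[leLHS](powRr0 M%:R) ler_powR// ltW.
  have -> : 2 * ((2 * kap + 2) ^+ 2 * (C * 4 `^ eps)) * (M%:R `^ (- 2%:R) * M%:R `^ (d / 2)) =
    (2 * M%:R `^ (- 2%:R)) * (((2 * kap + 2) ^+ 2 * M%:R `^ (eps * 2%:R)) * (C * M%:R `^ eps * (4 `^ eps * M%:R `^ (2 * alpha * eps)))).
    have -> : M%:R `^ (d / 2) = M%:R `^ (eps * 2%:R) * M%:R `^ eps * M%:R `^ (2 * alpha * eps).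
      by rewrite -!powR_add// -epsE; congr powR; ring.
    by ring.
  have Cm1 := ltW Cm0.
  have c4 : 0 <= C * M%:R `^ eps * ((normc z + 8 * M%:R * eta) ^+ 2) `^ eps.
    by rewrite mulr_ge0 ?powR_ge0.
  apply: ler_pM => //; first by rewrite mulr_ge0 ?sqr_ge0.
  by apply: ler_pM => //; [exact: sqr_ge0|rewrite ler_pM2l].
- move=> z hz; apply: le_trans (avg_family_small N M0 L0 P0 hz) _.
  have /andP[z0 _] := hz.
  rewrite lerXn2r ?nnegrE ?divr_ge0 ?mulr_ge0 ?(ltW m0) ?(ltW L0') ?(ltW z0) ?(ltW rho0)//.
  rewrite ler_pdivrMr ?mulr_gt0// mulrAC ler_pdivlMr ?mulr_gt0//.
  have -> : 16 * M%:R * (rho * normc z) = 64 * N%:R * ((rho * M%:R / (2 * N%:R) / 2) * normc z).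
    by field; rewrite gt_eqF.
  by rewrite ler_pM2l ?mulr_gt0// ler_pM2r.
Qed.

Local Open Scope classical_set_scope.

(** * Covers of limsup sets *)

Lemma ler_sum_sub (R : numDomainType) (T : eqType) (f : T -> R) (s t : seq T) :
  (forall i, 0 <= f i) -> uniq s -> {subset s <= t} ->
  \sum_(i <- s) f i <= \sum_(i <- t) f i.
Proof.
move=> f0; elim: s t => [|a s IH] t /=.
  by move=> _ _; rewrite big_nil sumr_ge0.
move=> /andP[ans us] sub; rewrite big_cons.
rewrite (perm_big _ (perm_to_rem (sub a (mem_head _ _)))) big_cons lerD2l.
apply: IH => // i si; have := sub i; rewrite in_cons si orbT => /(_ isT).
have ia : i != a by apply: contraNneq ans => <-.
by rewrite (perm_mem (perm_to_rem (sub a (mem_head _ _)))) in_cons (negbTE ia).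
Qed.

(** Summability is expressed throughout by a common bound for sums over duplicate-free lists. For
    product weights, such a list is enlarged to a rectangle. *)
Lemma ler_sum_pair (R : numDomainType) (T1 T2 : eqType) (f : T1 -> R) (g : T2 -> R)
    (A B : R) :
  (forall i, 0 <= f i) -> (forall i, 0 <= g i) ->
  (forall s, uniq s -> \sum_(i <- s) f i <= A) ->
  (forall s, uniq s -> \sum_(i <- s) g i <= B) ->
  forall s : seq (T1 * T2), uniq s -> \sum_(i <- s) f i.1 * g i.2 <= A * B.
Proof.
move=> f0 g0 fA gB s us.
pose s1 := undup [seq i.1 | i <- s]; pose s2 := undup [seq i.2 | i <- s].
apply: (@le_trans _ _ (\sum_(i <- [seq (x, y) | x <- s1, y <- s2]) f i.1 * g i.2)).
  apply: ler_sum_sub => //; first by move=> i; exact: mulr_ge0.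
  by move=> [x y] xy; apply/allpairsP; exists (x, y); split=> //=;
    rewrite mem_undup; apply/mapP; exists (x, y).
rewrite big_allpairs_dep /=.
under eq_bigr do rewrite -mulr_sumr.
rewrite -mulr_suml ler_pM ?sumr_ge0 ?fA ?gB ?undup_uniq//.
Qed.

(** Telescoping against the integral: [d * (n + 2)^-(1 + d) <= (n + 1)^-d - (n + 2)^-d], obtained
    from [ln (1 + x) <= x] and [exp x >= 1 + x]. *)
Lemma pseries_bounded (R : realType) (d : R) : 0 < d ->
  exists G, forall n, \sum_(k < n) (k.+1%:R : R) `^ (- (1 + d)) <= G.
Proof.
move=> d0; exists (1 + d^-1) => n.
have main : \sum_(k < n.+1) (k.+1%:R : R) `^ (- (1 + d))
    <= 1 + d^-1 * (1 - (n.+1%:R) `^ (- d)).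
  elim: n => [|n IH].
    by rewrite big_ord_recr big_ord0 /= !powR1 subrr mulr0 addr0 add0r.
  rewrite big_ord_recr /=; apply: le_trans (lerD IH (lexx _)) _.
  rewrite -addrA lerD2l.
  have n1 : 0 < n.+1%:R :> R by rewrite ltr0n.
  have n2 : 0 < n.+2%:R :> R by rewrite ltr0n.
  have key : (n.+2%:R : R) `^ (- d) * (1 + d / n.+2%:R) <= (n.+1%:R : R) `^ (- d).
    rewrite -[X in _ <= X](@divfK _ ((n.+2%:R : R) `^ (- d))) ?gt_eqF ?powR_gt0//.
    rewrite mulrC ler_pM2r ?powR_gt0//.
    rewrite -powRN opprK /powR !gt_eqF// -expRD.
    apply: le_trans (expR_ge1Dx _); rewrite lerD2l.
    rewrite mulNr -mulrN -mulrDr ler_pM2l//.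
    have : ln (n.+1%:R / n.+2%:R) <= - (n.+2%:R)^-1 :> R.
      have -> : n.+1%:R / n.+2%:R = 1 + (- (n.+2%:R)^-1) :> R.
        by apply: (mulIf (lt0r_neq0 n2)); rewrite mulrDl mulNr !mulVf ?gt_eqF// divfK ?gt_eqF// mul1r -(natrB _ (_ : 1 <= n.+2)%N)// subSS subn0.
      by apply: le_ln1Dx; rewrite ltrN2 invf_lt1// ltr1n.
    by rewrite ln_div ?posrE// => h; rewrite addrC -lerN2 opprB.
  rewrite opprD powRD ?pnatr_eq0 ?implybT// (powRN _ 1) powRr1 ?ler0n//.
  have d0' := lt0r_neq0 d0.
  have -> : d^-1 * (1 - n.+1%:R `^ (- d)) + (n.+2%:R)^-1 * n.+2%:R `^ (- d)
    = d^-1 * (1 - n.+1%:R `^ (- d) + d / n.+2%:R *  n.+2%:R `^ (- d)).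
    by field; rewrite gt_eqF.
  rewrite ler_pM2l ?invr_gt0//; move: key.
  by move: (n.+1%:R `^ _) (n.+2%:R `^ _) (d / _) => X1 X2 X3; lra.
apply: (@le_trans _ _ (\sum_(k < n.+1) (k.+1%:R : R) `^ (- (1 + d)))).
  by rewrite big_ord_recr /= lerDl powR_ge0.
apply: le_trans main _; rewrite lerD2l ler_piMr ?invr_ge0 ?ltW//.
Qed.

(** A summable weight on the integers. Bounding [diam^s] by a product of such weights replaces a
    count of the lattice points of each size. *)
Definition int_weight (R : realType) (d : R) (a : int) : R := ((`|a|%N).+1%:R) `^ (- (1 + d)).

Lemma int_weight_ge0 (R : realType) (d : R) a : 0 <= int_weight d a.
Proof. exact: powR_ge0. Qed.

Lemma int_weight_bounded (R : realType) (d : R) : 0 < d ->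
  exists G, forall s : seq int, uniq s -> \sum_(a <- s) int_weight d a <= G.
Proof.
move=> d0; have [G hG] := pseries_bounded d0; exists (G + G) => s us.
pose w (k : nat) : R := (k.+1%:R) `^ (- (1 + d)).
have wb (t : seq nat) : uniq t -> \sum_(k <- t) w k <= G.
  move=> ut; apply: le_trans (hG (\max_(k <- t) k).+1).
  rewrite -(big_mkord xpredT w); apply: ler_sum_sub => //.
    by move=> i; exact: powR_ge0.
  move=> i it; rewrite mem_index_iota ltnS leq0n /=.
  exact: (@leq_bigmax_seq _ _ xpredT id).
rewrite (bigID (fun a : int => 0 <= a)) /= lerD//.
  rewrite -big_filter; set t := seq.filter _ _.
  rewrite (_ : \sum_(i <- t) _ = \sum_(k <- [seq absz a | a <- t]) w k); last by rewrite big_map.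
  apply: wb; rewrite map_inj_in_uniq ?filter_uniq// => x y.
  by rewrite !mem_filter => /andP[x0 _] /andP[y0 _] xy; lia.
rewrite -big_filter; set t := seq.filter _ _.
rewrite (_ : \sum_(i <- t) _ = \sum_(k <- [seq absz a | a <- t]) w k); last by rewrite big_map.
apply: wb; rewrite map_inj_in_uniq ?filter_uniq// => x y.
by rewrite !mem_filter => /andP[x0 _] /andP[y0 _] xy; lia.
Qed.

Lemma supn_ge0 (R : realType) (x : R * R) : 0 <= supn x.
Proof. by rewrite /supn le_max normr_ge0. Qed.

Lemma diam_le (R : realType) (U : set (R * R)) (d : R) :
  (forall x y, U x -> U y -> supn (x - y) <= d) -> (diam U <= d%:E)%E.
Proof. by move=> h; apply: ge_ereal_sup => _ [x Ux [y Uy <-]]; rewrite lee_fin h. Qed.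

Lemma diam_ge (R : realType) (U : set (R * R)) x y : U x -> U y ->
  ((supn (x - y))%:E <= diam U)%E.
Proof. by move=> Ux Uy; apply: ereal_sup_ubound; exists x => //; exists y. Qed.

Lemma diam_ge0 (R : realType) (U : set (R * R)) x : U x -> (0 <= diam U)%E.
Proof.
by move=> Ux; apply: le_trans (diam_ge Ux Ux); rewrite lee_fin supn_ge0.
Qed.

Lemma fine_diam_le (R : realType) (U : set (R * R)) (d : R) x : U x ->
  (forall x y, U x -> U y -> supn (x - y) <= d) -> 0 <= fine (diam U) <= d.
Proof.
move=> Ux h; have h1 := diam_le h; have h0 := diam_ge0 Ux.
have fU : diam U \is a fin_num by rewrite ge0_fin_numE// (le_lt_trans h1)// ltry.
by rewrite fine_ge0//= -lee_fin fineK.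
Qed.

Lemma hausdorff_measure_eq0 (R : realType) (s : R) (A : set (R * R)) :
  (forall e delta : R, 0 < e -> 0 < delta ->
    (hausdorff_delta s delta A <= e%:E)%E) -> hausdorff_measure s A = 0%E.
Proof.
move=> h; apply/eqP; rewrite eq_le; apply/andP; split.
  apply: ge_ereal_sup => _ [d d0 <-]; apply/lee_addgt0Pr => e e0.
  by rewrite add0e h.
apply: (@le_trans _ _ (hausdorff_delta s 1 A)); last first.
  by apply: ereal_sup_ubound; exists 1 => //=.
apply: le_ereal_inf_tmp => _ [U _ <-]; apply: nneseries_ge0 => n _ _.
by case: ifP => // _; rewrite lee_fin powR_ge0.
Qed.

(** A point lying in infinitely many [V i] lies in some member of every tail of the enumeration, so
    each tail covers [A], and the tails of the series of [d i ^ s] tend to 0. *)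
Lemma hausdorff_cantelli (R : realType) (T : countType) (s : R) (A : set (R * R))
   (V : T -> set (R * R)) (d : T -> R) (B : R) :
  0 < s -> (forall i, 0 <= d i) ->
  (forall i x y, V i x -> V i y -> supn (x - y) <= d i) ->
  (forall r : seq T, uniq r -> \sum_(i <- r) d i `^ s <= B) ->
  (forall x, A x -> ~ finite_set [set i | V i x]) ->
  hausdorff_measure s A = 0%E.
Proof.
move=> s0 d0 dV sumB infA; apply: hausdorff_measure_eq0 => e delta e0 delta0.
pose u n : R := oapp (fun i => d i `^ s) 0 (pickle_inv n).
have u0 n : 0 <= u n by rewrite /u; case: pickle_inv => //= i; exact: powR_ge0.
have uB n : \sum_(0 <= k < n) u k <= B.
  suff -> : \sum_(0 <= k < n) u k = \sum_(i <- pmap pickle_inv (index_iota 0 n)) d i `^ s.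
    by apply: sumB; apply: (@pmap_uniq _ _ _ (@pickle T)); [exact: pickle_invK | exact: iota_uniq].
  elim: (index_iota 0 n) => [|a r IH] /=; first by rewrite !big_nil.
  by rewrite big_cons IH /u; case: pickle_inv => [i|] //=; rewrite ?big_cons ?add0r.
have tail : (\sum_(N <= k <oo) (u k)%:E)%E @[N --> \oo] --> 0%E.
  apply: nneseries_tail_cvg => [|k _]; last by rewrite lee_fin.
  apply: (@le_lt_trans _ _ B%:E); last exact: ltry.
  apply: lime_le; first by apply: is_cvg_nneseries => n _ _; rewrite lee_fin.
  by apply: nearW => n; rewrite sumEFin lee_fin.
(* A tail at most [delta^s] bounds each of its terms, hence each diameter in it by [delta]. *)
pose eta := Num.min e (delta `^ s).
have eta0 : 0 < eta by rewrite lt_min e0 powR_gt0.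
have [n hn] : exists n, (\sum_(n <= k <oo) (u k)%:E <= eta%:E)%E.
  have /fine_cvgP[f1 /cvgr0_norm_lt h] := tail; have f2 := h _ eta0.
  near \oo => n; exists n.
  have fn : (\sum_(n <= k <oo) (u k)%:E)%E \is a fin_num by near: n.
  rewrite -(fineK fn) lee_fin; apply/ltW/(le_lt_trans (ler_norm _)).
  by near: n.
(* Early indices and numbers that encode nothing get the empty set, which costs 0. *)
pose U j := if (n <= j)%N then (if pickle_inv j is Some i then V i else set0) else set0.
apply: ereal_inf_le.
exists (\sum_(0 <= i <oo) (if U i == set0 then 0%E
                           else ((fine (diam (U i))) `^ s)%:E))%E; last first.
  apply: le_trans (_ : (eta%:E <= _)%E); last by rewrite lee_fin ge_min lexx.
  apply: le_trans hn.
  rewrite (@nneseries_split _ _ 0 n); last first.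
    by move=> k _; case: ifP => // _; rewrite lee_fin powR_ge0.
  rewrite big_nat_cond big1 ?add0e ?add0n; last first.
    move=> i; rewrite andbT => /andP[_ iltn].
    by rewrite /U leqNgt iltn /= eqxx.
  apply: lee_nneseries => [k _ _|k _].
    by case: ifP => // _; rewrite lee_fin powR_ge0.
  case: ifP => [_|/negbT/set0P[x]]; first by rewrite lee_fin.
  rewrite /U /u; case: ifP => // _; case: pickle_inv => //= i Vx.
  have /andP[h0 h1] := fine_diam_le Vx (dV i).
  by rewrite lee_fin ge0_ler_powR ?nnegrE// ltW.
exists U => //; split.
  move=> x Ax; apply: contrapT => nU; apply: (infA x Ax).
  apply: (@sub_finite_set _ _ (@pickle T @^-1` `I_n)); last first.
    by apply: finite_preimage; [move=> i j _ _; exact: (pcan_inj pickleK)|exact: finite_II].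
  move=> i /= Vi; rewrite ltnNge; apply/negP => ni.
  by apply: nU; exists (pickle i) => //; rewrite /U ni pickleK_inv.
move=> i; rewrite /U; case: ifP => ni; last first.
  by apply: diam_le => x y [].
case E: (pickle_inv i) => [j|]; last by apply: diam_le => x y [].
apply: diam_le => x y Vx Vy; apply: le_trans (dV _ _ _ Vx Vy) _.
have : u i <= delta `^ s.
  apply: (@le_trans _ _ eta); last by rewrite ge_min lexx orbT.
  rewrite -lee_fin; apply: le_trans hn.
  apply: le_trans (@nneseries_lim_ge _ (fun k => (u k)%:E) xpredT n i.+1 _); last by move=> k _ _; rewrite lee_fin.
  by rewrite big_nat_recr//= leeDr// sume_ge0// => k _; rewrite lee_fin.
rewrite /u E /= => h; rewrite leNgt; apply/negP => lt.
have := gt0_ltr_powR s0 (_ : delta \in Num.nneg) (_ : d j \in Num.nneg) lt.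
by rewrite !nnegrE d0 ltW// => /(_ isT isT); rewrite ltNge h.
Unshelve. all: by end_near. Qed.

Lemma supn_cmul_le (R : realType) (q x : R * R) :
  supn (cmul q x) <= 2 * (supn q * supn x).
Proof.
have h1 : forall y : R * R, `|y.1| <= supn y by move=> y; rewrite /supn le_max lexx.
have h2 : forall y : R * R, `|y.2| <= supn y by move=> y; rewrite /supn le_max lexx orbT.
have h (a b c d : R) : `|a| <= supn q -> `|b| <= supn x -> `|c| <= supn q -> `|d| <= supn x ->
    `|a * b + c * d| <= 2 * (supn q * supn x).
  move=> ha hb hc hd; apply: le_trans (ler_normD _ _) _; rewrite !normrM mulr_natl mulr2n.
  by rewrite lerD// ler_pM.
by rewrite {1}/supn ge_max /= -mulNr !h ?normrN.
Qed.

(** The sup norm is not multiplicative. Multiplication of [q x] by the conjugate of [q] gives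
    [(q.1^2 + q.2^2) x], of norm at least [|q|^2 |x|], to which the upper bound [supn_cmul_le]
    applies. *)
Lemma supn_cmul_ge (R : realType) (q x : R * R) :
  supn q * supn x <= 2 * supn (cmul q x).
Proof.
have [->|q0] := eqVneq (supn q) 0; first by rewrite mul0r mulr_ge0 ?supn_ge0.
have qp : 0 < supn q by rewrite lt_neqAle eq_sym q0 supn_ge0.
rewrite -(ler_pM2l qp).
have := supn_cmul_le (q.1, - q.2) (cmul q x).
have -> : cmul (q.1, - q.2) (cmul q x) = ((q.1 ^+ 2 + q.2 ^+ 2) * x.1, (q.1 ^+ 2 + q.2 ^+ 2) * x.2).
  by congr pair => /=; ring.
have -> : supn (q.1, - q.2) = supn q by rewrite /supn /= normrN.
rewrite {1}/supn /= !normrM -maxr_pMr ?normr_ge0// => h.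
rewrite [leRHS]mulrCA; apply: le_trans h; rewrite mulrA ler_wpM2r ?supn_ge0//.
rewrite ger0_norm ?addr_ge0 ?sqr_ge0// -expr2 /supn.
case: (leP `|q.1| `|q.2|) => _; rewrite real_normK ?num_real// ?lerDl ?lerDr sqr_ge0//.
Qed.

Lemma supnD (R : realType) (x y : R * R) : supn (x + y) <= supn x + supn y.
Proof.
rewrite {1}/supn ge_max /=; apply/andP; split; apply: le_trans (ler_normD _ _) _;
by rewrite lerD// /supn le_max lexx ?orbT.
Qed.

Lemma supnN (R : realType) (x : R * R) : supn (- x) = supn x.
Proof. by rewrite /supn /= !normrN. Qed.

Lemma cmulBr (R : realType) (q x y : R * R) : cmul q (x - y) = cmul q x - cmul q y.
Proof. by congr pair => /=; ring. Qed.

Lemma supn_gauss_ge1 (R : realType) (q : int * int) : q != (0, 0) ->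
  1 <= supn (gauss R q).
Proof.
move=> q0; have : (1 <= `|q.1|) || (1 <= `|q.2|).
  by case: q q0 => a b; rewrite xpair_eqE /=; lia.
by rewrite /supn le_max -!intr_norm !ler1z.
Qed.

Lemma infinite_unbounded (T : choiceType) (S : set T) (f : T -> nat) :
  (forall N : nat, exists2 t, S t & (N < f t)%N) -> infinite_set S.
Proof.
move=> h /finite_seqP[s Ss]; have [t St] := h (\max_(i <- s) f i)%N.
by rewrite ltnNge (@leq_bigmax_seq _ _ xpredT f)//; move: St; rewrite Ss.
Qed.

Lemma finite_intbox (R : realType) (N : R) : finite_set [set a : int | `|a|%:~R <= N].
Proof.
have [m hm] : exists m : nat, N < m%:R.
  exists (Num.trunc `|N|).+1; apply: le_lt_trans (ler_norm N) _.
  by rewrite truncnS_gt.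
apply: (@sub_finite_set _ _ [set` [seq (Posz k - Posz m)%R | k <- iota 0 (2 * m)]]); last first.
  exact: finite_seq.
move=> a /= /le_lt_trans/(_ hm); rewrite pmulrn ltr_int => am; apply/mapP.
by exists (absz (a + Posz m)); [rewrite mem_iota; lia|lia].
Qed.

Lemma finite_gauss_box (R : realType) (N : R) :
  finite_set [set q : int * int | supn (gauss R q) <= N].
Proof.
apply: (@sub_finite_set _ _ ([set a : int | `|a|%:~R <= N] `*` [set a : int | `|a|%:~R <= N])).
  by move=> q /=; rewrite /supn ge_max /= -!intr_norm => /andP[].
by apply: finite_setX; exact: finite_intbox.
Qed.

Lemma int_weight_ge (R : realType) (d H : R) (a : int) : 0 < d -> 1 <= H -> `|a|%:~R <= H ->
  (2 * H) `^ (- (1 + d)) <= int_weight d a.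
Proof.
move=> d0 H1 aH; rewrite /int_weight !powRN lef_pV2 ?posrE ?powR_gt0//; last by lra.
rewrite ge0_ler_powR ?nnegrE//; [lra|lra|].
by rewrite -natr1; move: aH; rewrite -abszE -pmulrn; lra.
Qed.

Lemma int_weight_pair_ge (R : realType) (d H : R) (q : int * int) : 0 < d -> 1 <= H ->
  supn (gauss R q) <= H ->
  (2 * H) `^ (- (2 * (1 + d))) <= int_weight d q.1 * int_weight d q.2.
Proof.
move=> d0 H1; rewrite /supn ge_max /= -!intr_norm => /andP[h1 h2].
have -> : - (2 * (1 + d)) = - (1 + d) - (1 + d) by ring.
rewrite powR_add; last by lra.
by rewrite ler_pM ?powR_ge0// int_weight_ge.
Qed.

(* For a given [x] only finitely many [(q, r)] have [|r| > |q|^(1 + d)], hence a single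
   summable family covers the whole unbounded set. *)
Lemma hausdorff_Estar (R : realType) (tau s : R) : -1 < tau -> 0 < s ->
  4 < (1 + tau) * s -> hausdorff_measure s (Estar tau) = 0%E.
Proof.
move=> t1 s0 ts.
(* The weights cost [|q|^(2 * (1 + d))] for [q] and [|q|^(2 * (1 + d)^2)] for [r], in total
   [|q|^(2 * (1 + d) * (2 + d))]. For [d <= 1] this exponent is at most [4 + 8 * d]. *)
pose d := Num.min 1 (((1 + tau) * s - 4) / 8).
have d0 : 0 < d by rewrite lt_min ltr01 /=; lra.
have dle : 2 * (1 + d) * (2 + d) <= (1 + tau) * s.
  have d1 : d <= 1 by rewrite ge_min lexx.
  have d2 : d <= ((1 + tau) * s - 4) / 8 by rewrite ge_min lexx orbT.
  have : d * d <= d by rewrite ler_piMr// ltW.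
  lra.
have [G hG] := int_weight_bounded d0.
pose P (i : (int * int) * (int * int)) :=
  (i.1 != (0, 0)) && (supn (gauss R i.2) <= supn (gauss R i.1) `^ (1 + d)).
pose V i := [set x | P i /\
   supn (cmul (gauss R i.1) x - gauss R i.2) <= (supn (gauss R i.1)) `^ (- tau)].
pose D i : R := if P i then 4 * supn (gauss R i.1) `^ (- (1 + tau)) else 0.
pose W (i : (int * int) * (int * int)) := int_weight d i.1.1 * int_weight d i.1.2 * (int_weight d i.2.1 * int_weight d i.2.2).
pose K : R := 4 `^ s * 2 `^ (4 * (1 + d)).
have D0 i : 0 <= D i by rewrite /D; case: ifP => // _; rewrite mulr_ge0 ?powR_ge0.
have W0 i : 0 <= W i by rewrite /W !mulr_ge0// int_weight_ge0.
have DW i : D i `^ s <= K * W i.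
  rewrite /D; case: ifP => [/andP[q0 rq]|_]; last first.
    by rewrite powR0 ?gt_eqF// mulr_ge0// mulr_ge0// powR_ge0.
  set h := supn (gauss R i.1) in rq *.
  have h1 : 1 <= h by exact: supn_gauss_ge1.
  have h0 : 0 < h by exact: lt_le_trans h1.
  rewrite powRM ?powR_ge0// /K -mulrA ler_pM2l ?powR_gt0//.
  have w1 : (2 * h) `^ (- (2 * (1 + d))) <= int_weight d i.1.1 * int_weight d i.1.2 by rewrite int_weight_pair_ge.
  have w2 : (2 * h `^ (1 + d)) `^ (- (2 * (1 + d))) <= int_weight d i.2.1 * int_weight d i.2.2.
    apply: int_weight_pair_ge => //; rewrite -[leLHS](powRr0 h); apply: ler_powR => //; lra.
  apply: le_trans (_ : 2 `^ (4 * (1 + d)) * ((2 * h) `^ (- (2 * (1 + d))) * (2 * h `^ (1 + d)) `^ (- (2 * (1 + d)))) <= _); last first.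
    by rewrite ler_pM2l ?powR_gt0// ler_pM ?powR_ge0.
  rewrite (powRM _ (_ : 0 <= 2) (ltW h0))// (powRM _ (_ : 0 <= 2) (powR_ge0 _ _))//.
  rewrite -!powRrM mulrACA [leRHS]mulrA -!powR_add//.
  have -> : 4 * (1 + d) + (- (2 * (1 + d)) + - (2 * (1 + d))) = 0 :> R by ring.
  rewrite powRr0 mul1r; apply: ler_powR => //; lra.
have hcant := @hausdorff_cantelli R _ s (Estar tau) V D (K * (G * G * (G * G))) s0 D0.
apply: hcant.
- move=> i x y [Pi hx] [_ hy]; rewrite /D Pi; have /andP[q0 _] := Pi.
  set h := supn (gauss R i.1) in hx hy *.
  have h1 : 1 <= h by exact: supn_gauss_ge1.
  have h0 : 0 < h by exact: lt_le_trans h1.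
  rewrite opprD powR_add// (powRN h 1) (powRr1 (ltW h0)).
  rewrite mulrCA ler_pdivlMl//; apply: le_trans (supn_cmul_ge _ _) _.
  have -> : cmul (gauss R i.1) (x - y) = (cmul (gauss R i.1) x - gauss R i.2) - (cmul (gauss R i.1) y - gauss R i.2).
    by rewrite cmulBr opprB addrA subrK.
  have := supnD (cmul (gauss R i.1) x - gauss R i.2) (- (cmul (gauss R i.1) y - gauss R i.2)).
  by rewrite supnN; lra.
- move=> r ur; apply: le_trans (_ : \sum_(i <- r) K * W i <= _).
    by apply: ler_sum => i _; exact: DW.
  rewrite -mulr_sumr ler_pM2l ?mulr_gt0 ?powR_gt0//.
  have hp := ler_sum_pair (int_weight_ge0 d) (int_weight_ge0 d) hG hG.
  have g0 (i : int * int) : 0 <= int_weight d i.1 * int_weight d i.2 by rewrite mulr_ge0 ?int_weight_ge0.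
  exact: (ler_sum_pair g0 g0 hp hp).
- move=> x Ex finV; apply: Ex.
  (* As [-tau < 1], the approximation gives [|r| <= k * |q|]. If also [|r| > |q|^(1 + d)], then
     [|q|^d < k], which bounds both [q] and [r]. *)
  pose k := 2 * supn x + 1.
  have k1 : 1 <= k by rewrite lerDr mulr_ge0 ?supn_ge0.
  pose M := k `^ (d^-1).
  apply: (@sub_finite_set _ _ ([set i | V i x] `|` ([set q | supn (gauss R q) <= M] `*` [set q | supn (gauss R q) <= k * M]))).
    move=> i /= [q0 hi]; have [Pi|nP] := boolP (P i); first by left.
    right; move: nP; rewrite /P q0 /= -ltNge.
    set h := supn (gauss R i.1) in hi *.
    have h1 : 1 <= h by exact: supn_gauss_ge1.
    have h0 : 0 < h by exact: lt_le_trans h1.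
    have rk : supn (gauss R i.2) <= k * h.
      have -> : gauss R i.2 = cmul (gauss R i.1) x - (cmul (gauss R i.1) x - gauss R i.2).
        by rewrite opprB addrC subrK.
      apply: le_trans (supnD _ _) _; rewrite supnN.
      have := supn_cmul_le (gauss R i.1) x; rewrite -/h => hc.
      have : h `^ (- tau) <= h by apply: ler1_powR => //; lra.
      by rewrite /k; lra.
    move=> /lt_le_trans/(_ rk); rewrite addrC powR_add// (powRr1 (ltW h0)) ltr_pM2r// => hk.
    have hM : h <= M.
      rewrite /M -[leLHS](powRr1 (ltW h0)) -(mulfV (lt0r_neq0 d0)) powRrM.
      apply: ge0_ler_powR; rewrite ?nnegrE ?powR_ge0 ?invr_ge0 ?(ltW d0) ?(ltW hk)//.
      exact: le_trans k1.
    by split => //; apply: le_trans rk _; rewrite ler_pM2l// (lt_le_trans _ k1).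
  rewrite finite_setU; split => //.
  by apply: finite_setX; exact: finite_gauss_box.
Qed.

(** The limsup scheme again, with the denominators [2^k]: every point is close to [r / 2^k] for some
    integer point [r], and for large [k] the restriction [|r| <= 2^(k * (1 + d))] is met. *)
Lemma hausdorff_measure_gt2 (R : realType) (A : set (R * R)) (s : R) : 2 < s ->
  hausdorff_measure s A = 0%E.
Proof.
move=> s2; have s0 : 0 < s by lra.
pose d := Num.min 1 ((s - 2) / 12).
have d0 : 0 < d by rewrite lt_min ltr01 /=; lra.
have dle : 2 * (1 + d) * (1 + d) < s.
  have d1 : d <= 1 by rewrite ge_min lexx.
  have d2 : d <= (s - 2) / 12 by rewrite ge_min lexx orbT.
  have : d * d <= d by rewrite ler_piMr// ltW.
  lra.
(* The weights of [r] consume the exponent [2 * (1 + d)^2] of [2^k]; what remains makes the sum over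
   [k] geometric. *)
pose eta := s - 2 * (1 + d) * (1 + d).
have eta0 : 0 < eta by rewrite subr_gt0.
have [G hG] := int_weight_bounded d0.
pose p k : R := 2 ^+ k.
have p1 k : 1 <= p k by rewrite exprn_ege1// ler1n.
have p0 k : 0 < p k by exact: lt_le_trans (p1 k).
pose P (i : nat * (int * int)) := supn (gauss R i.2) <= p i.1 `^ (1 + d).
pose V i := [set x | P i /\ supn (cmul (p i.1, 0) x - gauss R i.2) <= 1].
pose D i : R := if P i then 4 / p i.1 else 0.
pose z : R := 2 `^ (- eta).
have z0 : 0 <= z by exact: powR_ge0.
have z1 : z < 1.
  by rewrite /z powRN invf_lt1 ?powR_gt0// -[ltLHS](powRr0 2) /powR pnatr_eq0/= ltr_expR ltr_pM2r// ln_gt0// ltr1n.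
pose K : R := 4 `^ s * 2 `^ (2 * (1 + d)).
have D0 i : 0 <= D i by rewrite /D; case: ifP => // _; rewrite divr_ge0// ltW.
have DW i : D i `^ s <= K * (z ^+ i.1 * (int_weight d i.2.1 * int_weight d i.2.2)).
  rewrite /D; case: ifP => [Pi|_]; last first.
    by rewrite powR0 ?gt_eqF// !mulr_ge0 ?powR_ge0 ?exprn_ge0.
  set h := p i.1 in Pi *.
  have h1 : 1 <= h by exact: p1.
  have h0 : 0 < h by exact: lt_le_trans h1.
  have zE : z ^+ i.1 = h `^ (- eta).
    by rewrite -powR_mulrn// /z -powRrM mulrC powRrM powR_mulrn.
  rewrite powRM ?invr_ge0 ?(ltW h0)// /K -mulrA ler_pM2l ?powR_gt0//.
  have w2 : (2 * h `^ (1 + d)) `^ (- (2 * (1 + d))) <= int_weight d i.2.1 * int_weight d i.2.2.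
    by apply: int_weight_pair_ge => //; rewrite -[leLHS](powRr0 h); apply: ler_powR => //; lra.
  apply: le_trans (_ : 2 `^ (2 * (1 + d)) * (z ^+ i.1 * (2 * h `^ (1 + d)) `^ (- (2 * (1 + d)))) <= _); last first.
    by rewrite ler_pM2l ?powR_gt0// ler_wpM2l// exprn_ge0.
  rewrite (powRM _ (_ : 0 <= 2) (powR_ge0 _ _))// zE [leRHS]mulrCA.
  rewrite [X in _ * X]mulrA -powR_add// subrr powRr0 mul1r -!powRrM -powR_add//.
  rewrite -powR_inv1 ?(ltW h0)// -powRrM mulN1r.
  by apply: ler_powR => //; rewrite /eta; lra.
have hcant := @hausdorff_cantelli R _ s A V D (K * ((1 - z)^-1 * (G * G))) s0 D0.
apply: hcant.
- move=> i x y [Pi hx] [_ hy]; rewrite /D Pi.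
  set h := p i.1 in hx hy *.
  have h1 : 1 <= h by exact: p1.
  have h0 : 0 < h by exact: lt_le_trans h1.
  have hq : supn (h, 0) = h.
    by rewrite /supn /= normr0 gtr0_norm// max_l// ltW.
  rewrite ler_pdivlMr// mulrC -{1}hq; apply: le_trans (supn_cmul_ge _ _) _.
  have -> : cmul (h, 0) (x - y) = (cmul (h, 0) x - gauss R i.2) - (cmul (h, 0) y - gauss R i.2).
    by rewrite cmulBr opprB addrA subrK.
  have := supnD (cmul (h, 0) x - gauss R i.2) (- (cmul (h, 0) y - gauss R i.2)).
  by rewrite supnN; lra.
- move=> r ur; apply: le_trans (_ : \sum_(i <- r) K * (z ^+ i.1 * (int_weight d i.2.1 * int_weight d i.2.2)) <= _).
    by apply: ler_sum => i _; exact: DW.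
  rewrite -mulr_sumr ler_pM2l ?mulr_gt0 ?powR_gt0//.
  have hp := ler_sum_pair (int_weight_ge0 d) (int_weight_ge0 d) hG hG.
  have g0 (i : int * int) : 0 <= int_weight d i.1 * int_weight d i.2 by rewrite mulr_ge0 ?int_weight_ge0.
  have zk k : 0 <= z ^+ k by rewrite exprn_ge0.
  have hz (t : seq nat) : uniq t -> \sum_(k <- t) z ^+ k <= (1 - z)^-1.
    move=> ut; set n := (\max_(k <- t) k).+1.
    apply: (@le_trans _ _ (\sum_(k <- index_iota 0 n) z ^+ k)).
      apply: ler_sum_sub => // i it; rewrite mem_index_iota ltnS leq0n /=.
      exact: (@leq_bigmax_seq _ _ xpredT id).
    by apply: geo_sum_le; rewrite z0 z1.
  exact: (ler_sum_pair zk g0 hz hp).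
- move=> x Ax.
  apply: (@infinite_unbounded _ _ fst) => N.
  pose c := supn x + 1.
  pose k := (N.+1 + (Num.trunc (c / (d * ln 2))).+1)%N.
  have ln2 : 0 < ln (2 : R) by rewrite ln_gt0// ltr1n.
  have kc : c <= p k `^ d.
    rewrite /powR gt_eqF// lnXn//; apply: le_trans (expR_ge1Dx _).
    apply: (@le_trans _ _ (d * ln 2 * k%:R)); last first.
      by rewrite -[ln 2 *+ k]mulr_natr mulrA lerDr.
    rewrite -ler_pdivrMl ?mulr_gt0// mulrC; apply: ltW.
    apply: lt_le_trans (truncnS_gt _) _; rewrite ler_nat; exact: leq_addl.
  pose r := (Num.floor (p k * x.1), Num.floor (p k * x.2)).
  have fl (y : R) : `|y - (Num.floor y)%:~R| <= 1.
    have := floor_itv y; rewrite intrD => /andP[h1 h2].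
    by rewrite ger0_norm ?subr_ge0//; lra.
  have cE : cmul (p k, 0) x = (p k * x.1, p k * x.2).
    by congr pair => /=; ring.
  have rx : supn (cmul (p k, 0) x - gauss R r) <= 1.
    by rewrite cE /supn ge_max /= !fl.
  exists (k, r); last by rewrite /k addSn ltnS leq_addr.
  split=> //; rewrite /P /=.
  have -> : gauss R r = cmul (p k, 0) x - (cmul (p k, 0) x - gauss R r).
    by rewrite opprB addrC subrK.
  apply: le_trans (supnD _ _) _; rewrite supnN.
  have : supn (cmul (p k, 0) x) = p k * supn x.
    by rewrite cE /supn /= !normrM (gtr0_norm (p0 k)) maxr_pMr ?ltW.
  move=> ->; rewrite powR_add// (powRr1 (ltW (p0 k))).
  apply: le_trans (_ : p k * c <= _); last by rewrite ler_pM2l.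
  by rewrite /c mulrDr mulr1 lerD2l (le_trans rx).
Qed.

Lemma dimH_Estar_le (R : realType) (tau : R) : -1 < tau ->
  (dimH (Estar tau) <= (Num.min (4 / (1 + tau)) 2)%:E)%E.
Proof.
move=> t1; apply/lee_addgt0Pr => e e0; rewrite -EFinD.
apply: ereal_inf_lbound; exists (Num.min (4 / (1 + tau)) 2 + e) => //.
have t0 : 0 < 1 + tau by lra.
have m0 : 0 < Num.min (4 / (1 + tau)) 2 by rewrite lt_min divr_gt0/=.
split; first by rewrite addr_ge0// ltW.
case: (leP (4 / (1 + tau)) 2) m0 => _ m0; last by apply: hausdorff_measure_gt2; lra.
apply: hausdorff_Estar => //; first by lra.
by rewrite mulrDr mulrC divfK ?gt_eqF// ltrDl mulr_gt0.
Qed.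

(** * Fourier decay bounds the Hausdorff dimension from below *)

Section BoundedMeasurable.
Context {d : measure_display} {T : measurableType d} {R : realType}.
Implicit Types f g : T -> R.

(** All integrands below are of this kind, so integrability against a probability measure comes for
    free. *)
Definition bmeas f := measurable_fun [set: T] f /\ exists M, forall x, `|f x| <= M.

Lemma bmeas_cst (c : R) : bmeas (fun=> c).
Proof. by split; [exact: measurable_cst|exists `|c|]. Qed.

Lemma bmeasD f g : bmeas f -> bmeas g -> bmeas (fun x => f x + g x).
Proof.
move=> [mf [M hM]] [mg [N hN]]; split; first exact: measurable_funD.
by exists (M + N) => x; apply: le_trans (ler_normD _ _) _; rewrite lerD.
Qed.

Lemma bmeasM f g : bmeas f -> bmeas g -> bmeas (fun x => f x * g x).
Proof.
move=> [mf [M hM]] [mg [N hN]]; split; first exact: measurable_funM.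
by exists (M * N) => x; rewrite normrM ler_pM.
Qed.

Lemma bmeas_sum (I : Type) (r : seq I) (F : I -> T -> R) :
  (forall i, bmeas (F i)) -> bmeas (fun x => \sum_(i <- r) F i x).
Proof.
move=> h; elim: r => [|i r IH].
  by under eq_fun do rewrite big_nil; exact: bmeas_cst.
by under eq_fun do rewrite big_cons; exact: bmeasD.
Qed.

Lemma bmeas_indic (A : set T) : measurable A -> bmeas (\1_A : T -> R).
Proof.
move=> mA; split; first exact: measurable_indic.
by exists 1 => x; rewrite indicE; case: (_ \in _); rewrite ?normr1 ?normr0.
Qed.

Variable P : probability T R.

Lemma bmeas_integrable f : bmeas f -> P.-integrable [set: T] (EFin \o f).
Proof.
move=> [mf [M hM]]; apply: measurable_bounded_integrable => //.
  by rewrite (le_lt_trans (probability_le1 _ _))// ltry.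
by exists M; split; [exact: num_real|move=> M' MM' x _; exact: le_trans (hM x) (ltW MM')].
Qed.

Lemma Rintegral_sum (I : Type) (r : seq I) (F : I -> T -> R) :
  (forall i, bmeas (F i)) ->
  (\int[P]_x (\sum_(i <- r) F i x) = \sum_(i <- r) \int[P]_x F i x)%R.
Proof.
move=> h; elim: r => [|i r IH].
  under eq_Rintegral do rewrite big_nil.
  by rewrite Rintegral_cst// mul0r big_nil.
under eq_Rintegral do rewrite big_cons.
rewrite RintegralD//; [by rewrite IH big_cons|exact: bmeas_integrable|].
by apply: bmeas_integrable; exact: bmeas_sum.
Qed.

Lemma ler_bmeas f g : bmeas f -> bmeas g -> (forall x, f x <= g x) ->
  (\int[P]_x f x <= \int[P]_x g x)%R.
Proof. by move=> bf bg h; apply: le_Rintegral => //; exact: bmeas_integrable. Qed.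

(** Markov's inequality, used for the mass of small balls and for the exceptional sets. *)
Lemma Rintegral_ge_indic f (A : set T) (c : R) : bmeas f -> measurable A ->
  (forall x, 0 <= f x) -> (forall x, A x -> c <= f x) ->
  c * fine (P A) <= \int[P]_x f x.
Proof.
move=> bf mA f0 fc.
have -> : c * fine (P A) = \int[P]_x (c * \1_A x).
  rewrite RintegralZl//; last by apply: bmeas_integrable; exact: bmeas_indic.
  by rewrite /Rintegral integral_indic// setIT.
apply: ler_bmeas => //; first exact: bmeasM (bmeas_cst _) (bmeas_indic mA).
move=> x; rewrite indicE; case: (boolP (x \in A)) => xA; rewrite ?mulr1 ?mulr0//.
by apply: fc; rewrite inE in xA.
Qed.

End BoundedMeasurable.

Section Support.
Variables (R : realType) (mu : probability (R * R)%type R).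

Lemma measurable_ball2 (x : R * R) e : measurable (ball x e).
Proof.
rewrite (_ : ball x e = ball x.1 e `*` ball x.2 e) //.
by apply: measurableX; exact: measurable_ball.
Qed.

Lemma ball2E (x y : R * R) e : ball x e y = (supn (x - y) < e) :> Prop.
Proof.
rewrite /ball /= /prod_ball /ball /= /supn gt_max propeqE; split; first by move=> [-> ->].
by move=> /andP[].
Qed.

(** A point off the support has a null ball around it, which contains a ball through the point with
    rational centre and radius [1 / (n + 1)]; there are countably many of these. *)
Lemma negligible_setC_msupport : mu.-negligible (~` msupport mu).
Proof.
pose B (t : rat * rat * nat) : set (R * R) := ball (ratr t.1.1 : R, ratr t.1.2 : R) (t.2.+1%:R^-1).
pose F i := if pickle_inv i is Some t then (if mu (B t) == 0%E then B t else set0) else set0.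
have nF i : mu.-negligible (F i).
  rewrite /F; case: pickle_inv => [t|]; last exact: negligible_set0.
  case: ifPn => [/eqP h|_]; last exact: negligible_set0.
  by exists (B t); split => //; exact: measurable_ball2.
apply: (@negligibleS _ _ _ mu (\bigcup_i F i)); last exact: negligible_bigcup.
move=> x; rewrite /msupport /= => /existsNP[e /not_implyP[e0 /negP]].
rewrite -leNgt => mux.
have [n hn] : exists n : nat, (n.+1%:R^-1 : R) * 2 < e.
  exists (Num.trunc (2 / e)); rewrite mulrC ltr_pdivrMr// mulrC -ltr_pdivrMr//.
  exact: truncnS_gt.
have n0 : 0 < (n.+1%:R^-1 : R) by rewrite invr_gt0 ltr0n.
have rat_near (y : R) : exists q : rat, `|ratr q - y| < n.+1%:R^-1.
  move: (n.+1%:R^-1 : R) n0 => i i0.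
  have lt : y - i < y + i by lra.
  have [q] := rat_in_itvoo lt.
  by rewrite in_itv /= => hq; exists q; rewrite ltr_distlC; lra.
have [q1 h1] := rat_near x.1; have [q2 h2] := rat_near x.2.
pose t := (q1, q2, n).
have Bx : B t x by rewrite /B ball2E /supn gt_max /= h1.
suff mut : mu (B t) == 0%E.
  by exists (pickle t); [exact: I|rewrite /F pickleK_inv mut].
rewrite eq_le measure_ge0 andbT; apply: le_trans mux.
apply: le_measure; rewrite ?inE//; try exact: measurable_ball2.
move=> y; rewrite /B !ball2E => hy; move: Bx; rewrite /B ball2E => hx.
apply: le_lt_trans hn.
have -> : x - y = (((ratr q1 : R), (ratr q2 : R)) - y) - (((ratr q1 : R), (ratr q2 : R)) - x).
  by rewrite opprB [RHS]addrC addrA subrK.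
apply: le_trans (supnD _ _) _; rewrite supnN mulr_natr mulr2n.
by apply: lerD; exact: ltW.
Qed.

End Support.

Section Fejer.
Variables (R : realType) (mu : probability (R * R)%type R) (n : nat).

Let ang (j : 'I_n * 'I_n) (x : R * R) : R := 2 * pi * (j.1%:R * x.1 + j.2%:R * x.2).
Let dif (j j' : 'I_n * 'I_n) (x : R * R) : R := ang j x - ang j' x.
Definition freq (j j' : 'I_n * 'I_n) : R * R := (j.1%:R - j'.1%:R, j.2%:R - j'.2%:R).

(* The integral over [x] of [|sum_j e(j.(x - y))|^2], expanded so that integrating in
   [y] produces the values of [fourier_sq] at integer frequencies. *)
Definition fejer_pot (y : R * R) : R :=
  \sum_(j : 'I_n * 'I_n) \sum_(j' : 'I_n * 'I_n)
    (cos (dif j j' y) * (\int[mu]_x cos (dif j j' x))%R +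
     sin (dif j j' y) * (\int[mu]_x sin (dif j j' x))%R).

Let mdif j j' : measurable_fun [set: R * R] (dif j j').
Proof.
apply: measurable_funB; apply: measurable_funM => //; apply: measurable_funD;
exact: measurable_funM.
Qed.

Let bcos j j' : bmeas (fun x => cos (dif j j' x)).
Proof.
split; last by exists 1 => x; exact: cos_max.
apply: measurableT_comp (mdif j j'); apply: continuous_measurable_fun.
exact: continuous_cos.
Qed.

Let bsin j j' : bmeas (fun x => sin (dif j j' x)).
Proof.
split; last by exists 1 => x; exact: sin_max.
apply: measurableT_comp (mdif j j'); apply: continuous_measurable_fun.
exact: continuous_sin.
Qed.

Lemma bmeas_fejer_pot : bmeas fejer_pot.
Proof.
apply: bmeas_sum => j; apply: bmeas_sum => j'.
by apply: bmeasD; apply: bmeasM => //; exact: bmeas_cst.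
Qed.

Let Phi (y x : R * R) : R :=
  (\sum_j cos (ang j x - ang j y)) ^+ 2 + (\sum_j sin (ang j x - ang j y)) ^+ 2.

Let PhiE y x : Phi y x = \sum_j \sum_j'
   (cos (dif j j' y) * cos (dif j j' x) + sin (dif j j' y) * sin (dif j j' x)).
Proof.
rewrite /Phi !expr2 !mulr_suml -big_split /=; apply: eq_bigr => j _.
rewrite !mulr_sumr -big_split /=; apply: eq_bigr => j' _.
by rewrite -!cosB -cosN; congr cos; rewrite /dif; ring.
Qed.

Let bPhi y : bmeas (Phi y).
Proof.
rewrite (funext (PhiE y)); apply: bmeas_sum => j; apply: bmeas_sum => j'.
by apply: bmeasD; apply: bmeasM => //; exact: bmeas_cst.
Qed.

Let fejer_potE y : fejer_pot y = (\int[mu]_x Phi y x)%R.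
Proof.
under eq_Rintegral do rewrite PhiE.
rewrite Rintegral_sum; last first.
  move=> j; apply: bmeas_sum => j'.
  by apply: bmeasD; apply: bmeasM => //; exact: bmeas_cst.
apply: eq_bigr => j _; rewrite Rintegral_sum; last first.
  by move=> j'; apply: bmeasD; apply: bmeasM => //; exact: bmeas_cst.
apply: eq_bigr => j' _; rewrite RintegralD//.
- by rewrite !RintegralZl//; exact: bmeas_integrable.
- by apply: bmeas_integrable; apply: bmeasM => //; exact: bmeas_cst.
- by apply: bmeas_integrable; apply: bmeasM => //; exact: bmeas_cst.
Qed.

Lemma fejer_pot_ge0 y : 0 <= fejer_pot y.
Proof.
by rewrite fejer_potE; apply: Rintegral_ge0 => x _; rewrite addr_ge0 ?sqr_ge0.
Qed.

Lemma Rintegral_fejer_pot : (\int[mu]_y fejer_pot y)%R =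
  \sum_(j : 'I_n * 'I_n) \sum_(j' : 'I_n * 'I_n) fourier_sq mu (freq j j').
Proof.
rewrite Rintegral_sum; last first.
  move=> j; apply: bmeas_sum => j'.
  by apply: bmeasD; apply: bmeasM => //; exact: bmeas_cst.
apply: eq_bigr => j _; rewrite Rintegral_sum; last first.
  by move=> j'; apply: bmeasD; apply: bmeasM => //; exact: bmeas_cst.
apply: eq_bigr => j' _; rewrite RintegralD//.
- rewrite !RintegralZr//; try exact: bmeas_integrable.
  have dE x : 2 * pi * dotp (freq j j') x = dif j j' x.
    by rewrite /dotp /dif /ang /freq /=; ring.
  rewrite /fourier_sq -!expr2; congr (_ ^+ 2 + _).
    by under eq_Rintegral do rewrite -dE.
  rewrite -[RHS]sqrrN; congr (_ ^+ 2).
  rewrite -[X in - X]/(\int[mu]_x (- sin (2 * pi * dotp (freq j j') x)))%R.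
  under [in RHS]eq_Rintegral do rewrite dE -mulN1r.
  by rewrite RintegralZl//; [rewrite mulN1r opprK|exact: bmeas_integrable].
- by apply: bmeas_integrable; apply: bmeasM => //; exact: bmeas_cst.
- by apply: bmeas_integrable; apply: bmeasM => //; exact: bmeas_cst.
Qed.

(** When [|x - y| < 1 / (16 n)] every phase is at most [2 * pi / 8 <= 1], so each of the [n^2]
    cosines is at least [1/2] and the squared sum at least [n^4 / 4]. *)
Lemma fejer_pot_ge (y : R * R) : (0 < n)%N ->
  n%:R ^+ 4 / 4 * fine (mu (ball y ((16 * n%:R)^-1))) <= fejer_pot y.
Proof.
move=> n0; rewrite fejer_potE; apply: Rintegral_ge_indic.
- exact: bPhi.
- exact: measurable_ball2.
- by move=> x; rewrite addr_ge0 ?sqr_ge0.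
move=> x; rewrite ball2E => yx.
have n0' : 0 < n%:R :> R by rewrite ltr0n.
have cge j : 2^-1 <= cos (ang j x - ang j y).
  apply: cos_ge_half.
  have -> : ang j x - ang j y = - (2 * pi * (j.1%:R * (y - x).1 + j.2%:R * (y - x).2)).
    by rewrite /ang /=; ring.
  have h1 : `|(y - x).1| <= (16 * n%:R)^-1 by apply/ltW/(le_lt_trans _ yx); rewrite /supn le_max lexx.
  have h2 : `|(y - x).2| <= (16 * n%:R)^-1 by apply/ltW/(le_lt_trans _ yx); rewrite /supn le_max lexx orbT.
  have hj (i : 'I_n) (z : R) : `|z| <= (16 * n%:R)^-1 -> `|i%:R * z| <= 16^-1.
    move=> hz; rewrite normrM normr_nat.
    apply: (@le_trans _ _ (n%:R * (16 * n%:R)^-1)).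
      by rewrite ler_pM// ler_nat ltnW.
    by rewrite invfM mulrCA divff ?gt_eqF// mulr1.
  rewrite normrN normrM ger0_norm ?mulr_ge0 ?pi_ge0//.
  have p4 : pi < 4 :> R by have := pihalf_lt2 R; lra.
  apply: (@le_trans _ _ (2 * pi * 8^-1)); last by lra.
  rewrite ler_wpM2l ?mulr_ge0 ?pi_ge0//; apply: le_trans (ler_normD _ _) _.
  by have := hj j.1 _ h1; have := hj j.2 _ h2; lra.
apply: (@le_trans _ _ ((\sum_j cos (ang j x - ang j y)) ^+ 2)); last by rewrite lerDl sqr_ge0.
have -> : n%:R ^+ 4 / 4 = ((n * n)%:R * 2^-1) ^+ 2 :> R by rewrite natrM; field.
rewrite ler_pXn2r ?nnegrE// ?mulr_ge0//; last first.
  by apply: sumr_ge0 => j _; apply: le_trans (cge j).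
apply: (@le_trans _ _ (\sum_(j : 'I_n * 'I_n) 2^-1)); last by apply: ler_sum.
by rewrite sumr_const card_prod card_ord -[leRHS]mulr_natl.
Qed.

End Fejer.

(** * The energy at integer frequencies *)

Definition recip (R : realType) (i : nat) : R := (maxn 1 i)%:R^-1.

Lemma recip_ge0 (R : realType) i : 0 <= recip R i.
Proof. by rewrite invr_ge0. Qed.

(** Each dyadic block contributes at most 1. *)
Lemma sum_recip_pow2 (R : realType) k : \sum_(0 <= i < 2 ^ k) recip R i <= k.+1%:R.
Proof.
elim: k => [|k IH]; first by rewrite big_nat1 /recip /= invr1.
rewrite (@big_cat_nat _ _ _ (2 ^ k))//=; last by rewrite leq_exp2l.
rewrite -(natr1 k.+1) lerD//.
apply: (@le_trans _ _ (\sum_(2 ^ k <= i < 2 ^ k.+1) ((2 ^ k)%:R : R)^-1)).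
  rewrite big_nat_cond [leRHS]big_nat_cond; apply: ler_sum => i; rewrite andbT => /andP[h1 h2].
  rewrite /recip lef_pV2 ?posrE ?ltr0n ?expn_gt0//; last by rewrite leq_max.
  by rewrite ler_nat leq_max h1 orbT.
rewrite sumr_const_nat expnS mul2n -addnn addnK -[leLHS]mulr_natl mulfV// pnatr_eq0 -lt0n expn_gt0.
Qed.

(** With truncated subtraction [(a - b) + (b - a)] is the distance of [a] and [b], and each distance
    occurs at most twice. *)
Lemma sum_recip_dist (R : realType) n b : (b < n)%N ->
  \sum_(0 <= a < n) recip R ((a - b) + (b - a)) <= 2 * \sum_(0 <= i < n) recip R i.
Proof.
move=> bn; have mono m : (m <= n)%N -> \sum_(0 <= i < m) recip R i <= \sum_(0 <= i < n) recip R i.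
  move=> mn; rewrite [leRHS](@big_cat_nat _ _ _ m)//= lerDl sumr_ge0// => i _.
  exact: recip_ge0.
rewrite (@big_cat_nat _ _ _ b)//=; last exact: ltnW.
rewrite mulr_natl mulr2n lerD//.
  rewrite big_nat_rev /=; apply: le_trans (mono _ (ltnW bn)).
  rewrite big_nat_cond [leRHS]big_nat_cond; apply: ler_sum => i; rewrite andbT add0n => /andP[_ ib].
  rewrite /recip lef_pV2 ?posrE ?ltr0n ?leq_max// ler_nat.
  lia.
rewrite -{1}(add0n b) big_addn; apply: le_trans (mono (n - b)%N (leq_subr _ _)).
rewrite big_nat_cond [leRHS]big_nat_cond; apply: ler_sum => i _.
rewrite /recip lef_pV2 ?posrE ?ltr0n ?leq_max// ler_nat.
lia.
Qed.

Section Energy.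
Variables (R : realType) (mu : probability (R * R)%type R) (s C : R).
Hypothesis s02 : 0 <= s <= 2.
Hypothesis decay : forall xi : R * R, xi != 0 -> fourier_sq mu xi * (supn xi) `^ s <= C.

Lemma fourier_sq_ge0 xi : 0 <= fourier_sq mu xi.
Proof. by rewrite /fourier_sq addr_ge0 ?sqr_ge0. Qed.

Lemma fourier_sq0 : fourier_sq mu 0 = 1.
Proof.
rewrite /fourier_sq /dotp /=.
rewrite -[X in X ^+ 2 + _]/(\int[mu]_x (cos (2 * pi * (0 * x.1 + 0 * x.2))))%R.
rewrite -[X in _ + X ^+ 2]/(\int[mu]_x (- sin (2 * pi * (0 * x.1 + 0 * x.2))))%R.
under eq_Rintegral do rewrite !mul0r addr0 mulr0 cos0.
under [in X in _ + X]eq_Rintegral do rewrite !mul0r addr0 mulr0 sin0 oppr0.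
by rewrite !Rintegral_cst// mul0r mul1r [X in fine X]probability_setT /= expr1n expr0n addr0.
Qed.

(* [|m|^2 >= max(1, |m.1|) max(1, |m.2|)] for [m != 0] makes the bound a product. *)
Lemma fourier_freq_le n (j j' : 'I_n * 'I_n) :
  fourier_sq mu (freq R j j') <= Num.max C 1 * n%:R `^ (2 - s) *
   (recip R ((j.1 - j'.1) + (j'.1 - j.1)) * recip R ((j.2 - j'.2) + (j'.2 - j.2))).
Proof.
have /andP[s0 s2] := s02.
have n0 : (0 < n)%N by case: n j j' => // -[[]].
have n1 : 1 <= n%:R :> R by rewrite ler1n.
have dist (a b : 'I_n) : `|(a%:R - b%:R : R)| = ((a - b) + (b - a))%:R.
  case: (leqP a b) => ab.
    have -> : (a - b + (b - a) = b - a)%N by lia.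
    by rewrite distrC ger0_norm ?subr_ge0 ?ler_nat// natrB.
  have -> : (a - b + (b - a) = a - b)%N by lia.
  have ba := ltnW ab; by rewrite ger0_norm ?subr_ge0 ?ler_nat// natrB.
set d1 := (_ + _)%N; set d2 := (_ + _)%N.
have sup : supn (freq R j j') = (maxn d1 d2)%:R.
  by rewrite /supn /= !dist natr_max.
(* Decay says nothing at frequency 0, where [fourier_sq] is 1; hence [Num.max C 1]. *)
have [/eqP d0|dn0] := boolP (maxn d1 d2 == 0)%N.
  have -> : freq R j j' = 0.
    have h1 : `|(freq R j j').1| <= 0 by rewrite -[leRHS]/(0%:R) -d0 -sup /supn le_max lexx.
    have h2 : `|(freq R j j').2| <= 0 by rewrite -[leRHS]/(0%:R) -d0 -sup /supn le_max lexx orbT.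
    by rewrite !normr_le0 in h1 h2; rewrite [LHS]surjective_pairing (eqP h1) (eqP h2).
  have [-> ->] : d1 = 0%N /\ d2 = 0%N by lia.
  rewrite fourier_sq0 /recip /= !invr1 !mulr1.
  rewrite -[leLHS]mulr1 ler_pM//; first by rewrite le_max lexx orbT.
  by rewrite -[leLHS](powRr0 n%:R) ler_powR// subr_ge0.
set X := supn (freq R j j') in sup *.
have X1 : 1 <= X by rewrite sup ler1n lt0n.
have X0 : 0 < X by exact: lt_le_trans X1.
have Xn : X <= n%:R.
  rewrite sup ler_nat geq_max /d1 /d2.
  have := ltn_ord j.1; have := ltn_ord j'.1; have := ltn_ord j.2; have := ltn_ord j'.2; lia.
have xi0 : freq R j j' != 0.
  by apply: contraTneq X0 => E; rewrite /X E /supn /= normr0 maxxx ltxx.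
have := decay xi0; rewrite -/X -ler_pdivlMr ?powR_gt0// => h; apply: le_trans h _.
have C0 : 0 <= C by apply: le_trans (decay xi0); rewrite mulr_ge0 ?powR_ge0 ?fourier_sq_ge0.
rewrite -powRN -mulrA ler_pM ?powR_ge0//; first by rewrite le_max lexx.
have -> : X `^ (- s) = X `^ (2 - s) * X `^ (- 2%:R).
  by rewrite -powR_add//; congr powR; ring.
rewrite ler_pM ?powR_ge0//.
  by rewrite ge0_ler_powR ?nnegrE ?subr_ge0// ltW.
rewrite powRN powR_mulrn ?(ltW X0)// expr2 invfM.
have rX e : (maxn 1 e <= maxn d1 d2)%N -> X^-1 <= recip R e.
  by move=> h; rewrite /recip lef_pV2 ?posrE ?ltr0n ?leq_max// sup ler_nat.
by apply: ler_pM; rewrite ?invr_ge0 ?(ltW X0)//; apply: rX; lia.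
Qed.

(** For each of the [n^2] values of [j'] the sum over [j] is [n^(2 - s)] times a squared logarithm.
    Against the [n^4 / 4] of [fejer_pot_ge], the mean mass of a ball of radius [1 / (16 n)] is thus
    [n^-s] up to logarithms. *)
Lemma energy_le k (n := (2 ^ k)%N) :
  \sum_(j : 'I_n * 'I_n) \sum_(j' : 'I_n * 'I_n) fourier_sq mu (freq R j j') <=
  Num.max C 1 * n%:R `^ (4%:R - s) * (2 * k.+1%:R) ^+ 2.
Proof.
have n0 : 0 < n%:R :> R by rewrite ltr0n expn_gt0.
have C1 : 0 <= Num.max C 1 by rewrite le_max ler01 orbT.
apply: (@le_trans _ _ (\sum_(j' : 'I_n * 'I_n) (Num.max C 1 * n%:R `^ (2 - s) * (2 * k.+1%:R) ^+ 2))).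
  rewrite exchange_big /=; apply: ler_sum => j' _.
  apply: (@le_trans _ _ (\sum_(j : 'I_n * 'I_n) (Num.max C 1 * n%:R `^ (2 - s) *
   (recip R ((j.1 - j'.1) + (j'.1 - j.1)) * recip R ((j.2 - j'.2) + (j'.2 - j.2)))))).
    by apply: ler_sum => j _; exact: fourier_freq_le.
  rewrite -mulr_sumr ler_wpM2l ?mulr_ge0 ?powR_ge0//.
  rewrite -(pair_bigA _ (fun a b : 'I_n => recip R ((a - j'.1) + (j'.1 - a)) * recip R ((b - j'.2) + (j'.2 - b)))) /=.
  under eq_bigr do rewrite -mulr_sumr.
  rewrite -mulr_suml expr2.
  have main (b : 'I_n) : \sum_(a < n) recip R (a - b + (b - a)) <= 2 * k.+1%:R.
    rewrite -(big_mkord xpredT (fun a => recip R (a - b + (b - a)))).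
    by apply: le_trans (sum_recip_dist R (ltn_ord b)) _; rewrite ler_pM2l// sum_recip_pow2.
  by rewrite ler_pM ?sumr_ge0// => i _; exact: recip_ge0.
rewrite sumr_const card_prod card_ord -[leLHS]mulr_natl natrM.
have -> : 4%:R - s = (2 - s) + 2%:R by ring.
rewrite (powR_add (2 - s) 2%:R n0) (powR_mulrn _ (ltW n0)) le_eqVlt; apply/orP; left; apply/eqP.
move: (n%:R : R) (n%:R `^ _) (k.+1%:R : R) (Num.max C 1) => a b c e; ring.
Qed.

End Energy.

(** * Ball masses and the mass distribution principle *)

Section Frostman.
Variables (R : realType) (mu : probability (R * R)%type R) (s C : R).
Hypothesis s02 : 0 <= s <= 2.
Hypothesis decay : forall xi : R * R, xi != 0 -> fourier_sq mu xi * (supn xi) `^ s <= C.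
Variable t : R.
Hypothesis ts : t < s.

(** With [n = 2^k] this is [n^4 / 4 * n^-t], the value below which [fejer_pot_ge] yields a ball mass
    of at most [n^-t]. *)
Let lam k : R := (2 ^ k)%:R ^+ 4 / 4 * (2 `^ (- t)) ^+ k.
Let bad k : set (R * R) := [set y | lam k < fejer_pot mu (2 ^ k) y].

Let lam_gt0 k : 0 < lam k.
Proof. by rewrite !mulr_gt0 ?invr_gt0 ?exprn_gt0 ?powR_gt0 ?ltr0n ?expn_gt0. Qed.

Let mbad k : measurable (bad k).
Proof.
have [mf _] := bmeas_fejer_pot mu (2 ^ k).
rewrite (_ : bad k = [set: _] `&` (fejer_pot mu (2 ^ k) @^-1` `]lam k, +oo[)).
  exact: mf.
by rewrite setTI; apply/seteqP; split => y /=; rewrite in_itv /= andbT.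
Qed.

(** Markov's inequality gives [O((k + 1)^2 * 2^(-(s - t) * k))]. Each factor [k + 1] costs
    [2^((s - t) * k / 4)], which leaves half of the exponent. *)
Let bad_le : exists2 c : R, 0 < c & exists2 r : R, 0 <= r < 1 &
  forall k, fine (mu (bad k)) <= c * r ^+ k.
Proof.
have e0 : 0 < (s - t) / 4 by rewrite divr_gt0 ?subr_gt0.
have [c1 c10 hc1] := poly_powR e0.
have C1 : 0 < Num.max C 1 by rewrite lt_max ltr01 orbT.
exists (16 * Num.max C 1 * c1 ^+ 2); first by rewrite !mulr_gt0 ?exprn_gt0.
exists (2 `^ (- ((s - t) / 2))).
  rewrite powR_ge0/= powRN invf_lt1 ?powR_gt0// -[ltLHS](powRr0 2) /powR pnatr_eq0/=.
  by rewrite ltr_expR ltr_pM2r ?ln_gt0 ?ltr1n// divr_gt0 ?subr_gt0.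
move=> k; set n := (2 ^ k)%N.
have n0 : 0 < n%:R :> R by rewrite ltr0n expn_gt0.
have h1 : lam k * fine (mu (bad k)) <= \int[mu]_y fejer_pot mu n y.
  apply: Rintegral_ge_indic.
  - exact: bmeas_fejer_pot.
  - exact: mbad.
  - exact: fejer_pot_ge0.
  - by move=> x /ltW.
have h2 := le_trans h1 _; rewrite Rintegral_fejer_pot in h2.
have {h1 h2} := h2 _ (energy_le s02 decay k); rewrite -/n.
rewrite -ler_pdivlMl// => h; apply: le_trans h _.
rewrite -/n /lam -/n.
have nE (a : R) : n%:R `^ a = (2 `^ a) ^+ k.
  by rewrite /n natrX -powR_mulrn// -powRrM -[RHS]powR_mulrn ?powR_ge0// -powRrM mulrC.
rewrite powR_add// (powR_mulrn _ (ltW n0)) nE.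
rewrite invfM [(_ / 4)^-1]invfM invrK.
have n4 : n%:R ^+ 4 != 0 :> R by rewrite expf_neq0// gt_eqF.
have aux (a w u c e : R) : a != 0 ->
    a^-1 * 4 * w * (e * (a * u) * (2 * c) ^+ 2) = 16 * e * (c ^+ 2 * (w * u)).
  by move=> a0; field.
rewrite aux//.
rewrite -exprVn -exprMn -powRN opprK -powR_add// -[leRHS]mulrA ler_pM2l ?mulr_gt0//.
have -> : 2 `^ (t - s) = ((2 `^ ((s - t) / 4))^-1) ^+ 2 * 2 `^ (- ((s - t) / 2)) :> R.
  by rewrite exprVn -powR_mulrn ?powR_ge0// -powRrM -powRN -powR_add//; congr powR; field.
rewrite exprMn mulrA ler_wpM2r ?exprn_ge0 ?powR_ge0// exprAC -exprMn.
rewrite ler_pXn2r ?nnegrE ?mulr_ge0 ?exprn_ge0 ?invr_ge0 ?powR_ge0 ?(ltW c10)//.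
by rewrite exprVn ler_pdivrMr ?exprn_gt0 ?powR_gt0.
Qed.

(** The masses of the sets [bad k] are dominated by a geometric series; [K] is chosen so that its
    tail is at most [1/2], and [good] avoids all later [bad k]. *)
Lemma frostman_good : exists K, exists2 good : set (R * R), measurable good &
  (2^-1%:E <= mu good)%E /\ forall y, good y -> forall k, (K <= k)%N ->
   fine (mu (ball y ((16 * (2 ^ k)%:R)^-1))) <= (2 `^ (- t)) ^+ k.
Proof.
have [c c0 [r r01 hr]] := bad_le; have /andP[r0 r1] := r01.
have [K hK] : exists K, c * r ^+ K / (1 - r) <= 2^-1.
  have : geometric (c / (1 - r)) r n @[n --> \oo] --> 0.
    by apply: cvg_geometric; rewrite ger0_norm.
  move=> /cvgr0_norm_lt h; have := h 2^-1; rewrite invr_gt0 ltr0n => /(_ isT) h2.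
  near \oo => K; exists K.
  have : `|geometric (c / (1 - r)) r K| < 2^-1 by near: K; exact: h2.
  by move=> /(le_lt_trans (ler_norm _))/ltW; rewrite /geometric /= mulrAC.
exists K; pose B := \bigcup_(k in ~` `I_K) bad k.
have mB : measurable B by apply: bigcup_measurable => k _; exact: mbad.
exists (~` B); first exact: measurableC.
have muB : (mu B <= 2^-1%:E)%E.
  apply: le_trans (@measure_sigma_subadditive_tail _ _ _ mu B bad K mbad mB (@subset_refl _ _)) _.
  apply: lime_le.
    by apply: is_cvg_nneseries => n _ _.
  apply: nearW => n.
  apply: (@le_trans _ _ (\sum_(K <= k < n) (c * r ^+ k)%:E)%E).
    apply: lee_sum => k _.
    have fb : mu (bad k) \is a fin_num by apply: fin_num_measure; exact: mbad.
    by rewrite -[leLHS](fineK fb) lee_fin hr.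
  rewrite sumEFin lee_fin; apply: le_trans hK.
  rewrite -mulr_sumr -mulrA ler_pM2l//.
  have [nK|Kn] := leqP n K.
    by rewrite big_geq// mulr_ge0 ?exprn_ge0 ?invr_ge0 ?subr_ge0 ?(ltW r1).
  rewrite -{1}(add0n K) big_addn.
  under eq_bigr do rewrite addnC exprD.
  by rewrite -mulr_sumr ler_wpM2l ?exprn_ge0// geo_sum_le.
split.
  rewrite probability_setC//.
  have fB : mu B \is a fin_num by exact: fin_num_measure.
  move: muB; rewrite -(fineK fB) lee_fin -EFinB lee_fin; lra.
move=> y nBy k Kk; have nbad : ~ bad k y.
  by move=> h; apply: nBy; exists k => //=; apply/negP; rewrite -leqNgt.
have := @fejer_pot_ge R mu (2 ^ k) y; rewrite expn_gt0 => /(_ isT) h.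
move/negP: nbad; rewrite -leNgt => /(le_trans h).
by rewrite ler_pM2l// divr_gt0// exprn_gt0// ltr0n expn_gt0.
Unshelve. all: by end_near. Qed.

End Frostman.

(** For [D > 0] the largest [k] with [D < 1 / (16 * 2^k)] has [2^-k <= 32 * D]. For [D = 0] no scale
    is largest, and [k] is taken so large that [e] suffices. The strict inequality fits the open
    balls. *)
Lemma choose_scale (R : realType) (u t D e : R) (K : nat) :
  0 < u -> 0 <= t <= u -> 0 <= D -> D < (16 * (2 ^ K)%:R)^-1 -> 0 < e ->
  exists k, [/\ (K <= k)%N, D < (16 * (2 ^ k)%:R)^-1 &
    (2 `^ (- u)) ^+ k <= 32 `^ t * D `^ t + e].
Proof.
move=> u0 /andP[t0 tu] D0 DK e0.
have p0 m : 0 < 16 * (2 ^ m)%:R :> R by rewrite mulr_gt0 ?ltr0n ?expn_gt0.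
have [->|Dn0] := eqVneq D 0.
  have z1 : 2 `^ (- u) < 1 :> R.
    rewrite powRN invf_lt1 ?powR_gt0// -[ltLHS](powRr0 2) /powR pnatr_eq0/=.
    by rewrite ltr_expR ltr_pM2r ?ln_gt0 ?ltr1n.
  have : geometric 1 (2 `^ (- u)) n @[n --> \oo] --> (0 : R).
    by apply: cvg_geometric; rewrite ger0_norm// powR_ge0.
  move=> /cvgr0_norm_lt h; have h2 := h _ e0.
  near \oo => k; exists k; split.
  - by near: k; exact: nbhs_infty_ge.
  - by rewrite invr_gt0.
  apply: ler_wpDl; first by rewrite mulr_ge0 ?powR_ge0.
  have : `|geometric 1 (2 `^ (- u)) k| < e by near: k; exact: h2.
  by move=> /(le_lt_trans (ler_norm _))/ltW; rewrite /geometric /= mul1r.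
have {}D0 : 0 < D by rewrite lt_neqAle eq_sym Dn0.
have exP : exists m, (16 * (2 ^ m)%:R)^-1 <= D.
  exists (Num.trunc D^-1).+1; rewrite -[leRHS](invrK D) lef_pV2 ?posrE ?invr_gt0//.
  apply: ltW; apply: lt_le_trans (truncnS_gt _) _.
  rewrite -natrM ler_nat; apply: leq_trans (ltnW (ltn_expl _ (isT : (1 < 2)%N))) _.
  by rewrite leq_pmull.
case: (ex_minnP exP) => m Pm minm.
have Km : (K < m)%N.
  rewrite ltnNge; apply/negP => mK; move: DK; apply/negP; rewrite -leNgt.
  apply: le_trans Pm; rewrite lef_pV2 ?posrE// ler_pM2l// ler_nat.
  by rewrite leq_pexp2l.
case: m Km Pm minm => // k Kk Pm minm; exists k; split => //.
  rewrite ltNge; apply/negP => /minm; by rewrite ltnn.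
rewrite -powR_mulrn ?powR_ge0// -powRrM mulNr mulrC -mulNr powRrM powRN powR_mulrn//.
have kD : (2 ^+ k)^-1 <= 32 * D.
  have : 32 * (16 * (2 ^ k.+1)%:R)^-1 <= 32 * D by rewrite ler_pM2l.
  apply: le_trans; rewrite natrX exprS !invfM.
  by rewrite le_eqVlt; apply/orP; left; apply/eqP; field; rewrite expf_neq0.
have k0 : (0 : R) < 2 ^+ k by rewrite exprn_gt0.
have k1 : 0 < (2 ^+ k : R)^-1 <= 1.
  apply/andP; split; first by rewrite invr_gt0.
  by rewrite invf_le1// exprn_ege1// ler1n.
apply: (@le_trans _ _ (((2 ^+ k)^-1) `^ t)); first exact: ger_powR.
apply: (@le_trans _ _ ((32 * D) `^ t)).
  by rewrite ge0_ler_powR ?nnegrE ?mulr_ge0 ?(ltW D0)//; case/andP: k1 => /ltW.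
by rewrite powRM ?(ltW D0)// lerDl ltW.
Unshelve. all: by end_near. Qed.

Lemma hausdorff_pos_of_decay (R : realType) (A : set (R * R))
    (mu : probability (R * R)%type R) (s C t : R) :
  probP A mu -> 0 <= s <= 2 ->
  (forall xi : R * R, xi != 0 -> fourier_sq mu xi * (supn xi) `^ s <= C) ->
  0 <= t < s -> hausdorff_measure t A <> 0%E.
Proof.
move=> [_ suppA] s02 decay /andP[t0 ts] H0.
(* Strictly between [t] and [s]: [u < s] is what [frostman_good] asks for, and [u > t] ensures
   [u > 0] even when [t = 0]. *)
pose u := (t + s) / 2.
have tu : t < u by rewrite /u; lra.
have us : u < s by rewrite /u; lra.
have u0 : 0 < u by exact: le_lt_trans tu.
have [K [good mgood [mu_good hgood]]] := frostman_good s02 decay us.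
have [N [mN muN subN]] := negligible_setC_msupport mu.
pose delta : R := (32 * (2 ^ K)%:R)^-1.
have delta0 : 0 < delta by rewrite invr_gt0 mulr_gt0// ltr0n expn_gt0.
have dK : delta < (16 * (2 ^ K)%:R)^-1.
  by rewrite /delta ltf_pV2 ?posrE ?mulr_gt0 ?ltr0n ?expn_gt0// ltr_pM2r ?ltr0n ?expn_gt0// ltr_nat.
(* A cover of total below [c] carries mass less than [1/4], plus the errors [eps i], which sum to
   [1/8]; this is less than the mass [1/2] of [good]. *)
pose c : R := (4 * 32 `^ t)^-1.
have c0 : 0 < c by rewrite invr_gt0 mulr_gt0// powR_gt0.
have : (hausdorff_delta t delta A < c%:E)%E.
  apply: (@le_lt_trans _ _ 0%E); last by rewrite lte_fin.
  by rewrite -H0; apply: ereal_sup_ubound; exists delta.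
move=> /ereal_inf_lt[_ [U [AU dU] <-]] Uc.
pose term i : \bar R := if U i == set0 then 0%E else ((fine (diam (U i))) `^ t)%:E.
have term0 i : (0 <= term i)%E by rewrite /term; case: ifP => // _; rewrite lee_fin powR_ge0.
pose eps i : R := 8^-1 / (2 ^ i.+1)%:R.
have eps0 i : 0 < eps i by rewrite divr_gt0// ?invr_gt0// ltr0n expn_gt0.
(* The sets [U i] need not be measurable. Each is replaced by a ball around one of its good points,
   or by the empty set if it has none. *)
have /choice[V hV] : forall i, exists V : set (R * R), [/\ measurable V,
    (mu V <= (32 `^ t)%:E * term i + (eps i)%:E)%E & U i `&` good `<=` V].
  move=> i; have [[y [Uy gy]]|none] := pselect (exists y, U i y /\ good y); last first.
    exists set0; split => //; last by move=> y [Uy gy]; apply: none; exists y.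
    by rewrite measure0 adde_ge0// ?mule_ge0 ?lee_fin ?powR_ge0// ltW.
  have D0 := diam_ge0 Uy.
  have fD : diam (U i) \is a fin_num by rewrite ge0_fin_numE// (le_lt_trans (dU i))// ltry.
  have Dd : fine (diam (U i)) < (16 * (2 ^ K)%:R)^-1.
    by apply: le_lt_trans dK; rewrite -lee_fin fineK.
  have t0u : 0 <= t <= u by rewrite t0 ltW.
  have [k [Kk Dk hk]] := choose_scale u0 t0u (fine_ge0 D0) Dd (eps0 i).
  exists (ball y ((16 * (2 ^ k)%:R)^-1)); split.
  - exact: measurable_ball2.
  - have fB : mu (ball y (16 * (2 ^ k)%:R)^-1) \is a fin_num.
      by apply: fin_num_measure; exact: measurable_ball2.
    rewrite -[leLHS](fineK fB) /term ifN; last by apply/set0P; exists y.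
    by rewrite -EFinM -EFinD lee_fin; apply: le_trans (hgood _ gy _ Kk) _.
  move=> z [Uz _]; rewrite ball2E; apply: le_lt_trans Dk.
  by rewrite -lee_fin fineK// diam_ge.
have mgN : measurable (good `\` N) by exact: measurableD.
have sub : good `\` N `<=` \bigcup_i V i.
  move=> y [gy nNy]; have sy : msupport mu y.
    by apply: contrapT => h; apply: nNy; exact: subN.
  have [i _ Uiy] := AU _ (suppA _ sy); exists i => //.
  by have [_ _] := hV i; apply.
have mV i : measurable (V i) by have [] := hV i.
have h1 : (mu (good `\` N) <= \sum_(0 <= i <oo) mu (V i))%E.
  exact: measure_sigma_subadditive.
have h2 : (\sum_(0 <= i <oo) mu (V i) <= (32 `^ t)%:E * \sum_(0 <= i <oo) term i + (8^-1)%:E)%E.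
  rewrite -nneseriesZl//.
  apply: le_trans (epsilon_trick _ _ _); last 2 first.
  - by move=> i; rewrite mule_ge0// lee_fin powR_ge0.
  - by rewrite invr_ge0.
  by apply: lee_nneseries => // i _; have [] := hV i.
have h3 : (mu good <= mu (good `\` N))%E.
  have -> : mu good = (mu (good `\` N) + mu (good `&` N))%E by rewrite -measureDI.
  rewrite (_ : mu (good `&` N) = 0%E) ?adde0//.
  apply/eqP; rewrite eq_le measure_ge0 andbT -muN; apply: le_measure; rewrite ?inE//.
  exact: measurableI.
have := le_trans mu_good (le_trans h3 (le_trans h1 h2)).
have sumfin : (\sum_(0 <= i <oo) term i)%E \is a fin_num.
  rewrite ge0_fin_numE; last by apply: nneseries_ge0.
  by apply: lt_trans Uc _; exact: ltry.
rewrite -(fineK sumfin) -EFinM -EFinD lee_fin => h4.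
have : fine (\sum_(0 <= i <oo) term i)%E < c by rewrite -lte_fin fineK.
rewrite -(@ltr_pM2l _ (32 `^ t)) ?powR_gt0// /c invfM mulrCA mulfV ?gt_eqF ?powR_gt0//.
rewrite mulr1 => h5; move: (32 `^ t * _) h4 h5 => z; lra.
Qed.

Lemma dimF_le_dimH (R : realType) (A : set (R * R)) : (dimF A <= dimH A)%E.
Proof.
apply: ge_ereal_sup => _ [s [/andP[s0 s2] [mu [pA [C decay]]]] <-].
apply: le_ereal_inf_tmp => _ [t [t0 Ht] <-]; rewrite lee_fin leNgt; apply/negP => ts.
have s02 : 0 <= s <= 2 by rewrite s0.
have tts : 0 <= t < s by rewrite t0.
exact: (hausdorff_pos_of_decay pA s02 decay tts Ht).
Qed.

(** * The law of a random series *)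

Section Uniform.
Variable R : realType.

Definition unif : probability (measurableTypeR R) R := uniform_prob (@ltr01 R).

Lemma unif_itv (a b : R) : 0 <= a -> a <= b -> b <= 1 -> unif `[a, b[%classic = (b - a)%:E.
Proof.
move=> a0 ab b1.
rewrite /unif /= /uniform_prob (eq_integral (fun=> 1%:E)); last first.
  move=> x; rewrite inE/= in_itv/= /uniform_pdf => /andP[ax xb].
  by rewrite (le_trans a0 ax) (ltW (lt_le_trans xb b1)) subr0 invr1.
rewrite integral_cst//= mul1e lebesgue_measure_itv/= lte_fin.
by case: ltgtP ab => // -> _; rewrite subrr.
Qed.

Lemma measurable_trunc_eq (c : R) n : measurable [set t : R | Num.trunc (t * c) = n].
Proof.
have mle m : measurable [set t : R | (Num.trunc (t * c) <= m)%N].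
  have -> : [set t : R | (Num.trunc (t * c) <= m)%N] = (fun t => t * c) @^-1` `]-oo, m.+1%:R[.
    by apply/seteqP; split => t /=; rewrite in_itv/= truncn_le_nat.
  rewrite -[X in measurable X]setTI.
  by apply: (measurable_funM (@measurable_id _ _ _) (@measurable_cst _ _ _ _ _ c)).
case: n => [|n].
  have -> : [set t : R | Num.trunc (t * c) = 0%N] = [set t : R | (Num.trunc (t * c) <= 0)%N].
    by apply/seteqP; split => t /=; rewrite leqn0 => /eqP.
  exact: mle.
have -> : [set t : R | Num.trunc (t * c) = n.+1] =
  [set t : R | (Num.trunc (t * c) <= n.+1)%N] `\` [set t : R | (Num.trunc (t * c) <= n)%N].
  apply/seteqP; split => t /=; first by move=> ->; split => //; apply/negP; rewrite ltnn.
  by move=> [h1 /negP]; rewrite -ltnNge => h2; apply/eqP; rewrite eqn_leq h1.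
exact: measurableD.
Qed.

Lemma measurable_step (c : R) (g : nat -> R) :
  measurable_fun [set: R] (fun t => g (Num.trunc (t * c))).
Proof.
move=> _ Y mY; rewrite setTI.
have -> : (fun t => g (Num.trunc (t * c))) @^-1` Y =
    \bigcup_(n in [set n | Y (g n)]) [set t : R | Num.trunc (t * c) = n].
  apply/seteqP; split => t /=; first by move=> Yt; exists (Num.trunc (t * c)).
  by move=> [n /= Yn ->].
by apply: bigcup_measurable => n _; exact: measurable_trunc_eq.
Qed.

Lemma bmeas_step (c M : R) (g : nat -> R) : (forall n, `|g n| <= M) ->
  bmeas (fun t : R => g (Num.trunc (t * c))).
Proof. by move=> gM; split; [exact: measurable_step|exists M]. Qed.

(** For [t] uniform in [[0, 1)], [Num.trunc (t * Q)] is uniform below [Q]. All the finite choices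
    can therefore be read from the digits of one real number, without a product space. *)
Lemma Rintegral_step (Q : nat) (M : R) (g : nat -> R) : (0 < Q)%N ->
  (forall n, `|g n| <= M) ->
  (\int[unif]_t g (Num.trunc (t * Q%:R)) = Q%:R^-1 * \sum_(j < Q) g j)%R.
Proof.
move=> Q0 gM; have q0 : 0 < Q%:R :> R by rewrite ltr0n.
have M0 : 0 <= M := le_trans (normr_ge0 _) (gM 0%N).
pose I (j : nat) : set R := `[j%:R / Q%:R, j.+1%:R / Q%:R[%classic.
pose E : set R := ~` `[0, 1[%classic.
have mE : measurable E by apply: measurableC.
have mI j : measurable (I j) by exact: measurable_itv.
pose u (t : R) := g (Num.trunc (t * Q%:R)).
have bu : bmeas u by exact: bmeas_step gM.
have PE : unif E = 0%E.
  by rewrite probability_setC// unif_itv// subr0 subee.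
have tI (t : R) j : I j t -> Num.trunc (t * Q%:R) = j.
  rewrite /I /= in_itv/= => /andP[h1 h2]; apply: truncn_def.
  by rewrite -ler_pdivrMr// h1 -ltr_pdivlMr.
(* Outside [[0, 1)] the index is not controlled, but that set is null and [g] is bounded. *)
have uE t : u t = \sum_(j < Q) g j * \1_(I j) t + u t * \1_E t.
  have [tE|tnE] := pselect (E t).
    rewrite big1 => [|j _]; first by rewrite add0r indicE mem_set// mulr1.
    rewrite indicE memNset ?mulr0// => Ijt; apply: tE.
    move: Ijt; rewrite /I /= !in_itv/= => /andP[h1 h2]; rewrite (le_trans _ h1) ?divr_ge0//=.
    by apply: lt_le_trans h2 _; rewrite ler_pdivrMr// mul1r ler_nat.
  rewrite [X in _ + u t * X]indicE memNset// mulr0 addr0.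
  have : `[0, 1[%classic t by apply: contrapT.
  rewrite /= in_itv/= => /andP[t0 t1].
  have kQ : (Num.trunc (t * Q%:R) < Q)%N.
    by rewrite truncn_lt_nat ?mulr_ge0 ?(ltW q0)// gtr_pMl.
  have /andP[h1 h2] := truncn_itv (mulr_ge0 t0 (ltW q0)).
  rewrite (bigD1 (Ordinal kQ))//= big1 ?addr0 => [|j jk].
    rewrite indicE mem_set ?mulr1// /I /= in_itv/= ler_pdivrMr// h1 /=.
    by rewrite ltr_pdivlMr.
  rewrite indicE memNset ?mulr0// => /tI jE.
  by move/negP: jk; apply; apply/eqP/val_inj; rewrite /= jE.
have bI j : bmeas (fun t => g j * \1_(I j) t).
  by apply: bmeasM (bmeas_cst _) _; exact: bmeas_indic.
have bE : bmeas (fun t => u t * \1_E t) by apply: bmeasM bu _; exact: bmeas_indic.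
rewrite -[LHS]/(\int[unif]_t u t)%R.
under eq_Rintegral do rewrite uE.
rewrite RintegralD//; last 2 first.
- apply: bmeas_integrable; apply: bmeas_sum => j; exact: bI.
- exact: bmeas_integrable.
rewrite Rintegral_sum//.
have -> : (\int[unif]_t (u t * \1_E t) = 0)%R.
  apply/eqP; rewrite -normr_le0; apply: le_trans (le_normr_Rintegral _ _) _ => //.
    exact: bmeas_integrable.
  have bnE : bmeas (fun t => `|u t * \1_E t|).
    have [m [K hK]] := bE; split; last by exists K => t; rewrite normr_id.
    exact: measurableT_comp.
  apply: (@le_trans _ _ (\int[unif]_t (M * \1_E t))%R).
    apply: ler_bmeas => //; first by apply: bmeasM (bmeas_cst _) _; exact: bmeas_indic.
    move=> t; rewrite normrM; apply: ler_pM; rewrite ?normr_ge0//; first exact: gM.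
    by rewrite indicE; case: (_ \in _); rewrite ?normr1 ?normr0.
  rewrite RintegralZl//; last by apply: bmeas_integrable; exact: bmeas_indic.
  by rewrite /Rintegral integral_indic// setIT [X in fine X]PE mulr0.
rewrite addr0 mulr_sumr; apply: eq_bigr => j _.
rewrite RintegralZl//; last by apply: bmeas_integrable; exact: bmeas_indic (mI j).
rewrite /Rintegral integral_indic//; last exact: mI.
rewrite setIT [X in fine X]unif_itv ?divr_ge0 ?ler_pM2r ?invr_gt0 ?ler_nat//.
  by rewrite /= -mulrBl -natr1 addrAC subrr add0r mul1r mulrC.
by rewrite ler_pdivrMr// mul1r ler_nat.
exact: bI.
Qed.

End Uniform.

(** The independence of the last digit and the leading ones, in the form of a factorisation of
    sums. *)
Lemma sum_mixed_radix (A : comNzRingType) (h w : nat -> A) Q B : (0 < B)%N ->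
  \sum_(0 <= j < Q * B) h (j %/ B)%N * w (j %% B)%N =
  (\sum_(0 <= i < Q) h i) * (\sum_(0 <= r < B) w r).
Proof.
move=> B0; elim: Q => [|Q IH]; first by rewrite mul0n !(big_geq (leqnn 0)) mul0r.
rewrite mulSn addnC (@big_cat_nat _ _ _ (Q * B))//= ?leq_addr// IH.
rewrite big_nat_recr//= mulrDl; congr (_ + _).
rewrite -{1}(add0n (Q * B)%N) big_addn addKn mulr_sumr.
rewrite big_nat_cond [RHS]big_nat_cond; apply: eq_bigr => r; rewrite andbT => /andP[_ rB].
by rewrite addnC divnMDl// modnMDl divn_small// modn_small// addn0.
Qed.

(** Nested intervals: [u k - 2 * rho k] increases and [u k + 2 * rho k] decreases. *)
Lemma fast_limit (R : realType) (u rho : nat -> R) :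
  (forall k, `|u k.+1 - u k| <= rho k) -> (forall k, rho k.+1 <= rho k / 2) ->
  exists l, forall k, `|l - u k| <= 2 * rho k.
Proof.
move=> hu hr; have r0 k : 0 <= rho k := le_trans (normr_ge0 _) (hu k).
pose a k := u k - 2 * rho k; pose b k := u k + 2 * rho k.
have amono m n : (m <= n)%N -> a m <= a n.
  apply: (@homo_leq _ a <=%O) => // [x y z|k]; first exact: le_trans.
  by rewrite /a; have := hu k; rewrite ler_norml => /andP[h1 h2]; have := hr k; lra.
have bmono m n : (m <= n)%N -> b n <= b m.
  apply: (@homo_leq _ b (fun x y => y <= x)) => // [x y z h1 h2|k]; first exact: le_trans h2 h1.
  by rewrite /b; have := hu k; rewrite ler_norml => /andP[h1 h2]; have := hr k; lra.
have ab m k : a m <= b k.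
  apply: (le_trans (amono _ _ (leq_maxl m k))); apply: le_trans (bmono _ _ (leq_maxr m k)).
  by rewrite /a /b; have := r0 (maxn m k); lra.
exists (sup (range a)) => k.
have h1 : a k <= sup (range a).
  by apply: ub_le_sup; [exists (b 0%N) => _ [m _ <-]|exists k].
have h2 : sup (range a) <= b k.
  by apply: ge_sup; [exists (a 0%N), 0%N|move=> _ [m _ <-]].
by rewrite ler_norml; move: h1 h2; rewrite /a /b; lra.
Qed.

Lemma closed_msupport (R : realType) (mu : probability (R * R)%type R) : closed (msupport mu).
Proof.
rewrite -openC openE => x; rewrite /msupport /= => /existsNP[e /not_implyP[e0 /negP]].
rewrite -leNgt => mux; apply/nbhs_ballP; exists (e / 2) => /=; first by rewrite divr_gt0.
move=> y xy /(_ (e / 2)); rewrite divr_gt0// => /(_ isT); apply/negP; rewrite -leNgt.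
apply: le_trans mux; apply: le_measure; rewrite ?inE; try exact: measurable_ball2.
move=> z yz; have := ball_triangle xy yz; by rewrite -splitr.
Qed.

Lemma compact_msupport (R : realType) (mu : probability (R * R)%type R) (c : R) :
  (forall x, msupport mu x -> supn x <= c) -> compact (msupport mu).
Proof.
move=> hc; apply: (@subclosed_compact _ _ (`[- c, c] `*` `[- c, c])).
- exact: closed_msupport.
- by apply: compact_setX; exact: segment_compact.
- move=> x /hc; rewrite /supn ge_max /= !ler_norml => /andP[h1 h2].
  by split; rewrite /= in_itv.
Qed.

Section Walk.
Variables (R : realType) (V : nat -> seq R[i]) (rho : nat -> R).
Hypothesis V0 : forall k, (0 < size (V k))%N.
Hypothesis Vrho : forall k x, x \in V k -> normc x <= rho k.
Hypothesis rho_gt0 : forall k, 0 < rho k.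
Hypothesis rho_half : forall k, rho k.+1 <= rho k / 2.

Let Q K : nat := (\prod_(k < K) size (V k))%N.

Let QS K : Q K.+1 = (Q K * size (V K))%N.
Proof. by rewrite /Q big_ord_recr. Qed.

Let Q0 K : (0 < Q K)%N.
Proof. by apply: prodn_gt0 => k. Qed.

(* Reads [j < Q K] in the mixed radix [size (V k)] and adds the selected points. *)
Fixpoint walk K (j : nat) : R[i] :=
  if K is K'.+1 then
    walk K' (j %/ size (V K'))%N + nth 0 (V K') (j %% size (V K'))%N
  else 0.

Lemma sum_chi_walk z K :
  \sum_(0 <= j < Q K) chi z (walk K j) = \prod_(k < K) \sum_(x <- V k) chi z x.
Proof.
elim: K => [|K IH]; first by rewrite /Q !big_ord0 big_nat1 chi0.
rewrite QS big_ord_recr /= -IH [X in _ = _ * X](big_nth 0).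
rewrite -(sum_mixed_radix (fun j => chi z (walk K j)) (fun r => chi z (nth 0 (V K) r)))//.
by apply: eq_bigr => j _; exact: chiD.
Qed.

(** The partial sums and terms of the random series as functions of a uniform [t]; [jump K] reads
    the last digit of the expansion with [K + 1] digits. *)
Let pos K (t : R) : R[i] := walk K (Num.trunc (t * (Q K)%:R)).
Let jump K (t : R) : R[i] :=
  nth 0 (V K) (Num.trunc (t * (Q K.+1)%:R) %% size (V K))%N.

Let posS K t : pos K.+1 t = pos K t + jump K t.
Proof.
by rewrite /pos /= -/(jump K t) [in LHS]QS natrM mulrA truncn_mul_div.
Qed.

Let jump_in K t : jump K t \in V K.
Proof. by rewrite mem_nth// ltn_mod. Qed.

Let pos_sum K t : pos K t = \sum_(k < K) jump k t.
Proof.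
elim: K => [|K IH]; first by rewrite big_ord0.
by rewrite posS IH big_ord_recr.
Qed.

Let rho_ge0 k : 0 <= rho k := ltW (rho_gt0 k).

Let rho_geo k : rho k <= rho 0%N * 2^-1 ^+ k.
Proof.
elim: k => [|k IH]; first by rewrite expr0 mulr1.
apply: le_trans (rho_half k) _; rewrite exprSr mulrA ler_pM2r//.
Qed.

Let rho_cvg : rho k @[k --> \oo] --> 0.
Proof.
apply: (@squeeze_cvgr _ _ _ _ (fun=> 0) (geometric (rho 0%N) 2^-1)).
- by near=> k; rewrite rho_ge0 /= rho_geo.
- exact: cvg_cst.
- by apply: cvg_geometric; rewrite ger0_norm// invf_lt1// ltr1n.
Unshelve. all: by end_near. Qed.

Let limit_exists : {g : R -> R * R | forall t k,
  `|(g t).1 - Re (pos k t)| <= 2 * rho k /\ `|(g t).2 - Im (pos k t)| <= 2 * rho k}.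
Proof.
have h : forall t, exists x : R * R, forall k,
    `|x.1 - Re (pos k t)| <= 2 * rho k /\ `|x.2 - Im (pos k t)| <= 2 * rho k.
  move=> t.
have h1 k : `|Re (pos k.+1 t) - Re (pos k t)| <= rho k.
  rewrite posS raddfD /= addrAC subrr add0r; apply: le_trans (normc_Re _) _; exact: Vrho.
have h2 k : `|Im (pos k.+1 t) - Im (pos k t)| <= rho k.
  rewrite posS raddfD /= addrAC subrr add0r; apply: le_trans (normc_Im _) _; exact: Vrho.
have [l1 hl1] := fast_limit h1 rho_half; have [l2 hl2] := fast_limit h2 rho_half.
by exists (l1, l2) => k; split.
by apply: cid; have [g hg] := choice h; exists g.
Qed.

Let g := sval limit_exists.
Let gP t k : `|(g t).1 - Re (pos k t)| <= 2 * rho k /\ `|(g t).2 - Im (pos k t)| <= 2 * rho k.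
Proof. exact: (svalP limit_exists). Qed.

Let approx_cvg (a : nat -> R) (l : R) : (forall k, `|l - a k| <= 2 * rho k) ->
  a k @[k --> \oo] --> l.
Proof.
move=> h; apply/cvgrPdist_le => e e0.
have e2 : 0 < e / 2 by rewrite divr_gt0.
have /cvgr0_norm_le h2 := rho_cvg; have h3 := h2 _ e2.
near=> k; apply: le_trans (h k) _.
have : `|rho k| <= e / 2 by near: k.
by move=> /(le_trans (ler_norm _)); lra.
Unshelve. all: by end_near. Qed.

(** [g] comes from the axiom of choice, but it is the pointwise limit of the step functions
    [pos k]. *)
Let mg : measurable_fun [set: measurableTypeR R] (g : measurableTypeR R -> R * R).
Proof.
rewrite (_ : g = fun t => ((g t).1, (g t).2)); last by apply/funext => t; case: (g t).
apply/measurable_fun_pairP; split.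
  apply: (@measurable_fun_cvg _ _ _ _ (fun k t => Re (pos k t))) => [k|t _].
    exact: (measurable_step (Q k)%:R (fun j => Re (walk k j))).
  by apply: approx_cvg => k; have [] := gP t k.
apply: (@measurable_fun_cvg _ _ _ _ (fun k t => Im (pos k t))) => [k|t _].
  exact: (measurable_step (Q k)%:R (fun j => Im (walk k j))).
by apply: approx_cvg => k; have [] := gP t k.
Qed.

Let gX : measurableTypeR R -> R * R := g.
Let X : {mfun measurableTypeR R >-> (R * R)%type} :=
  HB.pack gX (isMeasurableFun.Build _ _ _ _ gX mg).
Let mu : probability (R * R)%type R := distribution (unif R) X.

Let Rint_mu (f : R * R -> R) : bmeas f ->
  (\int[mu]_x f x = \int[unif R]_t f (g t))%R.
Proof.
move=> bf; rewrite /Rintegral /mu integral_distribution//.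
  by apply/measurable_EFinP; case: bf.
apply: (@bmeas_integrable _ _ _ (unif R) (fun t => f (gX t))).
case: bf => mf [M hM]; split; last by exists M => t.
exact: measurableT_comp mf mg.
Qed.

Section Fourier.
Variable xi : R * R.
Let z : R[i] := Complex xi.1 (- xi.2).

Let dotE (x : R[i]) : dotp xi (Re x, Im x) = Re (z * x).
Proof. by case: x => a b; rewrite /dotp /z /=; ring. Qed.

Let delta k : R := 2 * pi * ((`|xi.1| + `|xi.2|) * (2 * rho k)).

Let phase_close t k :
  `|2 * pi * dotp xi (g t) - 2 * pi * Re (z * pos k t)| <= delta k.
Proof.
have [h1 h2] := gP t k.
rewrite -mulrBr normrM ger0_norm ?mulr_ge0 ?pi_ge0// /delta ler_wpM2l ?mulr_ge0 ?pi_ge0//.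
rewrite -dotE /dotp /=.
have -> : xi.1 * (g t).1 + xi.2 * (g t).2 - (xi.1 * Re (pos k t) + xi.2 * Im (pos k t)) =
  xi.1 * ((g t).1 - Re (pos k t)) + xi.2 * ((g t).2 - Im (pos k t)) by ring.
apply: le_trans (ler_normD _ _) _; rewrite !normrM mulrDl.
by rewrite lerD// ler_wpM2l.
Qed.

Let mdot : measurable_fun [set: R * R] (fun x => 2 * pi * dotp xi x).
Proof.
apply: measurable_funM => //; apply: measurable_funD; exact: measurable_funM.
Qed.

(** Compares [mu] with the law of the [k]-th partial sum. [F] is [cos] or [sin]; being 1-Lipschitz,
    it turns the distance of the phases into an error tending to 0 with [rho k]. *)
Let close_int (F : R -> R) k : continuous F -> (forall y, `|F y| <= 1) ->
  (forall x y, `|F x - F y| <= `|x - y|) ->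
  `|(\int[mu]_x F (2 * pi * dotp xi x))%R
    - (Q k)%:R^-1 * \sum_(j < Q k) F (2 * pi * Re (z * walk k j))| <= delta k.
Proof.
move=> cF F1 lF.
have b1 : bmeas (fun x => F (2 * pi * dotp xi x)).
  split; last by exists 1 => x.
  by apply: measurableT_comp mdot; exact: continuous_measurable_fun.
rewrite Rint_mu//.
pose a (j : nat) := F (2 * pi * Re (z * walk k j)).
have a1 j : `|a j| <= 1 by exact: F1.
rewrite -(@Rintegral_step R (Q k) 1 a)//.
have b2 : bmeas (fun t : measurableTypeR R => F (2 * pi * dotp xi (g t))).
  case: b1 => m1 [M hM]; split; last by exists M => t.
  exact: measurableT_comp m1 mg.
have b3 : bmeas (fun t : measurableTypeR R => a (Num.trunc (t * (Q k)%:R))).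
  exact: (@bmeas_step R (Q k)%:R 1 a).
rewrite -RintegralB//; try exact: bmeas_integrable.
have b4 := bmeasD b2 (bmeasM (bmeas_cst (-1)) b3).
have b5 : bmeas (fun t : measurableTypeR R => F (2 * pi * dotp xi (g t)) - a (Num.trunc (t * (Q k)%:R))).
  by move: b4; congr bmeas; apply/funext => t; rewrite mulN1r.
apply: le_trans (le_normr_Rintegral _ _) _ => //; first exact: bmeas_integrable.
apply: (@le_trans _ _ (\int[unif R]_t (cst (delta k) t))%R).
  apply: ler_bmeas; last by move=> t; apply: le_trans (lF _ _) _; exact: phase_close.
    case: b5 => m5 [M hM]; split; first exact: measurableT_comp.
    by exists M => t; rewrite normr_id.
  exact: bmeas_cst.
by rewrite Rintegral_cst// [X in fine X]probability_setT mulr1.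
Qed.

(** The transform of the [k]-th partial sum is a product of averages of modulus at most 1. Only the
    [n]-th is kept, before [k] tends to infinity; [n] can then be adapted to the frequency. *)
Lemma fourier_limit_law n : fourier_sq mu xi <= avg_chi (V n) z ^+ 2.
Proof.
pose c := (\int[mu]_x cos (2 * pi * dotp xi x))%R.
pose s := (\int[mu]_x sin (2 * pi * dotp xi x))%R.
have -> : fourier_sq mu xi = c ^+ 2 + s ^+ 2.
  rewrite /fourier_sq; congr (_ + _); rewrite -[RHS]sqrrN; congr (_ ^+ 2).
  rewrite -[LHS]/(\int[mu]_x (- sin (2 * pi * dotp xi x)))%R.
  under eq_Rintegral do rewrite -mulN1r.
  rewrite RintegralZl//; first by rewrite mulN1r.
  apply: bmeas_integrable; split; last by exists 1 => x; exact: sin_max.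
  by apply: measurableT_comp mdot; apply: continuous_measurable_fun; exact: continuous_sin.
rewrite -[c ^+ 2 + _]/(Re (Complex c s) ^+ 2 + Im (Complex c s) ^+ 2) -sqr_normcE.
rewrite lerXn2r ?nnegrE ?normc_ge0 ?avg_chi_ge0//.
have step k : (n < k)%N -> normc (Complex c s) <= avg_chi (V n) z + 2 * delta k.
  move=> nk; pose S : R[i] := Complex ((Q k)%:R^-1 * \sum_(j < Q k) cos (2 * pi * Re (z * walk k j)))
     ((Q k)%:R^-1 * \sum_(j < Q k) sin (2 * pi * Re (z * walk k j))).
  have hc := close_int k (@continuous_cos R) (@cos_max R) (@normr_cosB_le R).
  have hs := close_int k (@continuous_sin R) (@sin_max R) (@normr_sinB_le R).
  have hS : normc S <= avg_chi (V n) z.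
    have SE : normc S = (Q k)%:R^-1 * normc (\sum_(0 <= j < Q k) chi z (walk k j)).
      rewrite -[X in X * _](@ger0_norm R) ?invr_ge0//.
      have -> : `|(Q k)%:R^-1 : R| = normc (Complex ((Q k)%:R^-1) 0).
        by rewrite /normc expr0n addr0 sqrtr_sqr.
      rewrite -normcM big_mkord; congr normc.
      have -> : \sum_(j < Q k) chi z (walk k j) =
         Complex (\sum_(j < Q k) cos (2 * pi * Re (z * walk k j))) (\sum_(j < Q k) sin (2 * pi * Re (z * walk k j))).
        elim/big_rec3: _ => // j x1 x2 _ _ ->.
        by rewrite /chi /expi.
      by rewrite /S; congr Complex; rewrite /= mul0r ?subr0 ?addr0.
    rewrite SE sum_chi_walk.
    have normc_prod (m : nat) : normc (\prod_(j < m) \sum_(x <- V j) chi z x) =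
       \prod_(j < m) normc (\sum_(x <- V j) chi z x).
      by elim/big_rec2: _ => [|j x y _ <-]; rewrite ?normc1 ?normcM.
    rewrite normc_prod /Q natr_prod -prodfV -big_split /=.
    rewrite (bigD1 (Ordinal nk))//= -[leRHS]mulr1 ler_pM//.
    - by rewrite mulr_ge0 ?normc_ge0.
    - by apply: prodr_ge0 => j _; rewrite mulr_ge0 ?normc_ge0.
    - by rewrite mulrC.
    - by apply: prodr_ile1 => j _; rewrite mulr_ge0 ?normc_ge0// mulrC; exact: avg_chi_le1.
  rewrite -(subrK S (Complex c s)) addrC; apply: le_trans (le_normcD _ _) _.
  rewrite lerD//; apply: le_trans (normc_le _) _.
  by rewrite mulr_natl mulr2n lerD.
have dcvg : 2 * delta k @[k --> \oo] --> 0.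
  rewrite (_ : (fun k => 2 * delta k) = (fun k => (2 * (2 * pi * (`|xi.1| + `|xi.2|) * 2)) * rho k)); last first.
    by apply/funext => k; rewrite /delta; ring.
  rewrite -[X in _ --> X](mulr0 (2 * (2 * pi * (`|xi.1| + `|xi.2|) * 2))).
  by apply: cvgM; [exact: cvg_cst|exact: rho_cvg].
apply/ler_addgt0Pr => e e0; have /cvgr0_norm_le h := dcvg; have h2 := h _ e0.
near \oo => k; apply: le_trans (step k _) _; first by near: k; exact: nbhs_infty_gt.
rewrite lerD2l; apply: le_trans (ler_norm _) _; by near: k.
Unshelve. all: by end_near. Qed.

End Fourier.

(** A ball of positive mass around [x] contains some [g t], whose jumps are taken. Per coordinate
    the error is [rho k] for the ball and [2 * rho k] for the tail, whence 6 in total. *)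
Let support_near x k : msupport mu x -> exists s : nat -> R[i],
  (forall j, s j \in V j) /\
  normc (Complex x.1 x.2 - \sum_(j < k) s j) <= 6 * rho k.
Proof.
move=> /(_ (rho k) (rho_gt0 k)) mux.
have [t gt] : exists t, ball x (rho k) (g t).
  apply: contrapT => none; move: mux; apply/negP; rewrite -leNgt.
  rewrite (_ : mu _ = 0%E)//; rewrite -[LHS]/(unif R (g @^-1` ball x (rho k))).
  rewrite (_ : g @^-1` _ = set0) ?measure0//; apply/seteqP; split => // t gt.
  by apply: none; exists t.
exists (jump ^~ t); split; first by move=> j; exact: jump_in.
rewrite -pos_sum; have [h1 h2] := gP t k.
have [b1 b2] : `|x.1 - (g t).1| < rho k /\ `|x.2 - (g t).2| < rho k by [].
apply: le_trans (normc_le _) _; rewrite !raddfB /=.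
have e1 := ler_distD (g t).1 x.1 (Re (pos k t)); have e2 := ler_distD (g t).2 x.2 (Im (pos k t)).
lra.
Qed.

Lemma limit_law : exists mu : probability (R * R)%type R,
  [/\ forall xi n, fourier_sq mu xi <= avg_chi (V n) (Complex xi.1 (- xi.2)) ^+ 2,
      compact (msupport mu) &
      forall x, msupport mu x -> forall k, exists s : nat -> R[i],
        (forall j, s j \in V j) /\
        normc (Complex x.1 x.2 - \sum_(j < k) s j) <= 6 * rho k].
Proof.
exists mu; split; first by move=> xi n; exact: fourier_limit_law.
  apply: (@compact_msupport R mu (6 * rho 0%N)) => x /(support_near 0)[s [_]].
  rewrite big_ord0 subr0; apply: le_trans.
  have := normc_Re (Complex x.1 x.2); have := normc_Im (Complex x.1 x.2).
  by rewrite /supn ge_max /= => -> ->.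
by move=> x mux k; exact: support_near.
Qed.

End Walk.

(** * Construction of the measures *)

Lemma gintM (R : realType) (q r : int * int) :
  gint R q * gint R r = gint R (q.1 * r.1 - q.2 * r.2, q.1 * r.2 + q.2 * r.1).
Proof.
rewrite /gint /=; congr Complex; first by rewrite rmorphB !rmorphM.
by rewrite rmorphD !rmorphM.
Qed.

Lemma gintD (R : realType) (q r : int * int) :
  gint R q + gint R r = gint R (q.1 + r.1, q.2 + r.2).
Proof. by rewrite /gint /= !rmorphD. Qed.

Lemma supn_Re_Im_le (R : realType) (w : R[i]) : supn (Re w, Im w) <= normc w.
Proof. by rewrite /supn ge_max normc_Re normc_Im. Qed.

Section Construction.
Variables (R : realType) (tau s : R).
Hypothesis tau_gt : -1 < tau.
Hypothesis s02 : 0 <= s <= 2.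
Hypothesis s_lt : s < 4 / (1 + tau).

(** Points are approximated to the exponent [t0 - 1 = max 0 tau], which is enough for [Estar tau]
    and keeps all exponents at least 1. The slack [theta] makes [alpha] exceed [t0], to beat the
    earlier denominators, and [beta] exceed [alpha], to gain decay in the gaps. Its denominator
    keeps [2 * theta * sigma] below half of [2 - sigma * t0]. *)
Let t0 : R := Num.max 1 (1 + tau).
Let sigma : R := s / 2.
Let theta : R := (2 - sigma * t0) / (4 * (sigma + 1)).
Let alpha : R := t0 + theta.
Let beta : R := t0 + 2 * theta.

Let sigma_ge0 : 0 <= sigma.
Proof. by case/andP: s02 => h _; rewrite divr_ge0. Qed.

Let t0_ge1 : 1 <= t0. Proof. by rewrite le_max lexx. Qed.

Let sigma_t0 : sigma * t0 < 2.
Proof.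
have /andP[_ h2] := s02; rewrite /sigma /t0; have t1 : 0 < 1 + tau by have := tau_gt; lra.
have := s_lt; rewrite ltr_pdivlMr// => h; case: (leP 1 (1 + tau)) => _; last by lra.
by rewrite mulrAC ltr_pdivrMr//; lra.
Qed.

Let theta_gt0 : 0 < theta.
Proof. by rewrite divr_gt0 ?subr_gt0// mulr_gt0//; have := sigma_ge0; lra. Qed.

Let beta_ge1 : 1 <= beta.
Proof. by rewrite /beta; have := t0_ge1; have := theta_gt0; lra. Qed.

Let alpha_lt : alpha < beta.
Proof. by rewrite /alpha /beta; have := theta_gt0; lra. Qed.

Let alpha_gt0 : 0 < alpha.
Proof. by rewrite /alpha; have := t0_ge1; have := theta_gt0; lra. Qed.

Let sigma_beta : sigma * beta < 2.
Proof.
have s1 : 0 < sigma + 1 by have := sigma_ge0; lra.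
have thE : theta * (4 * (sigma + 1)) = 2 - sigma * t0.
  by rewrite /theta divfK// mulf_neq0// gt_eqF.
rewrite /beta; have := theta_gt0; have := sigma_t0; have := sigma_ge0; nra.
Qed.

(** In a gap each of the [N] factors gains [r^-(1 - alpha / beta)], and [r^-sigma] is wanted. *)
Let N1 : nat := (Num.trunc (sigma / (1 - alpha / beta))).+1.

(** Requirements on a scale, given the bound [rho] on its terms and the bound [H] on the product of
    the earlier denominators. The inequalities on [M] give fast growth, halve the next radius, and
    make the next radius small against the new total denominator. *)
Let good (N : nat) (K rho H : R) (M : nat) (V : seq R[i]) :=
 [/\ [/\ (2 <= M)%N, H <= M%:R, M%:R `^ (- alpha) <= rho / 2 & 6 * (4 * H) `^ t0 <= M%:R `^ theta],
     (0 < size V)%N,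
    forall x, x \in V -> normc x <= rho /\ gauss_frac M%:R x,
    forall z, M%:R / 2 <= normc z <= M%:R `^ beta ->
      avg_chi V z <= normc z `^ (- sigma) &
    forall z, 0 < normc z <= M%:R / 2 -> avg_chi V z <= (K / (rho * normc z)) ^+ N].

(** Stated for every pair [(rho, H)], with the positivity conditions as premises, so that choice
    yields a total function to iterate. *)
Let stage_exists : exists2 N, (N1 <= N)%N & exists2 K : R, 0 < K &
  forall p : R * R, exists MV : nat * seq R[i],
    0 < p.1 -> 1 <= p.2 -> good N K p.1 p.2 MV.1 MV.2.
Proof.
have [N N1N [K K0 hK]] := decaying_family N1 sigma_ge0 beta_ge1 sigma_beta.
exists N => //; exists K => // -[rho H] /=.
have [rho0|] := ltP 0 rho; last by exists (0%N, [::]).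
have [Ma hMa] := hK rho rho0.
have [Mb hMb] := eventually_le_powR H ltr01.
have [Mc hMc] := eventually_le_powR (2 / rho) alpha_gt0.
have [Md hMd] := eventually_le_powR (6 * (4 * H) `^ t0) theta_gt0.
pose M := maxn 2 (maxn Ma (maxn Mb (maxn Mc Md))).
have : (M <= M)%N by []; rewrite {1}/M !geq_max => /and5P[M2 /hMa[V [V1 V2 V3 V4]] /hMb lb /hMc lc /hMd ld].
exists (M, V) => _ _; split => //; split => //.
  by move: lb; rewrite powRr1.
rewrite powRN -[rho / 2]invrK lef_pV2 ?posrE ?invr_gt0 ?divr_gt0 ?powR_gt0 ?ltr0n//; last first.
  by apply: leq_trans M2.
by rewrite invfM invrK mulrC.
Qed.

(** The common denominator is the product of all denominators. Its lower bound [2^k] later shows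
    that infinitely many different denominators occur. *)
Let approx_rational (w : nat -> R[i]) (M : nat -> nat) (H : nat -> R) :
  H 0%N = 1 -> (forall k, H k.+1 = 4 * H k * (M k)%:R) -> (forall k, (2 <= M k)%N) ->
  (forall j, gauss_frac (M j)%:R (w j)) -> forall k, exists Q A : int * int,
  [/\ 2 ^+ k <= normc (gint R Q), normc (gint R Q) <= H k &
      \sum_(j < k) w j = gint R A / gint R Q].
Proof.
move=> H0 HS M2 wfrac; elim=> [|k [Q [A [Q1 Q2 QE]]]].
  exists (1, 0), (0, 0); rewrite big_ord0 expr0 H0.
  have -> : gint R (1, 0) = 1 by [].
  by rewrite normc1 lexx invr1 mulr1.
have [q [a [q1 q2 qE]]] := wfrac k.
have Qpos : 0 < normc (gint R Q) by apply: lt_le_trans Q1; rewrite exprn_gt0.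
have qpos : 0 < normc (gint R q) by apply: lt_le_trans q1; rewrite ltr0n (leq_trans _ (M2 k)).
have neq0 (x : R[i]) : 0 < normc x -> x != 0 by apply: contraTneq => ->; rewrite normc0 ltxx.
exists (Q.1 * q.1 - Q.2 * q.2, Q.1 * q.2 + Q.2 * q.1).
exists ((A.1 * q.1 - A.2 * q.2) + (a.1 * Q.1 - a.2 * Q.2),
        (A.1 * q.2 + A.2 * q.1) + (a.1 * Q.2 + a.2 * Q.1)).
rewrite -gintM normcM; split.
- rewrite exprSr ler_pM// ?exprn_ge0//; apply: le_trans q1.
  by rewrite ler_nat.
- by rewrite HS (mulrC 4) -mulrA; apply: ler_pM; rewrite ?normc_ge0.
- rewrite -[X in _ = X / _](gintD R (A.1 * q.1 - A.2 * q.2, A.1 * q.2 + A.2 * q.1)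
    (a.1 * Q.1 - a.2 * Q.2, a.1 * Q.2 + a.2 * Q.1)) -!gintM big_ord_recr /= QE qE.
  by field; rewrite !neq0.
Qed.

Lemma salem_measure : exists mu : probability (R * R)%type R, probP (Estar tau) mu /\
  exists C : R, forall xi : R * R, xi != 0 -> fourier_sq mu xi * (supn xi) `^ s <= C.
Proof.
have [N N1N [K K0 /choice[m hm]]] := stage_exists.
(* The state is the radius of the current terms together with a bound for the product of the
   previous denominators. *)
pose st := fix st (k : nat) : R * R := if k is k'.+1 then
  let p := st k' in ((m p).1%:R `^ (- alpha), 4 * p.2 * (m p).1%:R) else (1, 1).
pose M k := (m (st k)).1; pose V k := (m (st k)).2.
pose rho k := (st k).1; pose H k := (st k).2.
have inv k : 0 < rho k /\ 1 <= H k.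
  elim: k => [|k [r0 h1]]; first by rewrite /rho /H.
  have [[M2 _ _ _] _ _ _ _] := hm (st k) r0 h1.
  have M1 : 1 <= (M k)%:R :> R by rewrite ler1n (leq_trans _ M2).
  split; first by rewrite /rho /= powR_gt0// (lt_le_trans ltr01 M1).
  rewrite /H /= -/(M k) -/(H k); have : 1 <= H k * (M k)%:R by rewrite -[leLHS]mulr1 ler_pM.
  lra.
have G k : good N K (rho k) (H k) (M k) (V k) by have [r0 h1] := inv k; exact: hm.
have M2 k : (2 <= M k)%N by have [[]] := G k.
have M0 k : 0 < (M k)%:R :> R by rewrite ltr0n (leq_trans _ (M2 k)).
have HM k : H k <= (M k)%:R by have [[]] := G k.
have HS k : H k.+1 = 4 * H k * (M k)%:R by [].
have rhoS k : rho k.+1 = (M k)%:R `^ (- alpha) by [].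
have [mu [mu_decay mu_compact mu_supp]] : exists mu : probability (R * R)%type R,
  [/\ forall xi n, fourier_sq mu xi <= avg_chi (V n) (Complex xi.1 (- xi.2)) ^+ 2,
      compact (msupport mu) &
      forall x, msupport mu x -> forall k, exists s : nat -> R[i],
        (forall j, s j \in V j) /\
        normc (Complex x.1 x.2 - \sum_(j < k) s j) <= 6 * rho k].
  apply: limit_law.
  - by move=> k; have [] := G k.
  - by move=> k x xV; have [_ _ h _ _] := G k; have [] := h x xV.
  - by move=> k; have [] := inv k.
  - by move=> k; rewrite rhoS; have [[]] := G k.
exists mu; split.
  split => // x /mu_supp xs.
  apply: (@infinite_unbounded _ _ (fun qr => `|qr.1.1| + `|qr.1.2|)%N) => n.
  have [w [wV wx]] := xs n.+1.
  have [||||Q [A [Q1 Q2 QE]]] := @approx_rational w M H _ _ _ _ n.+1 => //.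
    by move=> j; have [_ _ h _ _] := G j; have [] := h _ (wV j).
  have Qn1 : 1 <= normc (gint R Q) by apply: le_trans Q1; rewrite exprn_ege1// ler1n.
  have Q0 : gint R Q != 0.
    by apply: contraTneq Qn1 => ->; rewrite normc0 -ltNge ltr01.
  exists (Q, A) => /=.
    split; first by apply: contraNneq Q0 => ->.
    apply: (@le_trans _ _ (normc (gint R Q) * (6 * rho n.+1))).
      have -> : cmul (gauss R Q) x - gauss R A =
          (Re (gint R Q * Complex x.1 x.2 - gint R A), Im (gint R Q * Complex x.1 x.2 - gint R A)).
        by [].
      apply: le_trans (supn_Re_Im_le _) _.
      have -> : gint R Q * Complex x.1 x.2 - gint R A = gint R Q * (Complex x.1 x.2 - \sum_(j < n.+1) w j).
        by rewrite QE mulrBr mulrCA divff// mulr1.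
      by rewrite normcM ler_wpM2l ?normc_ge0.
    have q1 : 1 <= supn (gauss R Q) by apply: supn_gauss_ge1; apply: contraNneq Q0 => ->.
    have qQ : supn (gauss R Q) <= normc (gint R Q) by exact: (supn_Re_Im_le (gint R Q)).
    (* [t0 - 1 >= tau], and [t0 - 1 >= 0] allows the passage from the sup norm to the larger
       [normc]. *)
    apply: (@le_trans _ _ (supn (gauss R Q) `^ (- (t0 - 1)))); last first.
      by apply: ler_powR => //; rewrite lerN2 lerBrDl /t0 le_max lexx orbT.
    apply: (@le_trans _ _ (normc (gint R Q) `^ (- (t0 - 1)))); last first.
      rewrite !powRN lef_pV2 ?posrE ?powR_gt0 ?(lt_le_trans ltr01)//.
      rewrite ge0_ler_powR ?nnegrE ?normc_ge0 ?supn_ge0// subr_ge0; exact: t0_ge1.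
    set y := normc (gint R Q) in Q2 Qn1 qQ *.
    have y0 : 0 < y by exact: lt_le_trans Qn1.
    rewrite opprB powR_add// (powRr1 (ltW y0)) ler_pM2l// rhoS !powRN.
    rewrite ler_pdivrMr ?powR_gt0// mulrC ler_pdivlMr ?powR_gt0//.
    (* The claim is now [6 * y^t0 <= M^alpha] with [M = M n]. It follows from [y <= 4 * H n * M] and
       [6 * (4 * H n)^t0 <= M^theta], since [alpha = t0 + theta]. *)
    apply: (@le_trans _ _ (6 * ((4 * H n) `^ t0 * (M n)%:R `^ t0))).
      rewrite ler_pM2l// -powRM ?(ltW (M0 n))//; last first.
        by have [_ h] := inv n; rewrite mulr_ge0// (le_trans _ h).
      rewrite -HS ge0_ler_powR ?nnegrE ?(ltW y0)//.
        exact: le_trans t0_ge1.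
      exact: le_trans (ltW y0) Q2.
    rewrite mulrA /alpha addrC powR_add// ler_pM2r ?powR_gt0//.
    by have [[]] := G n.
  rewrite -(ltr_nat R); apply: lt_le_trans (_ : normc (gint R Q) <= _).
    apply: lt_le_trans Q1; rewrite -natrX ltr_nat; exact: ltnW (ltn_expl _ _).
  apply: le_trans (normc_le _) _; rewrite /gint /= natrD.
  by rewrite !natr_absz !intr_norm.
have Mpow k : 2 ^+ k <= (M k)%:R :> R.
  elim: k => [|k IH]; first by rewrite expr0 ler1n (leq_trans _ (M2 0%N)).
  apply: le_trans (HM k.+1); rewrite HS exprS; have [_ h] := inv k.
  rewrite -mulrA ler_pM ?exprn_ge0 ?ler_nat//.
  by apply: le_trans IH _; rewrite ler_peMl ?(ltW (M0 k)).
have ab : 0 < 1 - alpha / beta.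
  rewrite subr_gt0 ltr_pdivrMr ?mul1r; first exact: alpha_lt.
  exact: lt_le_trans beta_ge1.
have NE : sigma <= (1 - alpha / beta) * N%:R.
  rewrite mulrC -ler_pdivrMr//; apply/ltW/(lt_le_trans (truncnS_gt _)).
  by rewrite ler_nat.
(* One summand for each range of frequencies: the ranges [[M k / 2, M k ^ beta]], the part below
   [M 0 / 2] where the trivial bound is used, and the gaps. *)
pose C := 1 + (M 0%N)%:R `^ sigma + K ^+ N.
have C1 : 1 <= C.
  rewrite /C -addrA lerDl addr_ge0 ?powR_ge0// exprn_ge0// ltW//.
have C2 : (M 0%N)%:R `^ sigma <= C.
  by rewrite /C addrAC lerDr addr_ge0// exprn_ge0// ltW.
have C3 : K ^+ N <= C by rewrite /C lerDr addr_ge0// powR_ge0.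
have avg_le (z : R[i]) : 0 < normc z ->
    exists n, avg_chi (V n) z <= C * normc z `^ (- sigma).
  set r := normc z => r0.
  have rs0 : 0 < r `^ (- sigma) by rewrite powR_gt0.
  have exP : exists m, r < (M m)%:R / 2.
    exists (Num.trunc (2 * r)).+1; rewrite ltr_pdivlMr// mulrC.
    apply: lt_le_trans (truncnS_gt _) _; apply: le_trans (Mpow _).
    by rewrite -natrX ler_nat ltnW// ltn_expl.
  case: (ex_minnP exP) => -[|k] rm minm.
    exists 0%N; apply: le_trans (avg_chi_le1 _ _) _.
    apply: (@le_trans _ _ ((M 0%N)%:R `^ sigma * r `^ (- sigma))); last by rewrite ler_pM2r.
    rewrite powRN ler_pdivlMr ?powR_gt0// mul1r ge0_ler_powR ?nnegrE ?(ltW r0) ?(ltW (M0 0%N))//.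
    by apply/ltW/(lt_le_trans rm); rewrite ler_pdivrMr// ler_peMr ?ler1n// ltW.
  have kr : (M k)%:R / 2 <= r.
    by rewrite leNgt; apply/negP => /minm; rewrite ltnn.
  have [rb|rb] := leP r ((M k)%:R `^ beta).
    exists k; have [_ _ _ h _] := G k.
    apply: le_trans (h z _) _; first by rewrite -/r kr.
    by rewrite -/r ler_peMl// ltW.
  (* In the gap the bound is [(K * (M k)^alpha / r)^N] because [rho k.+1 = (M k)^-alpha]. From
     [r > (M k)^beta] it is at most [K^N * r^(-(1 - alpha / beta) * N)], and [N >= N1]. *)
  exists k.+1; have [_ _ _ _ h] := G k.+1.
  apply: le_trans (h z _) _; first by rewrite -/r r0 ltW.
  rewrite -/r rhoS powRN invfM invrK exprMn.
  have b0 : 0 < beta by exact: lt_le_trans beta_ge1.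
  have r1 : 1 <= r.
    apply: ltW; apply: le_lt_trans rb; rewrite -[leLHS](powRr0 (M k)%:R).
    by rewrite ler_powR ?(ltW b0)// ler1n (leq_trans _ (M2 k)).
  have Mr : (M k)%:R `^ alpha <= r `^ (alpha / beta).
    have -> : (M k)%:R `^ alpha = ((M k)%:R `^ beta) `^ (alpha / beta).
      by rewrite -powRrM mulrC divfK// gt_eqF.
    have ab0 : 0 <= alpha / beta by rewrite divr_ge0// ltW// alpha_gt0.
    by rewrite ge0_ler_powR ?nnegrE ?powR_ge0 ?(ltW r0) ?(ltW rb).
  apply: ler_pM => //; rewrite ?exprn_ge0 ?mulr_ge0 ?powR_ge0 ?invr_ge0 ?(ltW K0) ?(ltW r0)//.
  apply: (@le_trans _ _ ((r `^ (alpha / beta - 1)) ^+ N)).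
    have -> : r `^ (alpha / beta - 1) = r `^ (alpha / beta) / r.
      by rewrite powR_add// (powRN _ 1) powRr1// ltW.
    have ri : 0 <= r^-1 by rewrite invr_ge0 ltW.
    by rewrite lerXn2r ?nnegrE ?mulr_ge0 ?powR_ge0// ler_wpM2r.
  rewrite -powR_mulrn ?powR_ge0// -powRrM ler_powR//.
  by rewrite -opprB mulNr lerN2.
exists (C ^+ 2) => xi xi0; pose z : R[i] := Complex xi.1 (- xi.2).
have xz : supn xi <= normc z.
  by have := supn_Re_Im_le z; rewrite /supn /= normrN.
have z0 : 0 < normc z.
  apply: lt_le_trans xz; rewrite lt_neqAle supn_ge0 andbT eq_sym.
  apply: contra xi0 => /eqP h; have : supn xi <= 0 by rewrite h.
  by rewrite /supn ge_max !normr_le0 => /andP[/eqP h1 /eqP h2]; rewrite [xi]surjective_pairing h1 h2.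
have [n hn] := avg_le z z0.
have /andP[s0 _] := s02.
apply: (@le_trans _ _ ((C * normc z `^ (- sigma)) ^+ 2 * normc z `^ s)).
  apply: ler_pM; [exact: fourier_sq_ge0|exact: powR_ge0| |].
    apply: le_trans (mu_decay xi n) _; rewrite -/z.
    by rewrite lerXn2r ?nnegrE ?avg_chi_ge0// (le_trans _ hn)// avg_chi_ge0.
  by rewrite ge0_ler_powR ?nnegrE ?supn_ge0 ?normc_ge0.
rewrite exprMn -mulrA -[(_ `^ _) ^+ 2]powR_mulrn ?powR_ge0// -powRrM -powR_add//.
have -> : - sigma * 2%:R + s = 0 by rewrite /sigma; field.
by rewrite powRr0 mulr1.
Qed.

End Construction.

Lemma dimF_Estar_ge (R : realType) (tau : R) : -1 < tau ->
  ((Num.min (4 / (1 + tau)) 2)%:E <= dimF (Estar tau))%E.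
Proof.
move=> t1; have t0 : 0 < 1 + tau by lra.
set m := Num.min _ _; have m0 : 0 < m by rewrite lt_min divr_gt0/=.
apply/lee_addgt0Pr => e e0.
(* The maximum keeps [s] in the admissible range when [e] exceeds [m]. *)
pose s := Num.max 0 (m - e).
have s0 : 0 <= s by rewrite le_max lexx.
have sm : s < m by rewrite gt_max m0 /= ltrBlDr ltrDl.
have /andP[sm1 sm2] : (s < 4 / (1 + tau)) && (s < 2) by rewrite -lt_min.
have s02 : 0 <= s <= 2 by rewrite s0 ltW.
have [mu [pmu [C hC]]] := salem_measure t1 s02 sm1.
apply: (@le_trans _ _ (s%:E + e%:E)%E).
  by rewrite -EFinD lee_fin -lerBlDr le_max lexx orbT.
rewrite leeD2r//; apply: ereal_sup_ubound; exists s => //; split => //.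
by exists mu; split => //; exists C.
Qed.

Theorem theorem2 (R : realType) (tau : R) (htau : -1 < tau) :
  salem (Estar tau) /\
  dimH (Estar tau) = (Num.min (4 / (1 + tau)) 2)%:E /\
  dimF (Estar tau) = (Num.min (4 / (1 + tau)) 2)%:E.
Proof.
have h1 := dimF_Estar_ge htau; have h2 := dimH_Estar_le htau.
have h3 := dimF_le_dimH (Estar tau).
have eH : dimH (Estar tau) = (Num.min (4 / (1 + tau)) 2)%:E.
  by apply/eqP; rewrite eq_le h2 (le_trans h1).
have eF : dimF (Estar tau) = (Num.min (4 / (1 + tau)) 2)%:E.
  by apply/eqP; rewrite eq_le h1 (le_trans h3).
by rewrite /salem eH eF.
Qed.
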